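(* Let $M$ be a smooth, finite dimensional, orientable closed manifold and $\mu$ a volume form on $M$. The family $(\mathcal K_M^\infty(k,l))_{k,l\in\mathbb N_0}$ of smooth generalised kernels (with the structure given in the context) is a TRAP, and: 1. The vertical concatenation of two kernels is their generalised convolution: for all $(k,l,m)\in\mathbb N_0^3$, $K_1\in\mathcal K_M^\infty(k,l)$, $K_2\in\mathcal K_M^\infty(l,m)$ and $(x_1,\dots,x_k,z_1,\dots,z_m)\in M^{k+m}$, $$(K_2\circ K_1)(x_1,\dots,x_k,z_1,\dots,z_m)=t_{k+1,1}\circ\cdots\circ t_{k+l-1,l-1}\circ t_{k+l,l}(K_1\otimes K_2)(x_1,\dots,x_k,z_1,\dots,z_m)$$ $$=\int_{M^l}K_1(x_1,\dots,x_k,y_1,\dots,y_l)\,K_2(y_1,\dots,y_l,z_1,\dots,z_m)\,d\mu(y_1)\cdots d\mu(y_l).$$ 2. The associativity property $K_3\circ(K_2\circ K_1)=(K_3\circ K_2)\circ K_1$, for any $K_3\in\mathcal K_M^\infty(m,n)$, amounts to the Fubini property $$\int_{M^m}\Big(\int_{M^l}K_1(\vec x,\vec y_1)K_2(\vec y_1,\vec y_2)\,d\vec\mu(\vec y_1)\Big)K_3(\vec y_2,\vec z)\,d\vec\mu(\vec y_2)=\int_{M^l}K_1(\vec x,\vec y_1)\Big(\int_{M^m}K_2(\vec y_1,\vec y_2)K_3(\vec y_2,\vec z)\,d\vec\mu(\vec y_2)\Big)d\vec\mu(\vec y_1)$$ for all $\vec x\in M^k$, $\vec z\in M^n$, where $d\vec\mu$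 denotes the product measure $d\mu\cdots d\mu$ on the relevant power of $M$. 3. The generalised trace of $K\in\mathcal K_M^\infty(k,k)$ is $$\mathrm{Tr}(K)=\int_{M^k}K(x_1,\dots,x_k,x_1,\dots,x_k)\,d\mu(x_1)\cdots d\mu(x_k),$$ and it satisfies $\mathrm{Tr}(K_2\circ K_1)=\mathrm{Tr}(K_1\circ K_2)$ for $K_1\in\mathcal K_M^\infty(k,l)$, $K_2\in\mathcal K_M^\infty(l,k)$. 4. The $\mathcal K_M^\infty$-amplitude $\Phi:\mathrm{solCGr}(\mathcal K_M^\infty)\to\mathcal K_M^\infty$ is compatible with the horizontal and vertical concatenations in $\mathcal K_M^\infty$, i.e. $\Phi(G_1*G_2)=\Phi(G_1)*\Phi(G_2)$, and $\Phi(G_1\circ G_2)=\Phi(G_1)\circ\Phi(G_2)$ whenever $G_1\circ G_2$ is defined.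
   Context: Notation: $\mathbb{N}_0=\{0,1,2,\dots\}$, $[k]=\{1,\dots,k\}$, $\mathfrak S_k$ is the symmetric group on $[k]$. TRAP. A TRAP is a family $P=(P(k,l))_{k,l\ge 0}$ of sets with: (1) for all $k,l\in\mathbb N_0$, a left action of $\mathfrak S_l$ and a right action of $\mathfrak S_k$ on $P(k,l)$ which commute. (2) Maps $*:P(k,l)\times P(k',l')\to P(k+k',l+l')$ (horizontal concatenation) such that: $*$ is associative; there is $I_0\in P(0,0)$ with $I_0*p=p*I_0=p$; $(\sigma\cdot p\cdot\tau)*(\sigma'\cdot p'\cdot\tau')=(\sigma\otimes\sigma')\cdot(p*p')\cdot(\tau\otimes\tau')$, where for $\alpha\in\mathfrak S_m,\beta\in\mathfrak S_n$, $(\alpha\otimes\beta)(i)=\alpha(i)$ if $i\le m$ and $\beta(i-m)+m$ if $i>m$; and $c_{l,l'}\cdot(p*p')=(p'*p)\cdot c_{k,k'}$ for $p\in P(k,l)$, $p'\in P(k',l')$, where $c_{m,n}\in\mathfrak S_{m+n}$, $c_{m,n}(i)=i+n$ if $i\le m$ and $i-m$ if $i>m$. (3) For $k,l\ge1$, $i\in[k]$, $j\in[l]$, maps $t_{i,j}:P(k,l)\to P(k-1,l-1)$ (partial trace maps) such that: (a) for $k,l\ge2$, $i\in[k]$, $j\in[l]$, $i'\in[k-1]$, $j'\in[l-1]$: $t_{i',j'}\circ t_{i,j}$ equals $t_{i-1,j-1}\circ t_{i',j'}$ if $i'<i,j'<j$; $t_{i,j-1}\circ t_{i'+1,j'}$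 if $i'\ge i,j'<j$; $t_{i-1,j}\circ t_{i',j'+1}$ if $i'<i,j'\ge j$; $t_{i,j}\circ t_{i'+1,j'+1}$ if $i'\ge i,j'\ge j$. (b) $t_{i,j}(\sigma\cdot p\cdot\tau)=\sigma_j\cdot t_{\tau(i),\sigma^{-1}(j)}(p)\cdot\tau_{\tau(i)}$, where for $\alpha\in\mathfrak S_n$ and $q\in[n]$, $\alpha_q\in\mathfrak S_{n-1}$ is the permutation whose word is obtained from the word $\alpha(1)\dots\alpha(n)$ by deleting the letter $q$ and subtracting $1$ from all letters $>q$. (c) for $p\in P(k,l)$, $p'\in P(k',l')$ ($k,l,k',l'\ge0$), $i\in[k+k']$, $j\in[l+l']$: $t_{i,j}(p*p')=t_{i,j}(p)*p'$ if $i\le k,j\le l$, and $t_{i,j}(p*p')=p*t_{i-k,j-l}(p')$ if $i>k,j>l$. A morphism of TRAPs is a family of maps $P(k,l)\to Q(k,l)$ commuting with the symmetric group actions, $*$, $I_0$ and the partial traces. In a TRAP, the vertical concatenation of $p\in P(k,l)$, $q\in P(l,m)$ is $q\circ p=t_{k+1,1}\circ\cdots\circ t_{k+l,l}(p*q)\in P(k,m)$, and the generalised trace of $p\in P(k,k)$ is $\mathrm{Tr}(p)=t_{1,1}\circ\cdots\circ t_{k,k}(p)\in P(0,0)$. Kernels. $\mathcal K_M^\infty(k,l)=\mathcal E(M^k\times M^l)$ is the space of smooth complex-valued functions $K(x_1,\dots,x_k,y_1,\dots,y_l)$ ($\mathcal K_M^\infty(0,0)=\mathbb C$), isomorphic to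 $\mathcal E(M)^{\widehat\otimes k}\widehat\otimes\mathcal E(M)^{\widehat\otimes l}$. Action: $(\sigma\cdot K\cdot\tau)(x,y)=K(x_{\tau^{-1}(1)},\dots,x_{\tau^{-1}(k)},y_{\sigma(1)},\dots,y_{\sigma(l)})$. Horizontal concatenation (also written $\otimes$): $(K*K')(x,x',y,y')=K(x,y)K'(x',y')$ with $x\in M^k$, $x'\in M^{k'}$, $y\in M^l$, $y'\in M^{l'}$. Partial traces: $t_{i,j}(K)(x_1,\dots,x_{k-1},y_1,\dots,y_{l-1})=\int_M K(x_1,\dots,x_{i-1},z,x_i,\dots,x_{k-1},y_1,\dots,y_{j-1},z,y_j,\dots,y_{l-1})\,d\mu(z)$. Solar graphs. A solar corolla ordered graph decorated by a TRAP $P$ consists of finite sets $V(G)$ (vertices), $E(G)$ (internal edges), $I(G)$ (input edges), $O(G)$ (output edges), a source map $s:E(G)\sqcup O(G)\to V(G)$, a target map $t:E(G)\sqcup I(G)\to V(G)$, bijections $\alpha:I(G)\to[i(G)]$, $\beta:O(G)\to[o(G)]$ with $i(G)=|I(G)|$, $o(G)=|O(G)|$, for each vertex $v$ a total order on its incoming edges $t^{-1}(v)$ and on its outgoing edges $s^{-1}(v)$, and a decoration $d_G(v)\in P(|t^{-1}(v)|,|s^{-1}(v)|)$. $\mathrm{solCGr}(P)(k,l)$ is the set of isomorphism classes with $i(G)=k$, $o(G)=l$. It is a TRAP: $\tau\cdot G\cdot\sigma$ is $G$ with $\alpha,\beta$ replaced by $\sigma^{-1}\circ\alpha,\tau\circ\beta$;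 $G*G'$ is the disjoint union with labels of $G'$ shifted by $i(G)$, $o(G)$; $t_{i,j}(G)$ replaces the $i$-th input edge $e$ and the $j$-th output edge $f$ by one internal edge from $s(f)$ to $t(e)$ (keeping positions in the vertex orders), decreasing by $1$ input labels $>i$ and output labels $>j$. $G_1\circ G_2$ (vertical concatenation, gluing outputs of $G_2$ to inputs of $G_1$ with the same index) is defined when $o(G_2)=i(G_1)$. For $P=\mathcal K_M^\infty$, the amplitude $\Phi$ is the unique TRAP morphism $\mathrm{solCGr}(P)\to P$ sending, for each $p\in P(k,l)$, the one-vertex graph decorated by $p$ with $k$ inputs and $l$ outputs ordered at the vertex by their indices, to $p$. *)

(* Defs.v *)
From HB Require Import structures.
From mathcomp Require Import all_boot all_order all_algebra all_fingroup.
From mathcomp Require Import all_classical all_reals all_analysis.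
From mathcomp Require Import complex.

Set Implicit Arguments.
Unset Strict Implicit.
Unset Printing Implicit Defensive.
Import Order.TTheory GRing.Theory Num.Theory.
Import numFieldNormedType.Exports.
Local Open Scope classical_set_scope.
Local Open Scope ring_scope.

(** * Permutations *)

(* Indices are 0-based throughout. [(s * t)%g] is "first [s], then [t]" in
   MathComp, so that the composite [s \o t] is [(t * s)%g]. *)

Definition sum_map (A B A' B' : Type) (f : A -> A') (g : B -> B')
    (x : A + B) : A' + B' :=
  match x with inl a => inl (f a) | inr b => inr (g b) end.

Section Perms.

Definition tens_fun m n (a : 'S_m) (b : 'S_n) (i : 'I_(m + n)) : 'I_(m + n) :=
  match fintype.split i with
  | inl x => lshift n (a x)
  | inr y => rshift m (b y)
  end.

Lemma tens_fun_inj m n (a : 'S_m) (b : 'S_n) : injective (tens_fun a b).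
Proof.
have E i : tens_fun a b i = unsplit (sum_map a b (fintype.split i)).
  by rewrite /tens_fun; case: fintype.split.
move=> i j; rewrite !E => /(can_inj (@unsplitK _ _)) H.
apply: (can_inj (@splitK _ _)); move: H.
by case: fintype.split => x; case: fintype.split => y //= [/perm_inj ->].
Qed.

Definition perm_tens m n (a : 'S_m) (b : 'S_n) : 'S_(m + n) :=
  perm (@tens_fun_inj m n a b).

Definition c_fun m n (i : 'I_(m + n)) : 'I_(m + n) :=
  cast_ord (addnC n m)
    match fintype.split i with
    | inl x => rshift n x
    | inr y => lshift m y
    end.

Lemma c_fun_inj m n : injective (@c_fun m n).
Proof.
pose sw (x : 'I_m + 'I_n) : 'I_n + 'I_m :=
  match x with inl a => inr a | inr a => inl a end.
have E i : c_fun i = cast_ord (addnC n m) (unsplit (sw (fintype.split i))).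
  by rewrite /c_fun; case: fintype.split.
move=> i j; rewrite !E => /cast_ord_inj/(can_inj (@unsplitK _ _)) H.
apply: (can_inj (@splitK _ _)); move: H.
by case: fintype.split => x; case: fintype.split => y //= [->].
Qed.

Definition c_perm m n : 'S_(m + n) := perm (@c_fun_inj m n).

(* Deletion of the letter [q] from the word of [a]: the remaining positions
   are enumerated by [lift (a^-1 q)], the remaining letters by [lift q]. *)
Definition del_fun n (a : 'S_n.+1) (q : 'I_n.+1) (i : 'I_n) : 'I_n :=
  odflt i (unlift q (a (lift ((a^-1)%g q) i))).

Lemma del_funK n (a : 'S_n.+1) (q : 'I_n.+1) (i : 'I_n) :
  lift q (del_fun a q i) = a (lift ((a^-1)%g q) i).
Proof.
rewrite /del_fun; case: unliftP => [j ->//|] /(congr1 (a^-1)%g).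
by rewrite permK => /esym/eqP; rewrite (negPf (neq_lift _ _)).
Qed.

Lemma del_fun_inj n (a : 'S_n.+1) (q : 'I_n.+1) : injective (del_fun a q).
Proof.
by move=> i j /(congr1 (lift q)); rewrite !del_funK => /perm_inj/lift_inj.
Qed.

Definition perm_del n (a : 'S_n.+1) (q : 'I_n.+1) : 'S_n :=
  perm (@del_fun_inj n a q).

End Perms.

(** * TRAPs *)

(* Transport along equalities of arities, which are needed because [addn] is
   associative, commutative, etc. only propositionally. *)
Definition pcast (P : nat -> nat -> Type) k k' l l'
    (ek : k = k') (el : l = l') (p : P k l) : P k' l' :=
  eq_rect l (P k') (eq_rect k (P^~ l) p k' ek) l' el.

Record trap_ops (P : nat -> nat -> Type) := TrapOps {
  lact : forall k l, 'S_l -> P k l -> P k l;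
  ract : forall k l, P k l -> 'S_k -> P k l;
  hcat : forall k l k' l', P k l -> P k' l' -> P (k + k')%N (l + l')%N;
  hone : P 0 0;
  ptr : forall k l, 'I_k.+1 -> 'I_l.+1 -> P k.+1 l.+1 -> P k l
}.

Record is_trap (P : nat -> nat -> Type) (T : trap_ops P) : Prop := IsTrap {
  lact1 : forall k l (p : P k l), lact T 1%g p = p;
  lactM : forall k l (s s' : 'S_l) (p : P k l),
    lact T (s' * s)%g p = lact T s (lact T s' p);
  ract1 : forall k l (p : P k l), ract T p 1%g = p;
  ractM : forall k l (t t' : 'S_k) (p : P k l),
    ract T p (t' * t)%g = ract T (ract T p t) t';
  lract : forall k l (s : 'S_l) (t : 'S_k) (p : P k l),
    lact T s (ract T p t) = ract T (lact T s p) t;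
  hcatA : forall k l k' l' k'' l'' (p : P k l) (p' : P k' l') (p'' : P k'' l''),
    hcat T (hcat T p p') p'' =
    pcast (addnA k k' k'') (addnA l l' l'') (hcat T p (hcat T p' p''));
  hcat1p : forall k l (p : P k l), hcat T (hone T) p = p;
  hcatp1 : forall k l (p : P k l),
    pcast (addn0 k) (addn0 l) (hcat T p (hone T)) = p;
  hcat_act : forall k l k' l' (p : P k l) (p' : P k' l')
      (s : 'S_l) (t : 'S_k) (s' : 'S_l') (t' : 'S_k'),
    hcat T (lact T s (ract T p t)) (lact T s' (ract T p' t')) =
    lact T (perm_tens s s') (ract T (hcat T p p') (perm_tens t t'));
  hcatC : forall k l k' l' (p : P k l) (p' : P k' l'),
    lact T (c_perm l l') (hcat T p p') =
    ract T (pcast (addnC k' k) (addnC l' l) (hcat T p' p)) (c_perm k k');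
  ptr_ptr : forall k l (i : 'I_k.+2) (j : 'I_l.+2) (i' : 'I_k.+1) (j' : 'I_l.+1)
      (p : P k.+2 l.+2),
    [/\ (i' < i)%N -> (j' < j)%N ->
          ptr T i' j' (ptr T i j p) =
          ptr T (inord i.-1) (inord j.-1) (ptr T (inord i') (inord j') p),
        (i <= i')%N -> (j' < j)%N ->
          ptr T i' j' (ptr T i j p) =
          ptr T (inord i) (inord j.-1) (ptr T (inord i'.+1) (inord j') p),
        (i' < i)%N -> (j <= j')%N ->
          ptr T i' j' (ptr T i j p) =
          ptr T (inord i.-1) (inord j) (ptr T (inord i') (inord j'.+1) p)
      & (i <= i')%N -> (j <= j')%N ->
          ptr T i' j' (ptr T i j p) =
          ptr T (inord i) (inord j) (ptr T (inord i'.+1) (inord j'.+1) p)];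
  ptr_act : forall k l (i : 'I_k.+1) (j : 'I_l.+1) (s : 'S_l.+1) (t : 'S_k.+1)
      (p : P k.+1 l.+1),
    ptr T i j (lact T s (ract T p t)) =
    lact T (perm_del s j)
      (ract T (ptr T (t i) ((s^-1)%g j) p) (perm_del t (t i)));
  ptr_hcatl : forall k l k' l' (i : 'I_k.+1) (j : 'I_l.+1)
      (p : P k.+1 l.+1) (p' : P k' l'),
    @ptr P T (k + k')%N (l + l')%N (lshift k' i) (lshift l' j) (hcat T p p') =
    hcat T (ptr T i j p) p';
  ptr_hcatr : forall k l k' l' (i : 'I_k'.+1) (j : 'I_l'.+1)
      (p : P k l) (p' : P k'.+1 l'.+1),
    ptr T (cast_ord (addnS k k') (rshift k i)) (cast_ord (addnS l l') (rshift l j))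
      (pcast (addnS k k') (addnS l l') (hcat T p p')) =
    hcat T p (ptr T i j p')
}.

Record is_trap_morphism (P Q : nat -> nat -> Type) (T : trap_ops P)
    (U : trap_ops Q) (f : forall k l, P k l -> Q k l) : Prop := IsTrapMorphism {
  morph_lact : forall k l (s : 'S_l) (p : P k l),
    f k l (lact T s p) = lact U s (f k l p);
  morph_ract : forall k l (t : 'S_k) (p : P k l),
    f k l (ract T p t) = ract U (f k l p) t;
  morph_hcat : forall k l k' l' (p : P k l) (p' : P k' l'),
    f _ _ (hcat T p p') = hcat U (f k l p) (f k' l' p');
  morph_hone : f 0 0 (hone T) = hone U;
  morph_ptr : forall k l (i : 'I_k.+1) (j : 'I_l.+1) (p : P k.+1 l.+1),
    f k l (ptr T i j p) = ptr U i j (f _ _ p)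
}.

(* t_{k+1,1} o ... o t_{k+l,l}, the innermost trace being t_{k+l,l}. *)
Fixpoint vtrace (P : nat -> nat -> Type) (T : trap_ops P) (k l m : nat) :
    P (k + l)%N (l + m)%N -> P k m :=
  match l with
  | 0 => fun p => pcast (addn0 k) (add0n m) p
  | l'.+1 => fun p => @vtrace P T k l' m
      (@ptr P T (k + l')%N (l' + m)%N ord_max (lshift m (@ord_max l'))
        (pcast (addnS k l') (addSn l' m) p))
  end.

Definition vcomp (P : nat -> nat -> Type) (T : trap_ops P) (k l m : nat)
    (q : P l m) (p : P k l) : P k m := vtrace T (hcat T p q).

Fixpoint gtrace (P : nat -> nat -> Type) (T : trap_ops P) (k : nat) :
    P k k -> P 0 0 :=
  match k with
  | 0 => id
  | k'.+1 => fun p => gtrace T (ptr T ord_max ord_max p)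
  end.

(** * Solar corolla ordered graphs *)

(* [inedge] is the inverse of the labelling I(G) -> [k], and [outedge] that of
   O(G) -> [l]. The map [tgt] sends an edge to its target vertex together with
   its rank among the edges entering this vertex; its bijectivity says exactly
   that the ranks define a total order on each fibre of the target map and that
   [ain v] is the cardinal of the fibre of [v]. Likewise for [src]. *)
Record sgraph (P : nat -> nat -> Type) (k l : nat) := SGraph {
  gV : finType;
  gE : finType;
  gI : finType;
  gO : finType;
  inedge : 'I_k -> gI;
  inedge_bij : bijective inedge;
  outedge : 'I_l -> gO;
  outedge_bij : bijective outedge;
  ain : gV -> nat;
  aout : gV -> nat;
  tgt : gE + gI -> {v : gV & 'I_(ain v)};
  tgt_bij : bijective tgt;
  src : gE + gO -> {v : gV & 'I_(aout v)};
  src_bij : bijective src;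
  dec : forall v, P (ain v) (aout v)
}.

Section SumMaps.

Definition sum_ar (V V' : Type) (a : V -> nat) (a' : V' -> nat)
    (v : V + V') : nat :=
  match v with inl x => a x | inr x => a' x end.

Definition slotL (V V' : Type) (a : V -> nat) (a' : V' -> nat)
    (x : {v : V & 'I_(a v)}) : {v : V + V' & 'I_(sum_ar a a' v)} :=
  existT (fun v => 'I_(sum_ar a a' v)) (inl (projT1 x)) (projT2 x).

Definition slotR (V V' : Type) (a : V -> nat) (a' : V' -> nat)
    (x : {v : V' & 'I_(a' v)}) : {v : V + V' & 'I_(sum_ar a a' v)} :=
  existT (fun v => 'I_(sum_ar a a' v)) (inr (projT1 x)) (projT2 x).

Definition sum_slots (A B V V' : Type) (a : V -> nat) (a' : V' -> nat)
    (f : A -> {v : V & 'I_(a v)}) (g : B -> {v : V' & 'I_(a' v)})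
    (x : A + B) : {v : V + V' & 'I_(sum_ar a a' v)} :=
  match x with inl y => slotL a' (f y) | inr y => slotR a (g y) end.

Lemma sum_slots_bij (A B V V' : Type) (a : V -> nat) (a' : V' -> nat)
    (f : A -> {v : V & 'I_(a v)}) (g : B -> {v : V' & 'I_(a' v)}) :
  bijective f -> bijective g -> bijective (sum_slots f g).
Proof.
case=> f' fK f'K [g' gK g'K].
pose h (x : {v : V + V' & 'I_(sum_ar a a' v)}) : A + B :=
  match x with
  | existT (inl v) i => inl (f' (existT _ v i))
  | existT (inr v) i => inr (g' (existT _ v i))
  end.
exists h => [[y|y]|[[v|v] i]] /=.
- by rewrite /h/= -/(slotL _ _); case: (f y) (fK y) => /= v i ->.
- by rewrite /h/=; case: (g y) (gK y) => /= v i ->.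
- by rewrite /slotL f'K.
- by rewrite /slotR g'K.
Qed.

Definition cat_edges (E E' I I' : Type) (x : (E + E') + (I + I')) :
    (E + I) + (E' + I') :=
  match x with
  | inl (inl e) => inl (inl e) | inl (inr e) => inr (inl e)
  | inr (inl i) => inl (inr i) | inr (inr i) => inr (inr i)
  end.

Lemma cat_edges_bij (E E' I I' : Type) : bijective (@cat_edges E E' I I').
Proof.
by exists (fun x : (E + I) + (E' + I') => match x with
  | inl (inl e) => inl (inl e) | inr (inl e) => inl (inr e)
  | inl (inr i) => inr (inl i) | inr (inr i) => inr (inr i)
  end) => [[[]|[]]|[[]|[]]].
Qed.

Definition cat_labels m n (A B : Type) (f : 'I_m -> A) (g : 'I_n -> B)
    (i : 'I_(m + n)) : A + B := sum_map f g (fintype.split i).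

Lemma cat_labels_bij m n (A B : Type) (f : 'I_m -> A) (g : 'I_n -> B) :
  bijective f -> bijective g -> bijective (cat_labels f g).
Proof.
case=> f' fK f'K [g' gK g'K].
exists (fun x : A + B => unsplit (sum_map f' g' x)) => [j|[x|x]].
- rewrite /cat_labels -[RHS]splitK.
  by case: (fintype.split j) => x /=; rewrite ?fK ?gK.
- by rewrite /cat_labels unsplitK /= f'K.
- by rewrite /cat_labels unsplitK /= g'K.
Qed.

(* The new internal edge [None] takes, among the edges entering (resp.
   leaving) a vertex, the place of the removed external edge [x]. *)
Definition tr_edges (E I : eqType) (x : I)
    (y : option E + {z : I | z != x}) : E + I :=
  match y with
  | inl (Some e) => inl e | inl None => inr x | inr z => inr (val z)
  end.

Lemma tr_edges_bij (E I : eqType) (x : I) : bijective (@tr_edges E I x).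
Proof.
exists (fun y : E + I => match y with
  | inl e => inl (Some e)
  | inr z => if insub z is Some u then inr u else inl None
  end) => [[[e|]|z]|[e|z]] //=.
- by rewrite insubF // eqxx.
- by rewrite valK.
- by case: insubP => [u _ <-|] //=; rewrite negbK => /eqP ->.
Qed.

Lemma tr_label_neq n (I : eqType) (f : 'I_n.+1 -> I) (bf : bijective f)
  (i : 'I_n.+1) (j : 'I_n) : f (lift i j) != f i.
Proof. by rewrite (inj_eq (bij_inj bf)) eq_sym neq_lift. Qed.

Definition tr_labels n (I : eqType) (f : 'I_n.+1 -> I) (bf : bijective f)
    (i : 'I_n.+1) (j : 'I_n) : {z : I | z != f i} :=
  exist _ (f (lift i j)) (tr_label_neq bf i j).

Lemma tr_labels_bij n (I : finType) (f : 'I_n.+1 -> I) (bf : bijective f)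
  (i : 'I_n.+1) : bijective (tr_labels bf i).
Proof.
apply: inj_card_bij => [j j' /(congr1 val)/= /(bij_inj bf)/lift_inj//|].
have eC : #|{: {z : I | z != f i}}| = #|predC1 (f i)|.
  by rewrite card_sig; apply: eq_card.
by rewrite card_ord eC cardC1 -(bij_eq_card bf) card_ord.
Qed.

Lemma void_slots_bij (A : Type) (V : Type) (a : V -> nat)
  (f : A -> {v : V & 'I_(a v)}) : (A -> False) -> (V -> False) -> bijective f.
Proof.
by move=> nA nV; exists (fun s => match nV (projT1 s) with end) => [x|[v ?]];
  [case: (nA x)|case: (nV v)].
Qed.

(* Gluing: a new internal edge for each common label in [l]. *)
Definition glue_tgt (E E' I I' : Type) l (f : 'I_l -> I')
    (x : ((E + E') + 'I_l) + I) : (E + I) + (E' + I') :=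
  match x with
  | inl (inl (inl e)) => inl (inl e)
  | inl (inl (inr e)) => inr (inl e)
  | inl (inr a) => inr (inr (f a))
  | inr i => inl (inr i)
  end.

Lemma glue_tgt_bij (E E' I I' : Type) l (f : 'I_l -> I') :
  bijective f -> bijective (@glue_tgt E E' I I' l f).
Proof.
case=> f' fK f'K; exists (fun x : (E + I) + (E' + I') => match x with
  | inl (inl e) => inl (inl (inl e))
  | inr (inl e) => inl (inl (inr e))
  | inr (inr i) => inl (inr (f' i))
  | inl (inr i) => inr i
  end) => [[[[]|a]|i]|[[]|[|i]]] //=; by rewrite ?fK ?f'K.
Qed.

Definition glue_src (E E' O O' : Type) l (f : 'I_l -> O)
    (x : ((E + E') + 'I_l) + O') : (E + O) + (E' + O') :=
  match x with
  | inl (inl (inl e)) => inl (inl e)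
  | inl (inl (inr e)) => inr (inl e)
  | inl (inr a) => inl (inr (f a))
  | inr o => inr (inr o)
  end.

Lemma glue_src_bij (E E' O O' : Type) l (f : 'I_l -> O) :
  bijective f -> bijective (@glue_src E E' O O' l f).
Proof.
case=> f' fK f'K; exists (fun x : (E + O) + (E' + O') => match x with
  | inl (inl e) => inl (inl (inl e))
  | inr (inl e) => inl (inl (inr e))
  | inl (inr i) => inl (inr (f' i))
  | inr (inr i) => inr i
  end) => [[[[]|a]|i]|[[|i]|[]]] //=; by rewrite ?fK ?f'K.
Qed.

End SumMaps.

Section Graphs.
Variable P : nat -> nat -> Type.

Definition sgraph_iso k l (G H : sgraph P k l) : Prop :=
  exists (fV : gV G -> gV H) (fE : gE G -> gE H)
         (fI : gI G -> gI H) (fO : gO G -> gO H)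
         (ha : forall v, ain v = ain (fV v))
         (hb : forall v, aout v = aout (fV v)),
    [/\ [/\ bijective fV, bijective fE, bijective fI & bijective fO],
        (forall i, fI (inedge G i) = inedge H i) /\
        (forall j, fO (outedge G j) = outedge H j),
        (forall e, tgt (sum_map fE fI e) =
           existT (fun v => 'I_(ain v)) (fV (projT1 (tgt e)))
             (cast_ord (ha _) (projT2 (tgt e)))),
        (forall e, src (sum_map fE fO e) =
           existT (fun v => 'I_(aout v)) (fV (projT1 (src e)))
             (cast_ord (hb _) (projT2 (src e))))
      & forall v, dec (fV v) = pcast (ha v) (hb v) (dec v)].

(* The labelling of the outputs becomes [s \o beta], that of the inputs
   [t^-1 \o alpha]; these are written here on the inverses. *)
Definition sgraph_lact k l (s : 'S_l) (G : sgraph P k l) : sgraph P k l :=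
  @SGraph P k l _ _ _ _ _ (inedge_bij G)
    (fun j => outedge G ((s^-1)%g j)) (bij_comp (outedge_bij G) (injF_bij (@perm_inj _ _)))
    _ _ _ (tgt_bij G) _ (src_bij G) (@dec _ _ _ G).

Definition sgraph_ract k l (G : sgraph P k l) (t : 'S_k) : sgraph P k l :=
  @SGraph P k l _ _ _ _
    (fun i => inedge G (t i)) (bij_comp (inedge_bij G) (injF_bij (@perm_inj _ _)))
    _ (outedge_bij G)
    _ _ _ (tgt_bij G) _ (src_bij G) (@dec _ _ _ G).

Definition sum_dec k l k' l' (G : sgraph P k l) (H : sgraph P k' l')
    (v : gV G + gV H) :
    P (sum_ar (@ain _ _ _ G) (@ain _ _ _ H) v)
      (sum_ar (@aout _ _ _ G) (@aout _ _ _ H) v) :=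
  match v with inl x => dec x | inr x => dec x end.

Definition sgraph_hcat k l k' l' (G : sgraph P k l) (H : sgraph P k' l') :
    sgraph P (k + k') (l + l') :=
  @SGraph P (k + k') (l + l') (gV G + gV H)%type (gE G + gE H)%type
    (gI G + gI H)%type (gO G + gO H)%type
    _ (cat_labels_bij (inedge_bij G) (inedge_bij H))
    _ (cat_labels_bij (outedge_bij G) (outedge_bij H))
    _ _
    _ (bij_comp (sum_slots_bij (tgt_bij G) (tgt_bij H)) (@cat_edges_bij _ _ _ _))
    _ (bij_comp (sum_slots_bij (src_bij G) (src_bij H)) (@cat_edges_bij _ _ _ _))
    (@sum_dec _ _ _ _ G H).

Definition void_elim (A : void -> Type) (v : void) : A v :=
  match v with end.

Definition void_slots (a : void -> nat) (x : void + 'I_0) :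
    {v : void & 'I_(a v)} :=
  match x with
  | inl v => match v with end
  | inr i => False_rect _ (notF (ltn_ord i))
  end.

Lemma void_slots0_bij (a : void -> nat) : bijective (void_slots a).
Proof. by apply: void_slots_bij => // -[[]|[]]. Qed.

Definition sgraph_one : sgraph P 0 0 :=
  @SGraph P 0 0 void void 'I_0 'I_0 id (Bijective (frefl _) (frefl _))
    id (Bijective (frefl _) (frefl _))
    (fun=> 0%N) (fun=> 0%N)
    _ (void_slots0_bij _) _ (void_slots0_bij _) (void_elim _).

Definition sgraph_ptr k l (i : 'I_k.+1) (j : 'I_l.+1) (G : sgraph P k.+1 l.+1) :
    sgraph P k l :=
  @SGraph P k l (gV G) (option (gE G))
    {z : gI G | z != inedge G i} {z : gO G | z != outedge G j}
    _ (tr_labels_bij (inedge_bij G) i) _ (tr_labels_bij (outedge_bij G) j)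
    _ _
    _ (bij_comp (tgt_bij G) (tr_edges_bij _ (inedge G i)))
    _ (bij_comp (src_bij G) (tr_edges_bij _ (outedge G j)))
    (@dec _ _ _ G).

(* [sgraph_comp G1 G2] is G1 o G2. *)
Definition sgraph_comp k l m (G1 : sgraph P l m) (G2 : sgraph P k l) :
    sgraph P k m :=
  @SGraph P k m (gV G2 + gV G1)%type ((gE G2 + gE G1) + 'I_l)%type
    (gI G2) (gO G1)
    _ (inedge_bij G2) _ (outedge_bij G1)
    _ _
    _ (bij_comp (sum_slots_bij (tgt_bij G2) (tgt_bij G1))
        (@glue_tgt_bij _ _ _ _ _ _ (inedge_bij G1)))
    _ (bij_comp (sum_slots_bij (src_bij G2) (src_bij G1))
        (@glue_src_bij _ _ _ _ _ _ (outedge_bij G2)))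
    (@sum_dec _ _ _ _ G2 G1).

Definition corolla_slots k (x : void + 'I_k) : {v : unit & 'I_k} :=
  match x with
  | inl v => match v with end
  | inr i => existT (fun=> 'I_k) tt i
  end.

Lemma corolla_slots_bij k : bijective (@corolla_slots k).
Proof.
by exists (fun s : {v : unit & 'I_k} => inr (projT2 s)) => [[[]|]|[[]]].
Qed.

Definition corolla k l (p : P k l) : sgraph P k l :=
  @SGraph P k l unit void 'I_k 'I_l id (Bijective (frefl _) (frefl _))
    id (Bijective (frefl _) (frefl _))
    (fun=> k) (fun=> l)
    _ (@corolla_slots_bij k) _ (@corolla_slots_bij l) (fun=> p).

Definition solCGr (k l : nat) :=
  {A : sgraph P k l -> Prop | exists G, A = sgraph_iso G}.

Definition gclass k l (G : sgraph P k l) : solCGr k l :=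
  exist _ (sgraph_iso G) (ex_intro _ G erefl).

Definition grepr k l (A : solCGr k l) : sgraph P k l :=
  sval (cid (svalP A)).

(* The operations on isomorphism classes are computed on representatives. *)
Definition solCGr_ops : trap_ops solCGr := {|
  lact := fun k l s A => gclass (sgraph_lact s (grepr A));
  ract := fun k l A t => gclass (sgraph_ract (grepr A) t);
  hcat := fun k l k' l' A B => gclass (sgraph_hcat (grepr A) (grepr B));
  hone := gclass sgraph_one;
  ptr := fun k l i j A => gclass (sgraph_ptr i j (grepr A))
|}.

Definition solCGr_comp k l m (A : solCGr l m) (B : solCGr k l) : solCGr k m :=
  gclass (sgraph_comp (grepr A) (grepr B)).

(* The defining property of the P-amplitude. *)
Definition is_amplitude (T : trap_ops P)
    (Phi : forall k l, solCGr k l -> P k l) : Prop :=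
  is_trap_morphism solCGr_ops T Phi /\
  forall k l (p : P k l), Phi k l (gclass (corolla p)) = p.

End Graphs.

(** * Closed manifolds and volume forms *)

Section Smooth.
Context {R : realType}.

(* f is C^r at the points of the open set U: all its iterated directional
   derivatives of order at most r exist and are continuous there. *)
Fixpoint is_Cn (V W : normedModType R) (r : nat) (U : set V) (f : V -> W) : Prop :=
  (forall x, U x -> {for x, continuous f}) /\
  match r with
  | 0 => True
  | r'.+1 => forall v, (forall x, U x -> derivable f x v) /\
                       is_Cn r' U (fun x => 'D_v f x)
  end.

Definition smooth_on (V W : normedModType R) (U : set V) (f : V -> W) : Prop :=
  forall r, is_Cn r U f.

End Smooth.

(* The maps are total; only their values on [cdom] and its image matter. *)
Record chart (R : realType) (n : nat) (M : topologicalType) := Chart {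
  cdom : set M;
  cmap : M -> 'rV[R]_n;
  cinv : 'rV[R]_n -> M;
  cdom_open : open cdom;
  cimg_open : open (cmap @` cdom);
  cmapK : forall x, cdom x -> cinv (cmap x) = x;
  cmap_cont : {within cdom, continuous cmap};
  cinv_cont : {within cmap @` cdom, continuous cinv}
}.

Definition cimg (R : realType) n (M : topologicalType) (c : chart R n M) :
  set 'rV[R]_n := cmap c @` cdom c.

Definition overlap (R : realType) n (M : topologicalType) (c d : chart R n M) :
  set 'rV[R]_n := cmap c @` (cdom c `&` cdom d).

Definition transition (R : realType) n (M : topologicalType) (c d : chart R n M) :
  'rV[R]_n -> 'rV[R]_n := cmap d \o cinv c.

Definition is_smooth_atlas (R : realType) n (M : topologicalType)
    (A : set (chart R n M)) : Prop :=
  \bigcup_(c in A) cdom c = setT /\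
  forall c d, A c -> A d -> smooth_on (overlap c d) (transition c d).

Record closed_manifold (R : realType) (n : nat) := ClosedManifold {
  carrier :> ptopologicalType;
  atlas : set (chart R n carrier);
  atlas_smooth : is_smooth_atlas atlas;
  mfd_hausdorff : hausdorff_space carrier;
  mfd_second_countable : @second_countable carrier;
  mfd_compact : compact [set: carrier]
}.

Arguments atlas {R n} c _.

Definition orientable (R : realType) n (M : closed_manifold R n) : Prop :=
  exists B : set (chart R n M),
    [/\ is_smooth_atlas B, is_smooth_atlas (atlas M `|` B)
      & forall c d x, B c -> B d -> overlap c d x ->
          0 < \det (jacobian (transition c d) x)].

(* A nowhere vanishing form of top degree, given by its coefficient
   [vcoef c] dx_1 /\ ... /\ dx_n in each chart [c]. *)
Record volume_form (R : realType) (n : nat) (M : closed_manifold R n) :=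
  VolumeForm {
  vcoef : chart R n M -> 'rV[R]_n -> R;
  vcoef_smooth : forall c, atlas M c -> smooth_on (cimg c) (vcoef c : _ -> R^o);
  vcoef_neq0 : forall c x, atlas M c -> cimg c x -> vcoef c x != 0;
  vcoef_change : forall c d x, atlas M c -> atlas M d -> overlap c d x ->
    vcoef c x = vcoef d (transition c d x) * \det (jacobian (transition c d) x)
}.

(** * Integration *)

Section PowerMeasure.
Local Open Scope ereal_scope.
Context d (T : measurableType d) (R : realType).

(* The l-fold product measure mu x ... x mu, on the product sigma-algebra of
   [l.-tuple T]. *)
Fixpoint pow_measure (mu : set T -> \bar R) (l : nat) : set (l.-tuple T) -> \bar R :=
  match l with
  | 0 => fun A => \d_ ([tuple] : 0.-tuple T) A
  | l'.+1 => fun A =>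
      (mu \x @pow_measure mu l')
        ((fun p : T * l'.-tuple T => [tuple of p.1 :: p.2]) @^-1` A)
  end.

Definition cintegral (mu : set T -> \bar R) (f : T -> R[i]) : R[i] :=
  Complex (fine (\int[mu]_x (complex.Re (f x))%:E))
          (fine (\int[mu]_x (complex.Im (f x))%:E)).

End PowerMeasure.
Arguments pow_measure {d T R} mu l _.

Definition borel (M : ptopologicalType) := g_sigma_algebraType (@open M).

(* [mu] is the measure of integration against [om], for the orientation for
   which [om] is positive: |vcoef c| dx_1 ... dx_n in each chart [c]. This
   determines [mu] on all Borel sets, the atlas having a countable subcover. *)
Definition is_volume_measure (R : realType) n (M : closed_manifold R n)
    (om : volume_form M) (mu : set (borel M) -> \bar R) : Prop :=
  forall (c : chart R n M) (B : set (borel M)),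
    atlas M c -> measurable B -> B `<=` cdom c ->
    mu B = (\int[pow_measure (@lebesgue_measure R) n]_(
              t in [set t | (cmap c @` B) (\row_i tnth t i)])
              `|vcoef om c (\row_i tnth t i)|%:E)%E.

(** * Smooth kernels *)

Section Kernels.
Context {R : realType} {n : nat} (M : closed_manifold R n).

(* Smoothness on M^k x M^l, read in products of charts of the atlas. *)
Definition is_smooth_kernel k l (K : k.-tuple M -> l.-tuple M -> R[i]) : Prop :=
  forall (c : 'I_k -> chart R n M) (d : 'I_l -> chart R n M),
    (forall i, atlas M (c i)) -> (forall j, atlas M (d j)) ->
    let U : set ('M[R]_(k, n) * 'M[R]_(l, n)) :=
      [set u | (forall i, cimg (c i) (row i u.1)) /\
               (forall j, cimg (d j) (row j u.2))] in
    let f (u : 'M[R]_(k, n) * 'M[R]_(l, n)) : R[i] :=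
      K [tuple cinv (c i) (row i u.1) | i < k]
        [tuple cinv (d j) (row j u.2) | j < l] in
    smooth_on U ((fun u => complex.Re (f u)) : _ -> R^o) /\
    smooth_on U ((fun u => complex.Im (f u)) : _ -> R^o).

Record smooth_kernels (k l : nat) := Kernel {
  kfun :> k.-tuple M -> l.-tuple M -> R[i];
  kernel_smooth : is_smooth_kernel kfun
}.

(* (x_1, ..., x_{i-1}, z, x_i, ..., x_k) *)
Definition tinsert k (i : 'I_k.+1) (z : M) (x : k.-tuple M) : k.+1.-tuple M :=
  [tuple if unlift i a is Some b then tnth x b else z | a < k.+1].

Definition tleft k k' (x : (k + k').-tuple M) : k.-tuple M :=
  [tuple tnth x (lshift k' i) | i < k].

Definition tright k k' (x : (k + k').-tuple M) : k'.-tuple M :=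
  [tuple tnth x (rshift k i) | i < k'].

Record is_kernel_ops (mu : set (borel M) -> \bar R)
    (T : trap_ops smooth_kernels) : Prop := IsKernelOps {
  kernel_lact : forall k l (s : 'S_l) (K : smooth_kernels k l) x y,
    lact T s K x y = K x [tuple tnth y (s j) | j < l];
  kernel_ract : forall k l (t : 'S_k) (K : smooth_kernels k l) x y,
    ract T K t x y = K [tuple tnth x ((t^-1)%g i) | i < k] y;
  kernel_hcat : forall k l k' l' (K : smooth_kernels k l)
      (K' : smooth_kernels k' l') x y,
    hcat T K K' x y = K (tleft x) (tleft y) * K' (tright x) (tright y);
  kernel_hone : forall x y, hone T x y = 1;
  kernel_ptr : forall k l (i : 'I_k.+1) (j : 'I_l.+1)
      (K : smooth_kernels k.+1 l.+1) x y,
    ptr T i j K x y =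
    cintegral mu (fun z : borel M => K (tinsert i z x) (tinsert j z y))
}.

End Kernels.

(* Main.v *)
Require Import Defs.
From HB Require Import structures.
From mathcomp Require Import all_boot all_order all_algebra all_fingroup.
From mathcomp Require Import all_classical all_reals all_analysis.
From mathcomp Require Import complex measurable_realfun.

(** Smoothness.  Call a function of points of M indexed by a set I smooth when it
    is smooth along every family of points which, read in charts, depends affinely
    on a parameter ([chart_smooth]).  For a kernel this is smoothness in products
    of charts ([smooth_kernelP]), but the notion is visibly stable under renaming,
    repeating and freezing variables, and under products.  Every operation on
    kernels except the partial traces is built from these.  A partial trace
    integrates one variable z over M.  As M is compact, continuity in the parameter
    is uniform in z, so by the mean value theorem the difference quotients converge
    uniformly in z and derivatives of all orders pass under the integral sign
    ([parametric_integral]).  A derivative in the parameter at a fixed z does not see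
    the chart in which z is read, so that regularity in z can be checked chart by
    chart ([parametric_Cn_charts]).  The measure is finite since it has locally a
    bounded density with respect to Lebesgue measure and M is compact
    ([volume_finite]).

    Fubini.  A smooth function of finitely many points is bounded, and it is
    measurable for the product of the Borel sigma-algebras because M is second
    countable; hence integrations in two variables commute ([int_at_comm]), and the
    integral [Int] over all assignments of a finite set J of variables depends on J
    up to bijection only.  The axioms of TRAPs for the kernels ([kernel_is_trap]),
    the convolution formula ([vcomp_convolution]), its associativity
    ([vcompA_fubini]) and the two properties of the trace ([gtrace_diagonal],
    [gtrace_cyclic]) all say that two such integrals differ by a renaming of their
    variables.

    Amplitudes.  The amplitude of a graph is the integral, over one point of M for
    each internal edge, of the product over the vertices of their decorations
    ([amp_val]).  It is invariant under isomorphisms and compatible with the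
    operations for the same reason ([amplitude_is_amplitude]).  Compatibility with
    vertical concatenation holds for any TRAP morphism defined on graphs, since the
    graph G1 o G2 is isomorphic to an iterated trace of the disjoint union of G2 and
    G1 ([solCGr_compE]). *)

Set Implicit Arguments.
Unset Strict Implicit.
Unset Printing Implicit Defensive.
Import Order.TTheory GRing.Theory Num.Theory.
Import numFieldNormedType.Exports.
Local Open Scope classical_set_scope.
Local Open Scope ring_scope.

(** * Functions of class C^n on normed spaces *)

Section Cn.
Context {R : realType}.
Implicit Types V W : normedModType R.

Lemma is_Cn_continuous V W r (U : set V) (f : V -> W) x :
  is_Cn r U f -> U x -> {for x, continuous f}.
Proof. by case: r => [|r] /= [+ _]; apply. Qed.

Lemma is_CnW V W r (U : set V) (f : V -> W) : is_Cn r.+1 U f -> is_Cn r U f.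
Proof.
elim: r f => [|r IH] f [fc fd]; split=> // v; split; first by case: (fd v).
by apply: IH; case: (fd v).
Qed.

(** The values outside an open set do not influence the derivatives inside it, so
    the identities used to differentiate need only hold there. *)
Lemma is_Cn_eq V W r (U : set V) (f g : V -> W) : open U ->
  (forall x, U x -> f x = g x) -> is_Cn r U f -> is_Cn r U g.
Proof.
move=> oU; elim: r f g => [|r IH] f g fg [fc fd].
  split=> // x Ux; have Unx : \forall y \near x, U y by exact: open_nbhs_nbhs.
  have e : {near x, f =1 g} by apply: filterS Unx => y /fg.
  rewrite /prop_for /continuous_at -(fg _ Ux).
  exact: cvg_trans (near_eq_cvg e) (fc x Ux).
have near_fg x : U x -> {near x, f =1 g}.
  by move=> Ux; apply: filterS (open_nbhs_nbhs (conj oU Ux)) => y /fg.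
split=> [x Ux|v].
  rewrite /prop_for /continuous_at -(fg _ Ux).
  exact: cvg_trans (near_eq_cvg (near_fg x Ux)) (fc x Ux).
split=> [x Ux|].
  by apply: (near_eq_derivable (near_fg x Ux)); case: (fd v) => + _; apply.
apply: (IH (fun x => 'D_v f x)); last by case: (fd v).
by move=> x Ux; apply: near_eq_derive; exact: near_fg.
Qed.

Lemma is_Cn_cst V W r (U : set V) (c : W) : is_Cn r U (fun=> c).
Proof.
elim: r c => [|r IH] c; split=> //; try by move=> x _; exact: cst_continuous.
move=> v; split=> [x _|]; first exact: derivable_cst.
by under eq_fun do rewrite (derive_cst c); exact: IH.
Qed.

Lemma is_CnD V W r (U : set V) (f g : V -> W) : open U ->
  is_Cn r U f -> is_Cn r U g -> is_Cn r U (fun x => f x + g x).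
Proof.
move=> oU; elim: r f g => [|r IH] f g [fc fd] [gc gd].
  by split=> // x Ux; apply: continuousD; [exact: fc|exact: gc].
split=> [x Ux|v]; first by apply: continuousD; [exact: fc|exact: gc].
have [fv fd'] := fd v; have [gv gd'] := gd v.
split=> [x Ux|]; first by apply: derivableD; [exact: fv|exact: gv].
apply: is_Cn_eq (IH _ _ fd' gd') => // x Ux.
by rewrite -deriveD //; [exact: fv|exact: gv].
Qed.

Lemma is_CnM V r (U : set V) (f g : V -> R^o) : open U ->
  is_Cn r U f -> is_Cn r U g -> is_Cn r U (fun x => f x * g x : R^o).
Proof.
move=> oU; elim: r f g => [|r IH] f g Hf Hg.
  by split=> // x Ux; apply: continuousM;
     [exact: is_Cn_continuous Hf Ux|exact: is_Cn_continuous Hg Ux].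
have fW := is_CnW Hf; have gW := is_CnW Hg.
case: Hf Hg => [fc fd] [gc gd].
split=> [x Ux|v]; first by apply: continuousM; [exact: fc|exact: gc].
have [fv fd'] := fd v; have [gv gd'] := gd v.
split=> [x Ux|]; first by apply: derivableM; [exact: fv|exact: gv].
apply: is_Cn_eq (is_CnD oU (IH _ _ fW gd') (IH _ _ gW fd')) => // x Ux.
by rewrite -[LHS](deriveM (f := f) (g := g)) //; [exact: fv|exact: gv].
Qed.

(** Affine rather than linear, so that a coordinate can be frozen to a constant;
    A is the linear part. *)
Definition affine_map V W (L : V -> W) :=
  continuous L /\ exists A : V -> W,
    forall (h : R) v u, L (h *: v + u) = h *: A v + L u.

Lemma affine_comp V W W' (L : V -> W) (L' : W -> W') :
  affine_map L -> affine_map L' -> affine_map (L' \o L).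
Proof.
move=> [cL [A LE]] [cL' [A' LE']]; split.
  by move=> x; apply: continuous_comp; [exact: cL|exact: cL'].
by exists (A' \o A) => h v u /=; rewrite LE LE'.
Qed.

Lemma affine_cst V W (c : W) : affine_map (fun _ : V => c).
Proof.
by split; [exact: cst_continuous|exists (fun=> 0) => *; rewrite scaler0 add0r].
Qed.

Lemma affine_fst V W : affine_map (fst : V * W -> V).
Proof. by split; [move=> x; exact: cvg_fst|exists fst]. Qed.

Lemma affine_snd V W : affine_map (snd : V * W -> W).
Proof. by split; [move=> x; exact: cvg_snd|exists snd]. Qed.

Lemma affine_pair V W W' (L : V -> W) (L' : V -> W') :
  affine_map L -> affine_map L' -> affine_map (fun x => (L x, L' x)).
Proof.
move=> [cL [A LE]] [cL' [A' LE']]; split.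
  by move=> x; apply: cvg_pair; [exact: cL|exact: cL'].
by exists (fun x => (A x, A' x)) => h v u; rewrite LE LE'.
Qed.

Lemma continuous_mx (T : topologicalType) m n (f : T -> 'M[R]_(m, n)) x :
  (forall i j, {for x, continuous (fun y => f y i j)}) -> {for x, continuous f}.
Proof.
move=> cf A [P Px PA].
have : \forall y \near x, forall i j, P i j (f y i j).
  apply: filter_forall => i; apply: filter_forall => j.
  exact: (cf i j) (Px i j).
by apply: filterS => y Py; exact: PA.
Qed.

Lemma affine_row k n (i : 'I_k) : affine_map (row i : 'M[R]_(k, n) -> 'rV[R]_n).
Proof.
split; last by exists (row i) => h v u; rewrite linearD linearZ.
move=> x; apply: continuous_mx => a b.
rewrite /prop_for (_ : (fun y => _) = fun y : 'M[R]_(k, n) => y i b).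
  exact: coord_continuous.
by apply/funext => y; rewrite mxE.
Qed.

Lemma affine_mx V k n (L : 'I_k -> V -> 'rV[R]_n) :
  (forall i, affine_map (L i)) -> affine_map (fun x => \matrix_(i < k) L i x).
Proof.
move=> aL; split.
  move=> x; apply: continuous_mx => a b.
  rewrite /prop_for (_ : (fun y => _) = (fun m : 'rV[R]_n => m 0 b) \o L a).
    apply: (@continuous_comp _ _ _ (L a)); last exact: coord_continuous.
    by case: (aL a) => cL _; exact: cL.
  by apply/funext => y; rewrite mxE.
exists (fun x => \matrix_(i < k) (sval (cid (aL i).2)) x) => h v u.
apply/matrixP => a b; rewrite !mxE; case: cid => /= A ->.
by rewrite !mxE.
Qed.

(** The difference quotients of f \o L along v are those of f along A v. *)
Lemma is_Cn_comp_affine V V' W r (U : set V) (U' : set V') (f : V' -> W)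
    (L : V -> V') : affine_map L -> (forall x, U x -> U' (L x)) ->
  is_Cn r U' f -> is_Cn r U (f \o L).
Proof.
move=> [cL [A LE]] UU'.
elim: r f => [|r IH] f [fc fd].
  split=> // x Ux; apply: continuous_comp; first exact: cL.
  exact: fc (UU' _ Ux).
split=> [x Ux|v].
  by apply: continuous_comp; [exact: cL|exact: fc (UU' _ Ux)].
have [fv fd'] := fd (A v).
have rateE x : (fun h : R => h^-1 *: ((f \o L \o shift x) (h *: v) - (f \o L) x)) =
    (fun h : R => h^-1 *: ((f \o shift (L x)) (h *: A v) - f (L x))).
  by apply/funext => h /=; rewrite LE.
split=> [x Ux|].
  by rewrite /derivable rateE; exact: fv (UU' _ Ux).
have -> : (fun x => 'D_v (f \o L) x) = (fun x => 'D_(A v) f x) \o L.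
  by apply/funext => x /=; rewrite /derive rateE.
exact: IH.
Qed.
End Cn.

(** * Integrals depending on a parameter *)

Section BoundedIntegral.
Context d (T : measurableType d) {R : realType} (mu : {measure set T -> \bar R}).
Hypothesis mu_fin : (mu setT < +oo)%E.

Lemma bounded_integrable (f : T -> R) (C : R) :
  measurable_fun setT f -> (forall z, `|f z| <= C) ->
  mu.-integrable setT (EFin \o f).
Proof.
move=> mf fC; apply: measurable_bounded_integrable => //.
exists C; split; first exact: num_real.
by move=> D CD z _; exact: le_trans (fC z) (ltW CD).
Qed.

Lemma Rintegral_bound (f : T -> R) (e : R) :
  measurable_fun setT f -> (forall z, `|f z| <= e) ->
  `|\int[mu]_z f z| <= e * fine (mu setT).
Proof.
move=> mf fe; have fi := bounded_integrable mf fe.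
apply: le_trans (le_normr_Rintegral _ fi) _ => //.
rewrite -Rintegral_cst //; apply: le_Rintegral => //.
  exact: integrable_norm.
apply: (@bounded_integrable _ `|e|) => //; exact: measurable_cst.
Qed.
End BoundedIntegral.

Lemma continuous_bounded {R : realType} (X : topologicalType) (f : X -> R) :
  compact [set: X] -> continuous f -> exists C, forall z, `|f z| <= C.
Proof.
move=> cX cf; have : compact (f @` setT).
  by apply: continuous_compact => //; apply: continuous_subspaceT.
move=> /compact_bounded [C [_ HC]]; exists (C + 1) => z.
by apply: HC; [rewrite ltrDl|exists z].
Qed.

Section CompactParameter.
Context {R : realType} (X : ptopologicalType).
Hypothesis X_compact : compact [set: X].

Lemma continuous_borel (f : X -> R) :
  continuous f -> measurable_fun setT (f : borel X -> R).
Proof.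
move=> cf mD; apply: (measurability _ (RGenOInfty.measurableE R)) => //.
move=> /= _ [_ [x ->] <-]; rewrite setTI; apply: sub_sigma_algebra.
apply: open_comp => [z _|]; first exact: cf.
exact: interval_open.
Qed.

Variable V : normedModType R.
Implicit Types (U : set V) (g : V -> X -> R).

Definition jointly_continuous U g := forall u z, U u ->
  {for (u, z), continuous (fun p : V * X => g p.1 p.2)}.

(** Asking for joint continuity of the derivatives is what makes the notion
    survive an integration over the compact second factor. *)
Fixpoint parametric_Cn (r : nat) U g : Prop :=
  jointly_continuous U g /\
  match r with
  | 0 => True
  | r'.+1 => forall v, (forall u z, U u -> derivable (g^~ z : V -> R^o) u v) /\
       parametric_Cn r' U (fun u z => 'D_v (g^~ z : V -> R^o) u)
  end.

Lemma parametric_Cn_cont r U g : parametric_Cn r U g -> jointly_continuous U g.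
Proof. by case: r => [|r] []. Qed.

Lemma jointly_continuous_section U g u : jointly_continuous U g -> U u ->
  continuous (g u).
Proof.
move=> gc Uu z; apply: (@continuous_comp _ _ _ (fun z => (u, z))
  (fun p : V * X => g p.1 p.2)); last exact: gc.
by apply: cvg_pair => //; exact: cvg_cst.
Qed.

(** The tube lemma: z ranges over a compact space, so that finitely many of the
    neighbourhoods given by joint continuity suffice. *)
Lemma uniform_in_parameter U g u (e : R) : jointly_continuous U g -> U u ->
  0 < e -> \forall w \near u, forall z, `|g w z - g u z| < e.
Proof.
move=> gc Uu e0; have e20 : 0 < e / 2 by rewrite divr_gt0.
have := (compact_near_coveringP setT).1 X_compact V (nbhs u)
  (fun w z => `|g w z - g u z| < e) _.
have H : forall x, [set: X] x ->
    \forall x' \near x & w \near u, `|g w x' - g u x'| < e.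
  move=> x _; have /cvgrPdist_lt/(_ _ e20) := gc u x Uu.
  case=> -[A B] /= [uA xB] AB.
  exists (B, A) => //= -[x' w] /= [Bx' Aw].
  have h1 := AB (w, x') (conj Aw Bx').
  have h2 := AB (u, x') (conj (nbhs_singleton uA) Bx').
  rewrite [ltRHS]splitr (_ : _ - _ = (g u x - g u x') - (g u x - g w x')); last first.
    by rewrite opprB [RHS]addrC addrA subrK.
  by apply: le_lt_trans (ler_normB _ _) _; rewrite ltrD.
by move=> /(_ _ H); apply: filterS => w Hw z; apply: Hw.
Qed.

(** The increment of a difference quotient has an arbitrary sign; what matters about
    c is its distance to 0. *)
Lemma MVT_signed (phi dphi : R -> R) (h : R) :
  (forall t, `|t| <= `|h| -> is_derive (t : R) (1 : R) phi (dphi t)) ->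
  exists2 c, `|c| <= `|h| & phi h - phi 0 = dphi c * h.
Proof.
have aux (a b : R) : a <= b ->
    (forall t, t \in `[a, b]%R -> is_derive (t : R) (1 : R) phi (dphi t)) ->
    exists2 c, c \in `[a, b]%R & phi b - phi a = dphi c * (b - a).
  move=> ab dab.
  have H1 x : x \in `]a, b[%R -> is_derive (x : R) (1 : R) phi (dphi x).
    by move=> xab; apply: dab; exact: subset_itv_oo_cc.
  have H2 : {within `[a, b], continuous phi}.
    by apply: derivable_within_continuous => x xab; have := dab _ xab; case.
  exact: (MVT_segment ab H1 H2).
move=> dH; have [h0|h0] := leP 0 h.
  have [|c] := aux 0 h h0.
    by move=> t; rewrite in_itv /= => /andP[t0 th]; apply: dH; rewrite !ger0_norm.
  rewrite in_itv /= => /andP[c0 ch] ->; exists c; rewrite ?subr0 //.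
  by rewrite !ger0_norm.
have [|c] := aux h 0 (ltW h0).
  move=> t; rewrite in_itv /= => /andP[t0 th]; apply: dH.
  by rewrite !ler0_norm ?lerN2 // ltW.
rewrite in_itv /= => /andP[c0 ch] e; exists c.
  by rewrite !ler0_norm ?lerN2 // ltW.
by rewrite -opprB e sub0r mulrN opprK.
Qed.

(** Each difference quotient is a value of the derivative at a nearby parameter,
    and the latter is uniformly close to the derivative at u. *)
Lemma uniform_difference_quotient U g u v (e : R) : open U -> U u ->
  (forall u z, U u -> derivable (g^~ z : V -> R^o) u v) ->
  jointly_continuous U (fun u z => 'D_v (g^~ z : V -> R^o) u) -> 0 < e ->
  \forall h \near 0^', U (h *: v + u) /\
    forall z, `|'D_v (g^~ z : V -> R^o) u - h^-1 * (g (h *: v + u) z - g u z)| < e.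
Proof.
move=> oU Uu dg cdg e0.
have near_u : \forall w \near u, U w /\
    forall z, `|'D_v (g^~ z : V -> R^o) w - 'D_v (g^~ z : V -> R^o) u| < e.
  near=> w; split; near: w; first exact: open_nbhs_nbhs.
  exact: (uniform_in_parameter cdg Uu e0).
have near_0 : \forall h \near (0 : R), U (h *: v + u) /\
    forall z, `|'D_v (g^~ z : V -> R^o) (h *: v + u) - 'D_v (g^~ z : V -> R^o) u| < e.
  have cv : (fun h : R => h *: v + u) @ 0 --> 0 *: v + u.
    by apply: cvgD; [exact: scalel_continuous|exact: cvg_cst].
  by rewrite scale0r add0r in cv; exact: cv near_u.
have [d /= d0 Hd] := (nbhs_ballP _ _).1 near_0.
have {}Hd t : `|t| < d -> U (t *: v + u) /\
    forall z, `|'D_v (g^~ z : V -> R^o) (t *: v + u) - 'D_v (g^~ z : V -> R^o) u| < e.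
  by move=> td; apply: Hd; rewrite /ball /= sub0r normrN.
exists d => // h hd0 h0; have {hd0} hd : `|h| < d.
  by move: hd0; rewrite /= sub0r normrN.
have hd' := Hd h hd.
split=> [|z]; first by case: hd'.
have [|c ch] := @MVT_signed (fun t => g (t *: v + u) z)
    (fun t => 'D_v (g^~ z : V -> R^o) (t *: v + u)) h.
  move=> t th; have [Ut _] := Hd _ (le_lt_trans th hd).
  have rateE : (fun k : R => k^-1 *: (((g^~ z : V -> R^o) \o shift (t *: v + u)) (k *: v) -
      g (t *: v + u) z)) =
    (fun k : R => k^-1 *: (((fun t : R => g (t *: v + u) z) \o shift t)
      (k *: (1 : R)) - g (t *: v + u) z)).
    apply/funext => k /=; rewrite /shift /= scalerDl addrA.
    by rewrite -[k *: 1]/(k * 1) mulr1.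
  have dt := dg _ z Ut; rewrite /derivable rateE in dt.
  by apply: DeriveDef => //; rewrite /derive rateE.
rewrite scale0r add0r => ->.
rewrite mulrC mulfK // distrC.
by have [_] := Hd _ (le_lt_trans ch hd); apply.
Unshelve. all: by end_near. Qed.

Variable mu : {measure set (borel X) -> \bar R}.
Hypothesis mu_fin : (mu setT < +oo)%E.

Lemma continuous_integrable (f : X -> R) : continuous f ->
  mu.-integrable setT (EFin \o (f : borel X -> R)).
Proof.
move=> cf; have [C fC] := continuous_bounded X_compact cf.
exact: bounded_integrable (continuous_borel cf) fC.
Qed.

Lemma Rintegral_dist (f g : X -> R) e : continuous f -> continuous g ->
  (forall z, `|f z - g z| <= e) ->
  `|\int[mu]_z f z - \int[mu]_z g z| <= e * fine (mu setT).
Proof.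
move=> cf cg fge; rewrite -RintegralB //; try exact: continuous_integrable.
apply: Rintegral_bound => //; apply: (@continuous_borel (fun z => f z - g z)).
by move=> z; apply: continuousB; [exact: cf|exact: cg].
Qed.

(** Uniform convergence on a space of finite measure passes to the integrals: that
    of g gives continuity, that of its difference quotients differentiability, and
    the derivative is an integral of the same kind. *)
Lemma parametric_integral r U g : open U -> parametric_Cn r U g ->
  is_Cn r U (fun u => \int[mu]_z g u z : R^o).
Proof.
move=> oU; set m := fine (mu setT).
have m0 : 0 <= m by apply: fine_ge0; exact: measure_ge0.
have m1 : 0 < m + 1 by rewrite ltr_wpDl.
have small e : 0 < e -> e / (m + 1) * m < e.
  by move=> e0; rewrite mulrAC ltr_pdivrMr // ltr_pM2l // ltrDl.
have cont g' : jointly_continuous U g' ->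
    forall u, U u -> {for u, continuous (fun u => \int[mu]_z g' u z : R^o)}.
  move=> cg u Uu; apply/cvgrPdist_lt => e e0.
  (* the measure m may vanish, hence m + 1 *)
  have e1 : 0 < e / (m + 1) by rewrite divr_gt0.
  have := uniform_in_parameter cg Uu e1.
  have : \forall w \near u, U w by exact: open_nbhs_nbhs.
  apply: filterS2 => w Uw Hw; rewrite distrC; apply: le_lt_trans (small _ e0).
  by apply: Rintegral_dist => [||z]; rewrite ?ltW //;
    exact: jointly_continuous_section cg _.
elim: r g => [|r IH] g [cg dg]; split=> //; try exact: cont.
move=> v; have [gv gv'] := dg v; have cgv := parametric_Cn_cont gv'.
have lim_u u : U u ->
    (fun h => h^-1 *: (((fun u => \int[mu]_z g u z : R^o) \o shift u) (h *: v)
      - \int[mu]_z g u z)) @ 0^' --> (\int[mu]_z 'D_v (g^~ z : V -> R^o) u : R^o).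
  move=> Uu; apply/cvgrPdist_lt => e e0.
  have e1 : 0 < e / (m + 1) by rewrite divr_gt0.
  apply: filterS (uniform_difference_quotient oU Uu gv cgv e1) => h /= [Uh Hh].
  have cu := jointly_continuous_section cg Uu.
  have ch := jointly_continuous_section cg Uh.
  have cd : continuous (fun z => g (h *: v + u) z - g u z).
    by move=> z; apply: continuousB; [exact: ch|exact: cu].
  rewrite -RintegralB //; try exact: continuous_integrable.
  rewrite -[_ *: _]RintegralZl //; last exact: continuous_integrable.
  apply: le_lt_trans (small _ e0); apply: Rintegral_dist => [||z]; rewrite ?ltW //.
    exact: jointly_continuous_section cgv Uu.
  by move=> z; apply: cvgM; [exact: cvg_cst|exact: cd].
split=> [u Uu|]; first by apply/cvg_ex; eexists; exact: lim_u.
apply: is_Cn_eq (IH _ gv') => // u Uu.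
by rewrite -(cvg_lim _ (lim_u _ Uu)).
Qed.

End CompactParameter.

(** * Smooth functions of several points of a manifold *)

Section ChartSmooth.
Context {R : realType} {n : nat} {M : closed_manifold R n}.

Lemma chart_cover (p : M) : exists2 c, atlas M c & cdom c p.
Proof.
have : [set: M] p by [].
by rewrite -(atlas_smooth M).1 => -[c Mc cp]; exists c.
Qed.

Lemma cmap_continuous (c : chart R n M) p : cdom c p -> {for p, continuous (cmap c)}.
Proof.
move=> cp; have := @cmap_cont _ _ _ c; rewrite continuous_open_subspace; last exact: cdom_open.
by apply; rewrite inE.
Qed.

(** The parameter space and the affine maps are arbitrary, instead of one fixed
    product of charts, so that substitution of variables needs no computation. *)
Definition chart_smooth (I : Type) (F : (I -> M) -> R) :=
  forall (V : normedModType R) (U : set V) (c : I -> chart R n M)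
      (L : I -> V -> 'rV[R]_n),
    open U -> (forall i, atlas M (c i)) -> (forall i, affine_map (L i)) ->
    (forall i u, U u -> cimg (c i) (L i u)) ->
    smooth_on U (fun u => F (fun i => cinv (c i) (L i u)) : R^o).

(** A frozen point is a constant map into a chart that contains it. *)
Lemma chart_smooth_subst (I J : Type) (F : (I -> M) -> R) (s : I -> J + M) :
  chart_smooth F ->
  chart_smooth (fun x : J -> M =>
    F (fun i => match s i with inl j => x j | inr p => p end)).
Proof.
move=> sF V U c L oU Mc aL UL.
have cp (p : M) : {d : chart R n M | atlas M d & cdom d p}.
  by apply: cid2; exact: chart_cover.
pose cc p := s2val (cp p).
pose c' i := match s i with inl j => c j | inr p => cc p end.
pose L' i u := match s i with inl j => L j u | inr p => cmap (cc p) p end.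
have := sF V U c' L' oU.
have -> : (fun u => F (fun i => cinv (c' i) (L' i u))) =
    (fun u => F (fun i => match s i with inl j => cinv (c j) (L j u) | inr p => p end)).
  apply/funext => u; congr F; apply/funext => i; rewrite /c' /L'.
  by case: (s i) => // p; apply: cmapK; rewrite /cc; case: (cp p).
apply.
- by move=> i; rewrite /c'; case: (s i) => // p; rewrite /cc; case: (cp p).
- by move=> i; rewrite /L'; case: (s i) => // p; exact: affine_cst.
- move=> i u Uu; rewrite /c' /L'; case: (s i) => [j|p]; first exact: UL.
  by exists p => //; rewrite /cc; case: (cp p).
Qed.

Lemma chart_smooth_cst (I : Type) (a : R) : chart_smooth (fun _ : I -> M => a).
Proof. by move=> V U c L oU _ _ _ r; exact: is_Cn_cst. Qed.

Lemma chart_smoothD (I : Type) (F G : (I -> M) -> R) :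
  chart_smooth F -> chart_smooth G -> chart_smooth (fun x => F x + G x).
Proof.
move=> sF sG V U c L oU Mc aL UL r.
by apply: is_CnD => //; [exact: sF|exact: sG].
Qed.

Lemma chart_smoothM (I : Type) (F G : (I -> M) -> R) :
  chart_smooth F -> chart_smooth G -> chart_smooth (fun x => F x * G x).
Proof.
move=> sF sG V U c L oU Mc aL UL r.
by apply: is_CnM => //; [exact: sF|exact: sG].
Qed.

Lemma chart_smoothN (I : Type) (F : (I -> M) -> R) :
  chart_smooth F -> chart_smooth (fun x => - F x).
Proof.
move=> sF; under eq_fun do rewrite -mulN1r.
exact: (chart_smoothM (chart_smooth_cst (-1)) sF).
Qed.

(** Continuity for the product topology, stated with boxes because these are the
    sets that products of sigma-algebras control. *)
Definition box_continuous (I : Type) (F : (I -> M) -> R) :=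
  forall x (e : R), 0 < e -> exists W : I -> set M,
    (forall i, nbhs (x i) (W i)) /\
    forall y, (forall i, W i (y i)) -> `|F y - F x| < e.

Lemma open_cimgs k (c : 'I_k -> chart R n M) :
  open [set u : 'M[R]_(k, n) | forall i, cimg (c i) (row i u)].
Proof.
rewrite openE => u cu.
have H i : nbhs u [set v | cimg (c i) (row i v)].
  have [cr _] := affine_row (R := R) n i.
  have oc : open (cimg (c i)) by exact: cimg_open.
  exact: (cr u _ (open_nbhs_nbhs (conj oc (cu i)))).
exact: (@filter_forall _ _ (fun i => [set v | cimg (c i) (row i v)]) (nbhs u)
  (nbhs_filter u) H).
Qed.

Lemma open_prod (S T : topologicalType) (A : set S) (B : set T) :
  open A -> open B -> open (A `*` B).
Proof.
move=> oA oB; rewrite openE => -[a b] [/= Aa Bb].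
by exists (A, B) => //; split; exact: open_nbhs_nbhs.
Qed.

(** The parameter is a matrix whose rows are the coordinates of the points, each
    in a chart around the corresponding point of x. *)
Lemma chart_smooth_box (I : finType) (F : (I -> M) -> R) :
  chart_smooth F -> box_continuous F.
Proof.
move=> sF x e e0.
pose cp (p : M) := cid2 (chart_cover p).
pose c i := s2val (cp (x i)).
have Mc i : atlas M (c i) by rewrite /c; case: (cp (x i)).
have cx i : cdom (c i) (x i) by rewrite /c; case: (cp (x i)).
pose U : set 'M[R]_(#|I|, n) := [set u | forall k, cimg (c (enum_val k)) (row k u)].
pose L i (u : 'M[R]_(#|I|, n)) := row (enum_rank i) u.
pose Phi (u : 'M[R]_(#|I|, n)) : R^o := F (fun i => cinv (c i) (L i u)).
pose mx (y : I -> M) : 'M[R]_(#|I|, n) :=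
  \matrix_(k < #|I|) cmap (c (enum_val k)) (y (enum_val k)).
have Lmx i y : L i (mx y) = cmap (c i) (y i) by rewrite /L rowK enum_rankK.
have Phimx y : (forall i, cdom (c i) (y i)) -> Phi (mx y) = F y.
  by move=> cy; congr F; apply/funext => i; rewrite Lmx cmapK.
have Ux : U (mx x).
  by move=> k; rewrite /mx rowK; exists (x (enum_val k)) => //; exact: cx.
have sPhi : smooth_on U Phi.
  apply: sF => //; first exact: open_cimgs.
    by move=> i; exact: affine_row.
  by move=> i u Uu; have := Uu (enum_rank i); rewrite enum_rankK.
have /cvgrPdist_lt/(_ _ e0) := is_Cn_continuous (sPhi 0%N) Ux.
rewrite Phimx // => -[P xP PF].
exists (fun i => [set y | cdom (c i) y /\
  forall j, P (enum_rank i) j (cmap (c i) y 0 j)]); split.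
  move=> i; near=> y; split; near: y.
    by apply: open_nbhs_nbhs; split => //; exact: cdom_open.
  apply: filter_forall => j.
  have cont : {for x i, continuous (fun y => cmap (c i) y 0 j)}.
    apply: (@continuous_comp _ _ _ (cmap (c i)) (fun m : 'rV[R]_n => m 0 j)).
      exact: cmap_continuous.
    exact: coord_continuous.
  apply: cont; have := xP (enum_rank i) j.
  by rewrite mxE enum_rankK.
move=> y Wy; rewrite distrC -(Phimx y); last by move=> i; case: (Wy i).
apply: PF => k j; rewrite mxE.
by have [_ /(_ j)] := Wy (enum_val k); rewrite enum_valK.
Unshelve. all: by end_near. Qed.

(** Continuity in z can be tested in charts, and the derivative along v at a fixed
    z is the derivative along (v, 0) in any chart around z. *)
Lemma parametric_Cn_charts r (V : normedModType R) (U : set V) (g : V -> M -> R) :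
  open U ->
  (forall c : chart R n M, atlas M c ->
     is_Cn r (U `*` cimg c) (fun p : V * 'rV[R]_n => g p.1 (cinv c p.2) : R^o)) ->
  parametric_Cn r U g.
Proof.
move=> oU; have cont r' g' : (forall c : chart R n M, atlas M c ->
     is_Cn r' (U `*` cimg c) (fun p : V * 'rV[R]_n => g' p.1 (cinv c p.2) : R^o)) ->
    jointly_continuous U g'.
  move=> gC u z Uu; have [c Mc cz] := chart_cover z.
  have Uz : (U `*` cimg c) (u, cmap c z) by split => //; exists z.
  have cg := is_Cn_continuous (gC c Mc) Uz.
  rewrite /prop_for /continuous_at /= in cg *; rewrite cmapK // in cg.
  apply: (@cvg_trans _ ((fun p : V * M => g' p.1 (cinv c (cmap c p.2))) @ (u, z))).
    apply: near_eq_cvg; exists (setT, cdom c) => /=.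
      by split; [exact: filterT|apply: open_nbhs_nbhs; split => //; exact: cdom_open].
    by move=> [u' z'] /= [_ cz']; rewrite cmapK.
  have cz' : (fun p : V * M => (p.1, cmap c p.2)) @ (u, z) --> (u, cmap c z).
    have c1 : (fun p : V * M => p.1) @ (u, z) --> u by exact: cvg_fst.
    have c2 : (fun p : V * M => p.2) @ (u, z) --> z by exact: cvg_snd.
    have c3 : (fun p : V * M => cmap c p.2) @ (u, z) --> cmap c z.
      by apply: (@cvg_comp _ _ _ (fun p : V * M => p.2) (cmap c) _ _ _ c2);
        exact: cmap_continuous.
    exact: cvg_pair c1 c3.
  exact: (@cvg_comp _ _ _ (fun p : V * M => (p.1, cmap c p.2))
    (fun p : V * 'rV[R]_n => g' p.1 (cinv c p.2)) _ _ _ cz' cg).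
elim: r g => [|r IH] g gC; split=> //; try exact: cont gC.
move=> v.
have rateE (c : chart R n M) u w : (fun h : R => h^-1 *:
      (((fun p : V * 'rV[R]_n => g p.1 (cinv c p.2) : R^o) \o shift (u, w)) (h *: (v, 0))
        - g u (cinv c w))) =
    (fun h => h^-1 *: (((g^~ (cinv c w) : V -> R^o) \o shift u) (h *: v) - g u (cinv c w))).
  by apply/funext => h /=; rewrite scaler0 add0r.
split=> [u z Uu|].
  have [c Mc cz] := chart_cover z; have [_ /(_ (v, 0))[+ _]] := gC c Mc.
  have Uz : (U `*` cimg c) (u, cmap c z) by split => //; exists z.
  by move=> /(_ _ Uz); rewrite /derivable rateE cmapK.
apply: IH => c Mc; have [_ /(_ (v, 0))[_ +]] := gC c Mc.
apply: is_Cn_eq; last by move=> [u w] _; rewrite /= /derive rateE.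
by apply: open_prod => //; exact: cimg_open.
Qed.

Variable mu : {measure set (borel M) -> \bar R}.
Hypothesis mu_fin : (mu setT < +oo)%E.

(** Reading z in a chart turns it into one more affine coordinate. *)
Lemma chart_smooth_int (I : Type) (F : (option I -> M) -> R) : chart_smooth F ->
  chart_smooth (fun x : I -> M =>
    \int[mu]_z F (fun o => if o is Some i then x i else z)).
Proof.
move=> sF V U c L oU Mc aL UL r.
have := @parametric_integral _ _ (@mfd_compact _ _ M) _ mu mu_fin r U
  (fun u z => F (fun o => if o is Some i then cinv (c i) (L i u) else z)) oU.
apply; apply: parametric_Cn_charts => // d Md.
have := sF (V * 'rV[R]_n)%type (U `*` cimg d)
  (fun o => if o is Some i then c i else d)
  (fun o p => if o is Some i then L i p.1 else p.2).
have -> : (fun p : V * 'rV[R]_n => F (fun o =>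
     cinv (if o is Some i then c i else d) (if o is Some i then L i p.1 else p.2))) =
   (fun p => F (fun o => if o is Some i then cinv (c i) (L i p.1) else cinv d p.2)).
  by apply/funext => p; congr F; apply/funext; case.
apply.
- by apply: open_prod => //; exact: cimg_open.
- by case.
- case=> [i|]; last exact: affine_snd.
  exact: (affine_comp (affine_fst _ _) (aL i)).
- by case=> [i|] [u w] [/= Uu dw]; [exact: UL|].
Qed.

End ChartSmooth.

(** * Powers of a measure and finiteness of the volume *)

Section Bundles.
Context d (T : measurableType d) {R : realType}.

Lemma sigma_finite_bundle (q : {measure set T -> \bar R}) : sigma_finite setT q ->
  {m : {sigma_finite_measure set T -> \bar R} | (m : set T -> \bar R) = q}.
Proof.
move=> qs; pose H1 := isSFinite.Build d T R q (sfinite_measure_sigma_finite qs).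
pose H2 := isSigmaFinite.Build d T R q qs.
by exists (HB.pack_for (SigmaFiniteMeasure.type T R) (Measure.sort q) H1 H2).
Qed.

Lemma finite_bundle (q : {measure set T -> \bar R}) : (q setT < +oo)%E ->
  {m : {finite_measure set T -> \bar R} | (m : set T -> \bar R) = q}.
Proof.
move=> qfin; have fq : fin_num_fun q.
  move=> U mU; rewrite ge0_fin_numE //.
  by apply: le_lt_trans qfin; apply: le_measure; rewrite ?inE.
have sq : sigma_finite setT q.
  by apply: fin_num_fun_sigma_finite => //; rewrite measure0.
pose H1 := isSFinite.Build d T R q (sfinite_measure_sigma_finite sq).
pose H2 := isSigmaFinite.Build d T R q sq.
pose H3 := isFinite.Build d T R q fq.
by exists (HB.pack_for (FiniteMeasure.type T R) (Measure.sort q) H1 H2 H3).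
Qed.
End Bundles.

Section PowerMeasure.
Context d (T : measurableType d) {R : realType}.

Definition tcons l (p : T * l.-tuple T) : l.+1.-tuple T := [tuple of p.1 :: p.2].

Lemma measurable_tcons l : measurable_fun setT (@tcons l).
Proof. by apply: measurable_cons; [exact: measurable_fst|exact: measurable_snd]. Qed.

Lemma measurable_uncons l :
  measurable_fun setT (fun t : l.+1.-tuple T => (thead t, [tuple of behead t])).
Proof.
by apply: measurable_fun_pair; [exact: measurable_tnth|exact: measurable_behead].
Qed.

(** Powers are defined as bare set functions; integration theory needs them with
    their axioms.  The power l + 1 is the image of mu \x mu^l under the
    concatenation of tuples, whose inverse is measurable too. *)
Lemma pow_measure_sigma_finite (mu : {sigma_finite_measure set T -> \bar R}) l :
  {m : {sigma_finite_measure set (l.-tuple T) -> \bar R} |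
    (m : set _ -> \bar R) = pow_measure mu l}.
Proof.
elim: l => [|l [m mE]]; first by exists (dirac ([tuple] : 0.-tuple T)).
have mt := @measurable_tcons l.
pose p : {measure set (T * l.-tuple T)%type -> \bar R} := product_measure1 mu m.
pose q : {measure set (l.+1.-tuple T) -> \bar R} :=
  measure_function_pushforward__canonical__measure_function_Measure p mt.
have qs : sigma_finite setT q.
  have /sigma_finiteP[F [TF ndF Foo]] := sigma_finiteT mu.
  have /sigma_finiteP[G [TG ndG Goo]] := sigma_finiteT m.
  exists (fun k => (fun t : l.+1.-tuple T =>
      (thead t, [tuple of behead t] : l.-tuple T)) @^-1` (F k `*` G k)).
    apply/esym/seteqP; split => // t _.
    have : setT (thead t) by []. rewrite TF => -[j _ Fj].
    have : setT ([tuple of behead t] : l.-tuple T) by []. rewrite TG => -[k _ Gk].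
    exists (maxn j k) => //; split => /=.
      by move: Fj; exact/subsetPset/ndF/leq_maxl.
    by move: Gk; exact/subsetPset/ndG/leq_maxr.
  move=> k; have [? ?] := Foo k; have [? ?] := Goo k; split.
    rewrite -[X in measurable X]setTI; apply: measurable_uncons => //.
    exact: measurableX.
  rewrite /= /q /pushforward /=.
  rewrite (_ : _ @^-1` _ = F k `*` G k).
    by rewrite product_measure1E // lte_mul_pinfty // ge0_fin_numE.
  have beheadE (x : T) (y : l.-tuple T) : [tuple of behead (tcons (x, y))] = y.
    exact: val_inj.
  by apply/seteqP; split => -[x y] /=; rewrite theadE beheadE.
have [m' m'E] := sigma_finite_bundle qs.
by exists m'; rewrite m'E; apply/funext => A /=; rewrite -mE.
Qed.

Lemma pow_measure_box (mu : {sigma_finite_measure set T -> \bar R}) l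
    (A : 'I_l -> set T) :
  (forall i, measurable (A i)) -> (forall i, mu (A i) < +oo)%E ->
  measurable [set t : l.-tuple T | forall i, A i (tnth t i)] /\
  (pow_measure mu l [set t | forall i, A i (tnth t i)] < +oo)%E.
Proof.
move=> mA; have mbox k (B : 'I_k -> set T) : (forall i, measurable (B i)) ->
    measurable [set t : k.-tuple T | forall i, B i (tnth t i)].
  move=> mB; rewrite (_ : [set t | _] = \bigcap_(i in [set: 'I_k])
      ((fun t : k.-tuple T => tnth t i) @^-1` B i)); last first.
    by apply/seteqP; split => [t Bt i _|t Bt i]; [exact: Bt|exact: Bt].
  apply: fin_bigcap_measurable => // i _.
  by rewrite -[X in measurable X]setTI; exact: measurable_tnth.
split; first exact: mbox.
elim: l A mA H => [|l IH] A mA H /=.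
  by rewrite diracE; case: (_ \in _); rewrite ltry.
rewrite (_ : _ @^-1` _ = A ord0 `*`
    [set t : l.-tuple T | forall i, A (lift ord0 i) (tnth t i)]); last first.
  apply/seteqP; split => -[x t] /=.
    move=> At; split; first by have := At ord0.
    by move=> i; have := At (lift ord0 i); rewrite tnthS.
  by move=> [A0 At] i; case: (unliftP ord0 i) => [j|] ->; rewrite ?tnthS.
have [m mE] := pow_measure_sigma_finite mu l.
rewrite -mE product_measure1E //; last first.
  by apply: (mbox _ (fun i => A (lift ord0 i))).
rewrite lte_mul_pinfty ?ge0_fin_numE //; first exact: H.
by have := IH (fun i => A (lift ord0 i)); rewrite -mE; apply.
Qed.

(** Both sides are suprema over the simple functions below the integrand. *)
Lemma ge0_le_integral_raw (mu : {measure set T -> \bar R}) (f g : T -> \bar R) :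
  (forall x, 0 <= f x)%E -> (forall x, f x <= g x)%E ->
  (\int[mu]_x f x <= \int[mu]_x g x)%E.
Proof.
move=> f0 fg; rewrite !ge0_integralTE //; last first.
  by move=> x; exact: le_trans (f0 x) (fg x).
apply: le_ereal_sup => _ [h hf <-]; exists h => // x.
exact: le_trans (hf x) (fg x).
Qed.
End PowerMeasure.

Section VolumeFinite.
Context {R : realType} {n : nat} {M : closed_manifold R n}.
Variables (om : volume_form M) (mu : {measure set (borel M) -> \bar R}).
Hypothesis mu_om : is_volume_measure om mu.

(** In a small ball of a chart the coefficient of the form is bounded, so that the
    volume is at most a multiple of the Lebesgue measure of a box. *)
Lemma volume_locally_finite (p : M) :
  exists B : set M, [/\ open B, B p & (mu B < +oo)%E].
Proof.
have [c Mc cp] := chart_cover p.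
have cq : cimg c (cmap c p) by exists p.
have /cvgrPdist_lt/(_ _ ltr01) := is_Cn_continuous (vcoef_smooth om Mc 0%N) cq.
move=> /nbhs_ballP[r /= r0 qr].
pose B := cdom c `&` cmap c @^-1` (ball (cmap c p) r).
have Bp : B p by split => //; exact: ballxx.
have oB : open B.
  rewrite openE => y [cy yr]; apply: filterI.
    by apply: open_nbhs_nbhs; split => //; exact: cdom_open.
  apply: (cmap_continuous cy); apply: open_nbhs_nbhs; split => //.
  exact: ball_open.
exists B; split => //.
rewrite (mu_om Mc) //; last 2 first.
- exact: sub_sigma_algebra.
- by move=> y [].
(* the radius r is such that the coefficient varies by less than 1 *)
pose C := 1 + `|vcoef om c (cmap c p)|.
pose A i := ball (cmap c p 0 i) r.
have mA i : measurable (A i) by apply: open_measurable; exact: ball_open.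
have lA i : (lebesgue_measure (A i) < +oo)%E.
  rewrite /A ball_itv lebesgue_measure_itv /=; case: ifP => // _.
  by rewrite -EFinD ltry.
have [mbox fbox] := @pow_measure_box _ _ _ (@lebesgue_measure R) n A mA lA.
have [m mE] := pow_measure_sigma_finite (@lebesgue_measure R) n.
rewrite -mE in fbox *.
pose box := [set t : n.-tuple R | forall i, A i (tnth t i)].
apply: (@le_lt_trans _ _ (\int[m]_t (C%:E * (\1_box t)%:E))%E); last first.
  rewrite ge0_integralZl //; last 2 first.
  - by apply/measurable_EFinP; exact: measurable_indic.
  - by rewrite lee_fin addr_ge0.
  by rewrite integral_indic // setIT lte_mul_pinfty // lee_fin addr_ge0.
rewrite integral_mkcond; apply: ge0_le_integral_raw => t.
  by rewrite patchE; case: ifP => // _; rewrite lee_fin.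
rewrite patchE; case: ifPn => [|_]; last by rewrite mule_ge0 // lee_fin ?addr_ge0.
rewrite inE /= => -[y [cy yr] ye].
rewrite indicE mem_set ?mule1 /=; last first.
  move=> i; rewrite /A; have := yr; rewrite /= ye => -[_ /(_ 0 i)].
  by rewrite mxE.
rewrite lee_fin -ye /C -lerBlDr; apply: le_trans (lerB_dist _ _) _.
by rewrite distrC ltW // qr.
Qed.

Lemma volume_finite : (mu setT < +oo)%E.
Proof.
pose B (p : M) := sval (cid (volume_locally_finite p)).
have oB p : open (B p) by rewrite /B; case: cid => ? [].
have Bp p : B p p by rewrite /B; case: cid => ? [].
have fB p : (mu (B p) < +oo)%E by rewrite /B; case: cid => ? [].
have := @mfd_compact _ _ M; rewrite compact_cover => cM.
have [] := cM M setT B => // [p _|D _ cD]; first by exists p.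
have mB p : measurable (B p : set (borel M)) by exact: sub_sigma_algebra.
have fin_union (s : seq M) : measurable (\big[setU/set0]_(p <- s) (B p : set (borel M))) /\
    (mu (\big[setU/set0]_(p <- s) (B p : set (borel M))) < +oo)%E.
  elim: s => [|p s [ms fs]]; first by rewrite big_nil measure0 ltry.
  rewrite big_cons; split; first exact: measurableU.
  apply: le_lt_trans (measureU2 mu (mB p) ms) _.
  exact: (lte_add_pinfty (fB p) fs).
have [mD fD] := fin_union (finmap.enum_fset D).
apply: le_lt_trans fD; apply: le_measure; rewrite ?inE // => q _.
by have [p pD Bpq] := cD q Logic.I; rewrite -bigcup_seq; exists p.
Qed.

End VolumeFinite.

(** * Fubini for smooth functions *)

Section BoxContinuous.
Context {R : realType} {n : nat} {M : closed_manifold R n}.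

(** By second countability the preimage of an open ray is a countable union of
    boxes, and measurability of the coordinates suffices for boxes. *)
Lemma box_continuous_measurable (I : finType) (F : (I -> M) -> R)
    d (T : measurableType d) (g : I -> T -> borel M) :
  box_continuous F -> (forall i, measurable_fun setT (g i)) ->
  measurable_fun setT (fun t => F (fun i => g i t)).
Proof.
move=> cF mg; have [Bs cBs [oBs bBs]] := @mfd_second_countable _ _ M.
have /countable_injP[f finj] := cBs.
(* [e] enumerates the countable base, through an injection [f] of it into nat; the
   union has at most one member, and exactly one when k comes from the base *)
pose e (k : nat) : set M := \bigcup_(b in [set b | Bs b /\ f b = k]) b.
have oe k : open (e k) by apply: bigcup_open => b [Bb _]; exact: oBs.
have ef b : Bs b -> e (f b) = b.
  move=> Bb; apply/seteqP; split => [x [b' [Bb' fb] b'x]|x bx]; last by exists b.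
  by rewrite -(finj b' b) ?inE.
move=> mD; apply: (measurability _ (RGenOInfty.measurableE R)) => //.
move=> /= _ [_ [a ->] <-]; rewrite setTI.
pose D : set {ffun I -> nat} := [set w | forall y : I -> M,
  (forall i, e (w i) (y i)) -> a < F y].
rewrite (_ : _ @^-1` _ = \bigcup_(w in D) \bigcap_(i in [set: I]) (g i @^-1` e (w i))).
  rewrite bigcup_mkcond; apply: countable_bigcupT_measurable => [|w].
    exact: countableP.
  case: ifP => // _; apply: fin_bigcap_measurable => // i _.
  rewrite -[X in measurable X]setTI; apply: mg => //.
  exact: sub_sigma_algebra (oe _).
apply/seteqP; split => [t /=|t [w Dw wt]] /=; rewrite in_itv /= andbT; last first.
  by apply: Dw => i; exact: wt.
rewrite -subr_gt0 => /(cF (fun i => g i t))[W [Wx WF]].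
have hb i : exists b, [/\ Bs b, b (g i t) & b `<=` W i].
  by have [b [Bb bx] bW] := bBs (g i t) _ (Wx i); exists b.
pose b i := sval (cid (hb i)).
have bP i : [/\ Bs (b i), b i (g i t) & b i `<=` W i] by rewrite /b; case: cid.
exists [ffun i => f (b i)].
  move=> y ey; have := WF y; rewrite ltr_distl => /(_ _)/andP[|+ _].
    by move=> i; have [Bb _] := bP i; apply; have := ey i; rewrite ffunE ef.
  by rewrite opprB addrC subrK.
by move=> i _; have [Bb bx _] := bP i; rewrite /= ffunE ef.
Qed.

(** Compactness of M^I is the theorem of Tychonoff. *)
Lemma box_continuous_bounded (I : finType) (F : (I -> M) -> R) :
  box_continuous F -> exists C, forall x, `|F x| <= C.
Proof.
move=> cF; pose K (i : I) := (M : topologicalType).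
have cK : compact [set: prod_topology K].
  have -> : [set: prod_topology K] = [set f | forall i, [set: K i] (f i)].
    by apply/seteqP; split.
  by apply: (@tychonoff I K (fun=> setT)) => i; exact: mfd_compact.
apply: (continuous_bounded cK) => x; apply/cvgrPdist_lt => e e0.
have [W [Wx WF]] := cF x e e0.
have FF : Filter (nbhs (x : prod_topology K)) by exact: nbhs_filter.
have H i : nbhs (x : prod_topology K) [set y | W i (y i)].
  exact: (@proj_continuous I K i x _ (Wx i)).
apply: filterS (@filter_forall _ _ (fun i => [set y | W i (y i)]) _ FF H) => y Wy.
by rewrite distrC; exact: WF.
Qed.

End BoxContinuous.

Section BoundedFubini.
Context d1 d2 (T1 : measurableType d1) (T2 : measurableType d2) {R : realType}.
Variables (m1 : {finite_measure set T1 -> \bar R})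
  (m2 : {finite_measure set T2 -> \bar R}).
Variables (f : T1 * T2 -> R) (C : R).
Hypotheses (mf : measurable_fun setT f) (fC : forall p, `|f p| <= C).

Let fin1 : (m1 setT < +oo)%E.
Proof. by rewrite -ge0_fin_numE // fin_num_measure. Qed.
Let fin2 : (m2 setT < +oo)%E.
Proof. by rewrite -ge0_fin_numE // fin_num_measure. Qed.

Let int2 x : m2.-integrable setT (EFin \o (fun y => f (x, y))).
Proof.
apply: (@bounded_integrable _ _ _ _ fin2 _ C) => //.
exact: (measurable_fun_pair2 x mf).
Qed.

Let int1 y : m1.-integrable setT (EFin \o (fun x => f (x, y))).
Proof.
apply: (@bounded_integrable _ _ _ _ fin1 _ C) => //.
exact: (measurable_fun_pair1 y mf).
Qed.

Let int12 : (product_measure1 m1 m2).-integrable setT (EFin \o f).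
Proof.
have fin12 : (product_measure1 m1 m2 setT < +oo)%E.
  have := product_measure1E m1 m2 (@measurableT _ T1) (@measurableT _ T2).
  by rewrite setXTT /= => ->; rewrite lte_mul_pinfty // ge0_fin_numE.
exact: (@bounded_integrable _ _ _ _ fin12 _ C).
Qed.

Lemma Rintegral_prod12 :
  \int[m1]_x \int[m2]_y f (x, y) = \int[product_measure1 m1 m2]_p f p.
Proof.
rewrite /Rintegral -(integral12_prod_meas1 int12); congr fine.
by apply: eq_integral => x _; rewrite fineK //; exact: (integrable_fin_num _ (int2 x)).
Qed.

Lemma Rintegral_prod21 :
  \int[m2]_y \int[m1]_x f (x, y) = \int[product_measure1 m1 m2]_p f p.
Proof.
rewrite /Rintegral -(integral21_prod_meas1 int12); congr fine.
by apply: eq_integral => y _; rewrite fineK //; exact: (integrable_fin_num _ (int1 y)).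
Qed.

Lemma Rintegral_swap :
  \int[m1]_x \int[m2]_y f (x, y) = \int[m2]_y \int[m1]_x f (x, y).
Proof. by rewrite Rintegral_prod12 Rintegral_prod21. Qed.

End BoundedFubini.

Section SmoothComplex.
Context {R : realType} {n : nat} {M : closed_manifold R n}.
Local Notation C := R[i].

Lemma ComplexE (a b c d : R) : a = c -> b = d -> Complex a b = Complex c d.
Proof. by move=> -> ->. Qed.

Lemma ReM (a b : C) : complex.Re (a * b) =
  complex.Re a * complex.Re b - complex.Im a * complex.Im b.
Proof. by case: a b => [a a'] [b b']. Qed.

Lemma ImM (a b : C) : complex.Im (a * b) =
  complex.Re a * complex.Im b + complex.Im a * complex.Re b.
Proof. by case: a b => [a a'] [b b']. Qed.

Definition smoothC (I : Type) (F : (I -> M) -> C) :=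
  chart_smooth (fun x => complex.Re (F x)) /\
  chart_smooth (fun x => complex.Im (F x)).

Lemma smoothC_subst (I J : Type) (F : (I -> M) -> C) (s : I -> J + M) :
  smoothC F ->
  smoothC (fun x : J -> M =>
    F (fun i => match s i with inl j => x j | inr p => p end)).
Proof.
by case=> FR FI; split;
  [exact: (chart_smooth_subst s FR)|exact: (chart_smooth_subst s FI)].
Qed.

Lemma smoothC_rename (I J : Type) (F : (I -> M) -> C) (s : I -> J) :
  smoothC F -> smoothC (fun x : J -> M => F (fun i => x (s i))).
Proof. by move=> sF; exact: (smoothC_subst (fun i => inl (s i)) sF). Qed.

Lemma smoothC_cst (I : Type) (a : C) : smoothC (fun _ : I -> M => a).
Proof. by split; exact: chart_smooth_cst. Qed.

Lemma smoothCM (I : Type) (F G : (I -> M) -> C) :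
  smoothC F -> smoothC G -> smoothC (fun x => F x * G x).
Proof.
move=> [FR FI] [GR GI]; split.
  under eq_fun do rewrite ReM.
  exact: chart_smoothD (chart_smoothM FR GR) (chart_smoothN (chart_smoothM FI GI)).
under eq_fun do rewrite ImM.
exact: chart_smoothD (chart_smoothM FR GI) (chart_smoothM FI GR).
Qed.

Lemma smoothC_prod (I : Type) (V : finType) (F : V -> (I -> M) -> C) :
  (forall v, smoothC (F v)) -> smoothC (fun x => \prod_(v : V) F v x).
Proof.
move=> sF; elim: (index_enum V) => [|v s IH].
  by under eq_fun do rewrite big_nil; exact: smoothC_cst.
by under eq_fun do rewrite big_cons; exact: smoothCM.
Qed.

Variable mu : {finite_measure set (borel M) -> \bar R}.

Let mu_fin : (mu setT < +oo)%E.
Proof. by rewrite -ge0_fin_numE // fin_num_measure. Qed.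

Lemma smoothC_int (I : Type) (F : (option I -> M) -> C) : smoothC F ->
  smoothC (fun x : I -> M => cintegral mu (fun z : borel M =>
    F (fun o => if o is Some i then x i else z))).
Proof.
case=> FR FI; split => /=.
  exact: (@chart_smooth_int _ _ _ mu mu_fin I (fun x => complex.Re (F x))).
exact: (@chart_smooth_int _ _ _ mu mu_fin I (fun x => complex.Im (F x))).
Qed.

Lemma eq_cintegral d (T : measurableType d) (m : set T -> \bar R) (f g : T -> C) :
  f =1 g -> cintegral m f = cintegral m g.
Proof. by move=> /funext ->. Qed.

Lemma smoothC_measurable (I : finType) (F : (I -> M) -> C)
    d (T : measurableType d) (g : I -> T -> borel M) :
  smoothC F -> (forall i, measurable_fun setT (g i)) ->
  measurable_fun setT (fun t => complex.Re (F (fun i => g i t))) /\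
  measurable_fun setT (fun t => complex.Im (F (fun i => g i t))).
Proof.
by move=> [FR FI] mg; split;
  [apply: (box_continuous_measurable (chart_smooth_box FR) mg)
  |apply: (box_continuous_measurable (chart_smooth_box FI) mg)].
Qed.

Lemma smoothC_bounded (I : finType) (F : (I -> M) -> C) : smoothC F ->
  exists K, forall x, `|complex.Re (F x)| <= K /\ `|complex.Im (F x)| <= K.
Proof.
move=> [FR FI].
have [K1 H1] := box_continuous_bounded (chart_smooth_box FR).
have [K2 H2] := box_continuous_bounded (chart_smooth_box FI).
exists (Num.max K1 K2) => x; split; apply: (le_trans (H1 x)) || apply: (le_trans (H2 x)).
  by rewrite le_max lexx.
by rewrite le_max lexx orbT.
Qed.

(** Two variables are indexed by bool, which leaves the other ones to be frozen by
    substitution. *)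
Lemma cintegral_swap (F : (bool -> M) -> C) : smoothC F ->
  cintegral mu (fun z : borel M => cintegral mu (fun w : borel M =>
    F (fun b => if b then z else w))) =
  cintegral mu (fun w : borel M => cintegral mu (fun z : borel M =>
    F (fun b => if b then z else w))).
Proof.
move=> sF; pose g (b : bool) (p : borel M * borel M) := if b then p.1 else p.2.
have mg b : measurable_fun setT (g b).
  by case: b; [exact: measurable_fst|exact: measurable_snd].
have [mR mI] := smoothC_measurable sF mg.
have [K FK] := smoothC_bounded sF.
have gE (z w : borel M) : (fun b : bool => g b (z, w)) = (fun b => if b then z else w).
  by apply/funext; case.
apply: ComplexE.
  transitivity (\int[mu]_z \int[mu]_w complex.Re (F (fun b => g b (z, w)))).
    by congr fine; apply: eq_integral => z _; rewrite /Rintegral; congr (_ %:E);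
     congr fine; apply: eq_integral => w _; rewrite gE.
  rewrite (Rintegral_swap mu mu mR (fun p => (FK (fun b => g b p)).1)).
  by congr fine; apply: eq_integral => z _; rewrite /Rintegral; congr (_ %:E);
     congr fine; apply: eq_integral => w _; rewrite gE.
transitivity (\int[mu]_z \int[mu]_w complex.Im (F (fun b => g b (z, w)))).
  by congr fine; apply: eq_integral => z _; rewrite /Rintegral; congr (_ %:E);
   congr fine; apply: eq_integral => w _; rewrite gE.
rewrite (Rintegral_swap mu mu mI (fun p => (FK (fun b => g b p)).2)).
by congr fine; apply: eq_integral => z _; rewrite /Rintegral; congr (_ %:E);
   congr fine; apply: eq_integral => w _; rewrite gE.
Qed.

(** The factor comes out of the real and imaginary parts only together with
    additivity, hence the smoothness that ensures integrability. *)
Lemma cintegralZ (F : (unit -> M) -> C) (a : C) : smoothC F ->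
  cintegral mu (fun z : borel M => a * F (fun=> z)) =
  a * cintegral mu (fun z : borel M => F (fun=> z)).
Proof.
move=> sF.
have [mR mI] := smoothC_measurable sF (fun=> @measurable_id _ (borel M) setT).
have [K FK] := smoothC_bounded sF.
have iR := bounded_integrable mu_fin mR (fun z => (FK (fun=> z)).1).
have iI := bounded_integrable mu_fin mI (fun z => (FK (fun=> z)).2).
have iZ (b : R) f : mu.-integrable setT (EFin \o f) ->
    mu.-integrable setT (EFin \o (fun z => b * f z)).
  by move=> fi; exact: (integrableZl measurableT b fi).
case: a => a b; apply: ComplexE.
  rewrite -!RintegralZl // -RintegralB //; [|exact: iZ|exact: iZ].
  by congr fine; apply: eq_integral => z _; rewrite ReM.
rewrite -!RintegralZl // -RintegralD //; [|exact: iZ|exact: iZ].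
by congr fine; apply: eq_integral => z _; rewrite ImM.
Qed.

Lemma cintegral_pow0 (f : 0.-tuple (borel M) -> C) :
  cintegral (pow_measure mu 0) f = f [tuple].
Proof.
rewrite /cintegral /=; case E: (f [tuple]) => [a b].
have intE (g : 0.-tuple (borel M) -> R) :
    fine (\int[@pow_measure _ (borel M) R mu 0]_x (g x)%:E) = g [tuple].
  have -> : (fun x => (g x)%:E) = (cst (g [tuple])%:E).
    by apply/funext => x; rewrite tuple0.
  pose m : {measure set (0.-tuple (borel M)) -> \bar R} :=
    dirac ([tuple] : 0.-tuple (borel M)).
  rewrite -[pow_measure mu 0]/(m : set _ -> \bar R) integral_cst //.
  by rewrite (_ : m setT = 1%E) ?mule1 //; exact: diracT.
by rewrite !intE E.
Qed.

Let pow_finite l : {m : {finite_measure set (l.-tuple (borel M)) -> \bar R} |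
  (m : set _ -> \bar R) = pow_measure mu l}.
Proof.
have [m mE] := pow_measure_sigma_finite mu l.
have mfin : (m setT < +oo)%E.
  have [_] := @pow_measure_box _ (borel M) R mu l (fun=> setT)
    (fun=> measurableT) (fun=> mu_fin).
  by rewrite -mE (_ : [set t | _] = setT) //; apply/seteqP; split.
by have [m' m'E] := finite_bundle mfin; exists m'; rewrite m'E; exact: mE.
Qed.

(** The power measure is an image of the product measure, so this is Fubini after
    a change of variables. *)
Lemma cintegral_powS l (F : ('I_l.+1 -> M) -> C) : smoothC F ->
  cintegral (pow_measure mu l.+1) (fun t => F (fun i => tnth t i)) =
  cintegral mu (fun z : borel M => cintegral (pow_measure mu l) (fun t : l.-tuple (borel M) =>
    F (fun i => tnth [tuple of z :: t] i))).
Proof.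
move=> sF; have [m mE] := pow_finite l; rewrite -mE.
have mt := @measurable_tcons _ (borel M) l.
have mg i : measurable_fun setT (fun t : l.+1.-tuple (borel M) => tnth t i).
  exact: measurable_tnth.
have [mR mI] := smoothC_measurable sF mg.
have mg' i : measurable_fun setT (fun p : borel M * l.-tuple (borel M) => tnth (tcons p) i).
  by apply: (measurableT_comp (mg i)).
have [mR' mI'] := smoothC_measurable sF mg'.
have [K FK] := smoothC_bounded sF.
pose p : {measure set (borel M * l.-tuple (borel M))%type -> \bar R} := product_measure1 mu m.
have fin12 : (p setT < +oo)%E.
  have := product_measure1E mu m (@measurableT _ _) (@measurableT _ _).
  rewrite setXTT /= => ->; rewrite lte_mul_pinfty // ?ge0_fin_numE //.
  by rewrite -ge0_fin_numE // fin_num_measure.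
have key (f : l.+1.-tuple (borel M) -> R) : measurable_fun setT f ->
    (forall t, `|f t| <= K) ->
    fine (\int[pow_measure mu l.+1]_t (f t)%:E) = \int[mu]_z \int[m]_t f [tuple of z :: t].
  move=> mf fK; have mft : measurable_fun setT (fun p => f (tcons p)).
    exact: measurableT_comp.
  have e := Rintegral_prod12 mu m mft (fun p => fK (tcons p)).
  rewrite -[RHS]/(\int[mu]_z \int[m]_t f (tcons (z, t))) e.
  have -> : pow_measure mu l.+1 = pushforward p (@tcons _ (borel M) l).
    rewrite -[LHS]/(fun A => product_measure1 mu (pow_measure mu l)
      (@tcons _ (borel M) l @^-1` A)) -mE.
    by [].
  rewrite (@integral_pushforward _ _ _ _ _ _ mt p setT (fun t => (f t)%:E)) //.
    exact/measurable_EFinP.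
  exact: (@bounded_integrable _ _ _ p fin12 _ K).
apply: ComplexE.
  by rewrite (key _ mR) // => t; case: (FK (fun i => tnth t i)).
by rewrite (key _ mI) // => t; case: (FK (fun i => tnth t i)).
Qed.

End SmoothComplex.

(** * Integration over a finite set of variables *)

Section IteratedIntegrals.
Context {R : realType} {n : nat} {M : closed_manifold R n}.
Variable mu : {finite_measure set (borel M) -> \bar R}.
Local Notation C := R[i].

Definition upd (I : eqType) (x : I -> M) (j : I) (z : M) : I -> M :=
  fun i => if i == j then z else x i.

(** Integrals are taken in named variables of an assignment, the result still
    being a function of the assignment.  Iterated integrals then compose without
    any dependent type, and permuting them is permuting a list of names. *)
Definition int_at (I : eqType) (j : I) (F : (I -> M) -> C) : (I -> M) -> C :=
  fun x => cintegral mu (fun z : borel M => F (upd x j z)).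

Definition int_over (I : eqType) (s : seq I) (F : (I -> M) -> C) : (I -> M) -> C :=
  foldr (@int_at I) F s.

Lemma smoothC_int_at (I : eqType) (j : I) F : smoothC F -> smoothC (int_at j F).
Proof.
move=> sF.
have := smoothC_int mu (smoothC_rename (fun i => if i == j then None else Some i) sF).
congr smoothC; apply/funext => x; apply: eq_cintegral => z; congr F.
by apply/funext => i; rewrite /upd; case: (i == j).
Qed.

Lemma smoothC_int_over (I : eqType) (s : seq I) F :
  smoothC F -> smoothC (int_over s F).
Proof. by move=> sF; elim: s => //= j s; exact: smoothC_int_at. Qed.

Lemma int_at_comm (I : eqType) (j k : I) F : smoothC F ->
  int_at j (int_at k F) = int_at k (int_at j F).
Proof.
move=> sF; have [->//|jk] := eqVneq j k; apply/funext => x.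
have sG := smoothC_subst (fun i => if i == j then inl true
  else if i == k then inl false else inr (x i)) sF.
have := cintegral_swap mu sG; rewrite /int_at /=.
have E (z w : M) : upd (upd x j z) k w = (fun i => match (if i == j then inl true
    else if i == k then inl false else inr (x i)) with
    | inl b => if b then z else w | inr p => p end).
  apply/funext => i; rewrite /upd; case: (eqVneq i k) => [->|_].
    by rewrite eq_sym (negbTE jk).
  by case: (i == j).
have E' (z w : M) : upd (upd x k w) j z = upd (upd x j z) k w.
  apply/funext => i; rewrite /upd; case: (eqVneq i k) => [->|//].
  by rewrite eq_sym (negbTE jk).
move=> H; rewrite /int_at; under eq_cintegral => z do under eq_cintegral => w do rewrite E.
by under [RHS]eq_cintegral => w do under eq_cintegral => z do rewrite E' E.
Qed.

Lemma int_over_int_at (I : eqType) (j : I) s F : smoothC F ->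
  int_over s (int_at j F) = int_at j (int_over s F).
Proof.
move=> sF; elim: s => //= k s ->; apply: int_at_comm.
exact: smoothC_int_over.
Qed.

Lemma int_over_cat (I : eqType) (s t : seq I) F :
  int_over (s ++ t) F = int_over s (int_over t F).
Proof. by rewrite /int_over foldr_cat. Qed.

(** Integrations commute pairwise, so each one can be moved to the front. *)
Lemma int_over_perm (I : eqType) (s t : seq I) F : smoothC F -> perm_eq s t ->
  int_over s F = int_over t F.
Proof.
move=> sF; elim: s t => [|j s IH] t st.
  by move: st; rewrite perm_sym => /perm_nilP ->.
have jt : j \in t by rewrite -(perm_mem st) mem_head.
case/splitPr: jt st => t1 t2; rewrite perm_sym perm_catC /= perm_cons perm_catC perm_sym => st.
rewrite /= (IH _ st) !int_over_cat /= int_over_int_at //.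
exact: smoothC_int_over.
Qed.

(** All changes of variables below are instances: [h] renames the integration
    variables and [phi] transports the whole assignment, which may have further
    variables or be extended by constants. *)
Lemma int_over_rename (I J : eqType) (h : J -> I) (phi : (J -> M) -> (I -> M))
    (s : seq J) F y :
  (forall y j z, j \in s -> phi (upd y j z) = upd (phi y) (h j) z) ->
  int_over (map h s) F (phi y) = int_over s (F \o phi) y.
Proof.
elim: s y => //= j s IH y phiE; apply: eq_cintegral => z.
rewrite -phiE ?mem_head // IH // => y' k z' ks.
by rewrite phiE // inE ks orbT.
Qed.

Lemma int_over_indep (I : eqType) (s : seq I) F x y :
  (forall i, i \notin s -> x i = y i) -> int_over s F x = int_over s F y.
Proof.
elim: s x y => [|j s IH] x y xy /=; first by congr F; apply/funext => i; exact: xy.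
apply: eq_cintegral => z; apply: IH => i is_; rewrite /upd.
by case: eqVneq => // ij; apply: xy; rewrite inE negb_or ij.
Qed.

Lemma int_overZ (I : eqType) (s : seq I) F (a : C) : smoothC F ->
  int_over s (fun x => a * F x) = (fun x => a * int_over s F x).
Proof.
move=> sF; elim: s => //= j s ->; apply/funext => x.
rewrite /int_at.
have sG := smoothC_subst (fun i => if i == j then inl tt else inr (x i))
  (smoothC_int_over s sF).
have E (z : M) : upd x j z = (fun i => match (if i == j then inl tt else inr (x i))
    with inl _ => z | inr p => p end).
  by apply/funext => i; rewrite /upd; case: (i == j).
have := cintegralZ mu a sG => H.
by under eq_cintegral => z do rewrite E; rewrite H;
   under [in RHS]eq_cintegral => z do rewrite E.
Qed.

(** The base point is immaterial by [int_over_indep], all variables being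
    integrated. *)
Definition Int (J : finType) (F : (J -> M) -> C) : C :=
  int_over (enum J) F (fun=> point).

Lemma eq_Int (J : finType) (F G : (J -> M) -> C) : F =1 G -> Int F = Int G.
Proof. by move=> /funext ->. Qed.

Lemma Int_base (J : finType) (F : (J -> M) -> C) x : Int F = int_over (enum J) F x.
Proof. by apply: int_over_indep => i; rewrite mem_enum. Qed.

Lemma Int_void (J : finType) (F : (J -> M) -> C) x : #|J| = 0%N -> Int F = F x.
Proof.
move=> J0; rewrite (Int_base F x) (_ : enum J = [::]) //.
by apply: size0nil; rewrite -cardE.
Qed.

Lemma Int_bij (J J' : finType) (h : J -> J') (F : (J -> M) -> C) :
  bijective h -> smoothC F -> Int (fun x : J' -> M => F (x \o h)) = Int F.
Proof.
move=> [g hK gK] sF; have pe : perm_eq (enum J') (map h (enum J)).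
  apply: uniq_perm; rewrite ?enum_uniq ?(map_inj_uniq (can_inj hK)) ?enum_uniq //.
  by move=> j; rewrite mem_enum -[j]gK map_f ?mem_enum.
rewrite /Int (int_over_perm (smoothC_rename h sF) pe).
rewrite -[X in int_over _ _ X]/((fun y : J -> M => y \o g) (fun=> point)).
rewrite int_over_rename; last first.
  move=> y j z _; apply/funext => i; rewrite /upd /=.
  by rewrite (can2_eq gK hK).
rewrite -/(Int _); apply: eq_Int => x /=; congr F.
by apply/funext => j /=; rewrite hK.
Qed.

Definition sumf (J J' : Type) (x : J -> M) (y : J' -> M) (i : J + J') : M :=
  match i with inl j => x j | inr j => y j end.

Lemma int_over_inr (J J' : eqType) (s : seq J') (F : (J + J' -> M) -> C) x y :
  int_over (map inr s) F (sumf x y) = int_over s (fun y => F (sumf x y)) y.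
Proof.
rewrite (@int_over_rename _ _ inr (sumf x)) // => {}y j z _.
by apply/funext => -[i|i].
Qed.

Lemma Int_sum (J J' : finType) (F : (J + J' -> M) -> C) : smoothC F ->
  Int F = Int (fun x => Int (fun y => F (sumf x y))).
Proof.
move=> sF.
have pe : perm_eq (enum {: J + J'}) (map inl (enum J) ++ map inr (enum J')).
  have iL : injective (@inl J J') by move=> ? ? [].
  have iR : injective (@inr J J') by move=> ? ? [].
  apply: uniq_perm; rewrite ?enum_uniq // ?cat_uniq.
    rewrite (map_inj_uniq iL) (map_inj_uniq iR) !enum_uniq andbT.
    by apply/hasPn => _ /mapP[j _ ->]; apply/mapP => -[].
  move=> [j|j]; rewrite mem_enum mem_cat; apply/esym/orP; [left|right];
    by rewrite map_f ?mem_enum.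
rewrite /Int (int_over_perm sF pe) int_over_cat.
have -> : (fun _ : J + J' => point) = sumf (fun=> point) (fun=> point) :> (_ -> M).
  by apply/funext => -[].
rewrite (@int_over_rename _ _ inl (fun x => sumf x (fun=> point))); last first.
  by move=> y j z _; apply/funext => -[i|i].
by rewrite -/(Int _); apply: eq_Int => x /=; rewrite int_over_inr.
Qed.

Definition optf (J : Type) (z : M) (x : J -> M) (o : option J) : M :=
  if o is Some j then x j else z.

Lemma Int_option (J : finType) (F : (option J -> M) -> C) : smoothC F ->
  Int F = cintegral mu (fun z : borel M => Int (fun x => F (optf z x))).
Proof.
move=> sF.
have pe : perm_eq (enum {: option J}) (None :: map Some (enum J)).
  have iS : injective (@Some J) by move=> ? ? [].
  apply: uniq_perm; rewrite ?enum_uniq //=.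
    by rewrite (map_inj_uniq iS) enum_uniq andbT; apply/mapP => -[].
  move=> [j|]; rewrite mem_enum; apply/esym; last exact: mem_head.
  by rewrite in_cons; apply/orP; right; rewrite map_f ?mem_enum.
rewrite /Int (int_over_perm sF pe) /=; apply: eq_cintegral => z.
have -> : upd (fun=> point) None z = optf z (fun=> point) :> (option J -> M).
  by apply/funext => -[].
rewrite (@int_over_rename _ _ Some (optf z)) // => y j w _.
by apply/funext => -[].
Qed.

Lemma Int_option_inner (J : finType) (F : (option J -> M) -> C) : smoothC F ->
  Int F = Int (fun x => cintegral mu (fun z : borel M => F (optf z x))).
Proof.
move=> sF.
have pe : perm_eq (enum {: option J}) (map Some (enum J) ++ [:: None]).
  have iS : injective (@Some J) by move=> ? ? [].
  apply: uniq_perm; rewrite ?enum_uniq // ?cat_uniq.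
    by rewrite (map_inj_uniq iS) enum_uniq /= orbF andbT; apply/mapP => -[].
  move=> [j|]; rewrite mem_enum mem_cat; apply/esym/orP; last first.
    by right; rewrite mem_head.
  by left; rewrite map_f ?mem_enum.
rewrite /Int (int_over_perm sF pe) int_over_cat.
have -> : (fun=> point) = optf point (fun=> point) :> (option J -> M).
  by apply/funext => -[].
rewrite (@int_over_rename _ _ Some (optf point)); last first.
  by move=> y j w _; apply/funext => -[].
rewrite -/(Int _); apply: eq_Int => x /=; apply: eq_cintegral => z; congr F.
by apply/funext => -[].
Qed.

Lemma IntZ (J : finType) (F : (J -> M) -> C) a : smoothC F ->
  Int (fun x => a * F x) = a * Int F.
Proof. by move=> sF; rewrite /Int int_overZ. Qed.

Lemma smoothC_Int (I : eqType) (J : finType) (F : (I + J -> M) -> C) : smoothC F ->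
  smoothC (fun x => Int (fun y => F (sumf x y))).
Proof.
move=> sF.
have -> : (fun x => Int (fun y => F (sumf x y))) =
   (fun x => int_over (map inr (enum J)) F (sumf x (fun=> point))).
  by apply/funext => x; rewrite int_over_inr.
have := smoothC_subst (fun i : I + J => match i with
  inl j => inl j | inr j => inr (point : M) end)
  (smoothC_int_over (map inr (enum J)) sF).
congr smoothC; apply/funext => x; congr int_over.
by apply/funext => -[].
Qed.

Lemma Int_swap (J J' : finType) (F : (J + J' -> M) -> C) : smoothC F ->
  Int (fun x => Int (fun y => F (sumf x y))) =
  Int (fun y => Int (fun x => F (sumf x y))).
Proof.
move=> sF; rewrite -Int_sum //.
pose sw (A B : Type) (i : A + B) : B + A := match i with inl a => inr a | inr a => inl a end.
have bsw : bijective (sw J J') by exists (sw J' J) => -[].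
rewrite -(Int_bij bsw sF) Int_sum; last exact: smoothC_rename.
apply: eq_Int => y; apply: eq_Int => x; congr F.
by apply/funext => -[].
Qed.

Lemma Int_prod (J J' : finType) (F : (J -> M) -> C) (G : (J' -> M) -> C) :
  smoothC F -> smoothC G ->
  Int (fun x => Int (fun y => F x * G y)) = Int F * Int G.
Proof.
move=> sF sG; under eq_Int => x do rewrite IntZ // mulrC.
by rewrite IntZ // mulrC.
Qed.

Lemma cintegral_pow l (F : ('I_l -> M) -> C) : smoothC F ->
  cintegral (pow_measure mu l) (fun t : l.-tuple (borel M) => F (tnth t)) = Int F.
Proof.
elim: l F => [|l IH] F sF.
  by rewrite cintegral_pow0 (@Int_void _ F (tnth [tuple])) ?card_ord.
rewrite (cintegral_powS mu sF).
pose h (o : option 'I_l) : 'I_l.+1 := if o is Some i then lift ord0 i else ord0.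
pose h' (i : 'I_l.+1) : option 'I_l := unlift ord0 i.
have h'K : cancel h' h by move=> i; rewrite /h /h'; case: unliftP.
have hK : cancel h h' by case=> [i|]; rewrite /h /h' ?liftK ?unlift_none.
have sF' := smoothC_rename h' sF.
have bh' : bijective h' by exists h.
rewrite -(Int_bij bh' sF).
rewrite Int_option //; apply: eq_cintegral => z.
rewrite -IH; last first.
  have := smoothC_subst (fun i : option 'I_l => if i is Some j then inl j else inr z) sF'.
  congr smoothC; apply/funext => x; congr F; apply/funext => i /=.
  by case: (h' i).
apply: eq_cintegral => t; congr F; apply/funext => i /=.
rewrite /h'; case: (unliftP ord0 i) => [j|] -> /=; first by rewrite tnthS.
by [].
Qed.

End IteratedIntegrals.

Definition ins (T : Type) (i : nat) (z : T) (a : nat -> T) (m : nat) : T :=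
  if (m < i)%N then a m else if m == i then z else a m.-1.

Lemma ins_comp (T U : Type) (f : T -> U) i z a m :
  f (ins i z a m) = ins i (f z) (f \o a) m.
Proof. by rewrite /ins; case: ifP => // _; case: ifP. Qed.

(** Both sides hold w at rank i' + 1 and z at rank i. *)
Lemma ins_insC (T : Type) i i' (z w : T) a m : (i <= i')%N ->
  ins i z (ins i' w a) m = ins i'.+1 w (ins i z a) m.
Proof.
move=> ii'; rewrite /ins; case: (ltngtP m i) => [mi|im|->]; last by rewrite ltnS ii'.
  have mi' : (m < i')%N by exact: leq_trans mi ii'.
  by rewrite mi' ltnS ltnW.
case: m im => // m im; rewrite /= ltnS eqSS.
case: (ltngtP m i') => // mi'.
by rewrite ltnNge (leq_trans ii' (ltnW mi')) /= gtn_eqF // (leq_ltn_trans ii' mi').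
Qed.

(** * The TRAP of smooth kernels *)

Section KernelOps.
Context {R : realType} {n : nat} {M : closed_manifold R n}.
Variable mu : {finite_measure set (borel M) -> \bar R}.
Local Notation C := R[i].
Local Notation kernels := (smooth_kernels M).

(** The product charts of the definition are the case where the parameter is the
    pair of matrices of coordinates; conversely any affine family of points factors
    through such a pair of matrices. *)
Lemma smooth_kernelP k l (K : k.-tuple M -> l.-tuple M -> C) :
  is_smooth_kernel K <->
  smoothC (fun v : 'I_k + 'I_l -> M => K [tuple v (inl i) | i < k] [tuple v (inr j) | j < l]).
Proof.
split=> [sK|[sR sI] c d Mc Md U f].
  suff H (p : C -> R) : (forall (c : 'I_k -> chart R n M) (d : 'I_l -> chart R n M),
     (forall i, atlas M (c i)) -> (forall j, atlas M (d j)) ->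
     smooth_on [set u : 'M[R]_(k, n) * 'M[R]_(l, n) |
        (forall i, cimg (c i) (row i u.1)) /\ (forall j, cimg (d j) (row j u.2))]
       (fun u => p (K [tuple cinv (c i) (row i u.1) | i < k]
                      [tuple cinv (d j) (row j u.2) | j < l]) : R^o)) ->
     chart_smooth (fun v : 'I_k + 'I_l -> M =>
       p (K [tuple v (inl i) | i < k] [tuple v (inr j) | j < l])).
    split; apply: H => c d Mc Md; by case: (sK c d Mc Md).
  move=> sp V U c L oU Mc aL UL r.
  have aA : affine_map (fun u : V =>
      (\matrix_(i < k) L (inl i) u, \matrix_(j < l) L (inr j) u)).
    by apply: affine_pair; apply: affine_mx => i; exact: aL.
  have eqC (X Y : V -> R^o) : X =1 Y -> is_Cn r U X -> is_Cn r U Y by move=> /funext ->.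
  apply: eqC (is_Cn_comp_affine aA _
    (sp (fun i => c (inl i)) (fun j => c (inr j)) (fun i => Mc _) (fun j => Mc _) r)).
    by move=> u /=; congr (p (K _ _)); apply: eq_from_tnth => i; rewrite !tnth_mktuple rowK.
  by move=> u Uu; split=> i /=; rewrite rowK; exact: UL.
have oU : open U.
  exact: (open_prod (@open_cimgs _ _ _ _ c) (@open_cimgs _ _ _ _ d)).
pose cc (i : 'I_k + 'I_l) := match i with inl i => c i | inr j => d j end.
pose L (i : 'I_k + 'I_l) (u : 'M[R]_(k, n) * 'M[R]_(l, n)) : 'rV[R]_n :=
  match i with inl i => row i u.1 | inr j => row j u.2 end.
have aL i : affine_map (L i).
  case: i => i.
    exact: (affine_comp (affine_fst _ _) (affine_row _ i)).
  exact: (affine_comp (affine_snd _ _) (affine_row _ i)).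
have Mcc i : atlas M (cc i) by case: i.
have UL i u : U u -> cimg (cc i) (L i u) by case=> U1 U2; case: i.
by split; [exact: sR oU Mcc aL UL|exact: sI oU Mcc aL UL].
Qed.

Lemma kernel_eq k l (K K' : kernels k l) : (forall x y, K x y = K' x y) -> K = K'.
Proof.
case: K K' => f sf [g sg] /= fg.
have {}fg : f = g by apply/funext => x; apply/funext => y.
by subst g; rewrite (Prop_irrelevance sf sg).
Qed.

Lemma kernel_smoothC k l (K : kernels k l) I (s : 'I_k -> I) (t : 'I_l -> I) :
  smoothC (fun v : I -> M => K [tuple v (s i) | i < k] [tuple v (t j) | j < l]).
Proof.
have /smooth_kernelP sK := @kernel_smooth _ _ _ _ _ K.
exact: (smoothC_rename (fun i => match i with inl i => s i | inr j => t j end) sK).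
Qed.

(** A kernel read on sequences of points, of which it uses the first k and l.
    With such arguments arities need not match syntactically, and transport along
    equalities of arities becomes invisible ([kev_pcast]). *)
Definition kev k l (K : kernels k l) (a b : nat -> M) : C :=
  K [tuple a i | i < k] [tuple b j | j < l].

Lemma kev_ext k l (K K' : kernels k l) :
  (forall a b, kev K a b = kev K' a b) -> K = K'.
Proof.
move=> KK'; apply: kernel_eq => x y.
have E m (z : m.-tuple M) : z = [tuple nth point z i | i < m].
  by apply: eq_from_tnth => i; rewrite tnth_mktuple (tnth_nth point).
by rewrite (E _ x) (E _ y); exact: KK'.
Qed.

Lemma kev_eq k l (K : kernels k l) a b a' b' :
  (forall i, (i < k)%N -> a i = a' i) -> (forall j, (j < l)%N -> b j = b' j) ->
  kev K a b = kev K a' b'.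
Proof.
by move=> aa' bb'; congr (kfun K _ _); apply: eq_from_tnth => i;
  rewrite !tnth_mktuple ?aa' ?bb'.
Qed.

Lemma kev_pcast k k' l l' (ek : k = k') (el : l = l') (K : kernels k l) a b :
  kev (pcast ek el K) a b = kev K a b.
Proof. by subst k' l'. Qed.

Definition k_lact k l (s : 'S_l) (K : kernels k l) : kernels k l.
Proof.
exists (fun x y => K x [tuple tnth y (s j) | j < l]); apply/smooth_kernelP.
have := kernel_smoothC K inl (fun j => inr (s j)).
congr smoothC; apply/funext => v; congr (kfun K _ _).
by apply: eq_from_tnth => j; rewrite !tnth_mktuple.
Defined.

Definition k_ract k l (K : kernels k l) (t : 'S_k) : kernels k l.
Proof.
exists (fun x y => K [tuple tnth x ((t^-1)%g i) | i < k] y); apply/smooth_kernelP.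
have := kernel_smoothC K (fun i => inl ((t^-1)%g i)) inr.
congr smoothC; apply/funext => v; congr (kfun K _ _).
by apply: eq_from_tnth => j; rewrite !tnth_mktuple.
Defined.

Definition k_hcat k l k' l' (K : kernels k l) (K' : kernels k' l') :
  kernels (k + k')%N (l + l')%N.
Proof.
exists (fun x y => K (tleft x) (tleft y) * K' (tright x) (tright y)).
apply/smooth_kernelP.
have := smoothCM (kernel_smoothC K (fun i => inl (lshift k' i)) (fun j => inr (lshift l' j)))
  (kernel_smoothC K' (fun i => inl (rshift k i)) (fun j => inr (rshift l j))).
congr smoothC; apply/funext => v; congr (kfun K _ _ * kfun K' _ _);
  by apply: eq_from_tnth => i; rewrite !tnth_mktuple.
Defined.

Definition k_hone : kernels 0 0.
Proof.
exists (fun _ _ => 1); apply/smooth_kernelP; exact: smoothC_cst.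
Defined.

Definition k_ptr k l (i : 'I_k.+1) (j : 'I_l.+1) (K : kernels k.+1 l.+1) : kernels k l.
Proof.
exists (fun x y => cintegral mu (fun z : borel M => K (tinsert i z x) (tinsert j z y))).
apply/smooth_kernelP.
have := smoothC_int mu (kernel_smoothC K
  (fun a => if unlift i a is Some b then Some (inl b) else None)
  (fun a => if unlift j a is Some b then Some (inr b) else None)).
congr smoothC; apply/funext => v; apply: eq_cintegral => z; congr (kfun K _ _);
  by apply: eq_from_tnth => a; rewrite !tnth_mktuple;
     case: unlift => // b; rewrite tnth_mktuple.
Defined.

Definition kernel_trap : trap_ops kernels :=
  @TrapOps _ k_lact k_ract k_hcat k_hone k_ptr.

Lemma kernel_trap_ops : is_kernel_ops mu kernel_trap.
Proof. by split. Qed.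

Definition perm_nat m (s : 'S_m) (i : nat) : nat :=
  if insub i is Some j then s j : nat else i.

Lemma perm_natE m (s : 'S_m) (i : 'I_m) : perm_nat s i = s i.
Proof. by rewrite /perm_nat valK. Qed.

Lemma kev_lact k l (s : 'S_l) (K : kernels k l) a b :
  kev (k_lact s K) a b = kev K a (b \o perm_nat s).
Proof.
by congr (kfun K _ _); apply: eq_from_tnth => j; rewrite !tnth_mktuple /= perm_natE.
Qed.

Lemma kev_ract k l (t : 'S_k) (K : kernels k l) a b :
  kev (k_ract K t) a b = kev K (a \o perm_nat t^-1) b.
Proof.
by congr (kfun K _ _); apply: eq_from_tnth => j; rewrite !tnth_mktuple /= perm_natE.
Qed.

Lemma kev_hcat k l k' l' (K : kernels k l) (K' : kernels k' l') a b :
  kev (k_hcat K K') a b = kev K a b * kev K' (a \o addn k) (b \o addn l).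
Proof.
by congr (kfun K _ _ * kfun K' _ _); apply: eq_from_tnth => i; rewrite !tnth_mktuple.
Qed.

Lemma tinsertE m (i : 'I_m.+1) z (a : nat -> M) :
  tinsert i z [tuple a j | j < m] = [tuple ins i z a j | j < m.+1].
Proof.
apply: eq_from_tnth => j; rewrite !tnth_mktuple /ins.
case: unliftP => [b|] ->; last by rewrite ltnn eqxx.
rewrite tnth_mktuple /= /bump; case: (leqP i b) => ib /=.
  by rewrite add1n ltnNge leqW //= gtn_eqF.
by rewrite add0n ib.
Qed.

Lemma kev_ptr k l (i : 'I_k.+1) (j : 'I_l.+1) (K : kernels k.+1 l.+1) a b :
  kev (k_ptr i j K) a b =
  cintegral mu (fun z : borel M => kev K (ins i z a) (ins j z b)).
Proof. by rewrite /kev /=; apply: eq_cintegral => z; rewrite !tinsertE. Qed.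

Lemma kev_smoothC k l (K : kernels k l) I (s t : nat -> I) :
  smoothC (fun v : I -> M => kev K (v \o s) (v \o t)).
Proof. exact: (kernel_smoothC K (fun i => s i) (fun j => t j)). Qed.

End KernelOps.

Section KernelTrap.
Context {R : realType} {n : nat} {M : closed_manifold R n}.
Variable mu : {finite_measure set (borel M) -> \bar R}.
Local Notation C := R[i].
Local Notation kernels := (smooth_kernels M).

Definition fill (I : Type) (v : I -> M) (x : I + M) : M :=
  match x with inl i => v i | inr p => p end.

Lemma kev_smooth_fill k l (K : kernels k l) I (s t : nat -> I + M) :
  smoothC (fun v : I -> M => kev K (fill v \o s) (fill v \o t)).
Proof.
have := smoothC_subst (fun c : nat + nat => match c with inl m => s m | inr m => t m end)
  (kev_smoothC K inl inr).
by congr smoothC; apply/funext => v; apply: kev_eq.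
Qed.

Lemma kev_swap k l (K : kernels k l) (s t : nat -> bool + M) :
  cintegral mu (fun z : borel M => cintegral mu (fun w : borel M =>
    let v b := if b then z else w in kev K (fill v \o s) (fill v \o t))) =
  cintegral mu (fun w : borel M => cintegral mu (fun z : borel M =>
    let v b := if b then z else w in kev K (fill v \o s) (fill v \o t))).
Proof. exact: cintegral_swap (kev_smooth_fill K s t). Qed.

(** Two iterated traces agree as soon as they insert the same two points at the
    same ranks; the order of integration differs, which is Fubini. *)
Lemma kev_ptr_ptr k l (i i' I I' : nat) (j j' J J' : nat) (K : kernels k l) a b :
  (forall (z w : M) m, ins i z (ins i' w a) m = ins I' w (ins I z a) m) ->
  (forall (z w : M) m, ins j z (ins j' w b) m = ins J' w (ins J z b) m) ->
  cintegral mu (fun w : borel M => cintegral mu (fun z : borel M =>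
    kev K (ins i z (ins i' w a)) (ins j z (ins j' w b)))) =
  cintegral mu (fun z : borel M => cintegral mu (fun w : borel M =>
    kev K (ins I' w (ins I z a)) (ins J' w (ins J z b)))).
Proof.
move=> Ha Hb.
have E (z w : M) x r r' : ins r z (ins r' w x) =1
    fill (fun b : bool => if b then z else w) \o
    ins r (inl true) (ins r' (inl false) (inr \o x)).
  by move=> m; rewrite /= !(ins_comp (fill _)) /=; congr (ins _ _ _ _);
     apply/funext => m'; rewrite /= !(ins_comp (fill _)).
have := kev_swap K (ins i (inl true) (ins i' (inl false) (inr \o a)))
  (ins j (inl true) (ins j' (inl false) (inr \o b))).
move=> sw; transitivity (cintegral mu (fun w : borel M => cintegral mu (fun z : borel M =>
    let v b := if b then z else w in
    kev K (fill v \o ins i (inl true) (ins i' (inl false) (inr \o a)))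
          (fill v \o ins j (inl true) (ins j' (inl false) (inr \o b)))))).
  apply: eq_cintegral => w; apply: eq_cintegral => z /=.
  by apply: kev_eq => m _; rewrite E.
rewrite -sw; apply: eq_cintegral => z; apply: eq_cintegral => w /=.
by apply: kev_eq => m _; rewrite -?Ha -?Hb E.
Qed.

Lemma ins_ord_ge k (i : 'I_k.+2) (i' : 'I_k.+1) (a : nat -> M) : (i <= i')%N ->
  forall (z w : M) m, ins i z (ins i' w a) m =
    ins (inord i'.+1 : 'I_k.+2) w (ins (inord i : 'I_k.+1) z a) m.
Proof.
move=> ii' z w m; rewrite !inordK ?ltnS //; first exact: ins_insC.
  exact: leq_trans ii' (leq_ord i').
exact: leq_ord.
Qed.

Lemma ins_ord_lt k (i : 'I_k.+2) (i' : 'I_k.+1) (a : nat -> M) : (i' < i)%N ->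
  forall (z w : M) m, ins i z (ins i' w a) m =
    ins (inord i' : 'I_k.+2) w (ins (inord i.-1 : 'I_k.+1) z a) m.
Proof.
move=> ii' z w m; have i0 : (0 < i)%N by exact: leq_trans ii'.
rewrite !inordK; last 2 first.
- by rewrite prednK // -ltnS.
- exact: leqW.
rewrite -{1}(prednK i0) -ins_insC //.
by rewrite -ltnS prednK.
Qed.

(** The permutation [perm_del s j] is what remains of s once the letter j, and the
    position where it occurs, are removed. *)
Lemma ins_perm m (s : 'S_m.+1) (j : 'I_m.+1) z (b : nat -> M) p : (p < m.+1)%N ->
  ins j z b (perm_nat s p) = ins ((s^-1)%g j) z (b \o perm_nat (perm_del s j)) p.
Proof.
move=> pm; rewrite -[p]/(nat_of_ord (Ordinal pm)) perm_natE; move: (Ordinal pm) => {pm}p.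
have insE (i c : 'I_m.+1) (x : nat -> M) :
    ins i z x c = if unlift i c is Some d then x d else z.
  have := tinsertE i z x => /(congr1 (fun t => tnth t c)); rewrite !tnth_mktuple => <-.
  by case: unlift => // d; rewrite tnth_mktuple.
rewrite !insE; case: (unliftP ((s^-1)%g j) p) => [d|] ->.
  by rewrite -del_funK liftK /= perm_natE permE.
by rewrite permKV unlift_none.
Qed.

Lemma perm_delV m (t : 'S_m.+1) (i : 'I_m.+1) :
  ((perm_del t (t i))^-1)%g = perm_del (t^-1)%g i.
Proof.
apply/permP => j; apply: (@perm_inj _ (perm_del t (t i))); rewrite permKV.
apply: (@lift_inj _ (t i)); rewrite [in RHS]permE del_funK.
rewrite permK permE del_funK invgK.
by rewrite permKV.
Qed.

Lemma perm_tensE m m' (s : 'S_m) (s' : 'S_m') :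
  (forall i, (i < m)%N -> perm_nat (perm_tens s s') i = perm_nat s i) /\
  (forall i, (i < m')%N -> perm_nat (perm_tens s s') (m + i) = (m + perm_nat s' i)%N).
Proof.
split=> c cm.
  rewrite -[c in LHS]/(nat_of_ord (lshift m' (Ordinal cm))) perm_natE permE /tens_fun.
  by rewrite (unsplitK (inl _)) -[c]/(nat_of_ord (Ordinal cm)) perm_natE.
rewrite -[(m + c)%N]/(nat_of_ord (rshift m (Ordinal cm))) perm_natE permE /tens_fun.
by rewrite (unsplitK (inr _)) -[c]/(nat_of_ord (Ordinal cm)) perm_natE.
Qed.

Lemma perm_tensV m m' (s : 'S_m) (s' : 'S_m') :
  ((perm_tens s s')^-1)%g = perm_tens (s^-1)%g (s'^-1)%g.
Proof.
apply/permP => j; apply: (@perm_inj _ (perm_tens s s')); rewrite permKV !permE.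
rewrite /tens_fun -[in LHS](splitK j).
by case: (fintype.split j) => x; rewrite ?(unsplitK (inl _)) ?(unsplitK (inr _)) permKV.
Qed.

Lemma c_permE m m' :
  (forall i, (i < m)%N -> perm_nat (c_perm m m') i = (m' + i)%N) /\
  (forall i, (i < m')%N -> perm_nat (c_perm m m') (m + i) = i).
Proof.
split=> c cm.
  rewrite -[c in LHS]/(nat_of_ord (lshift m' (Ordinal cm))) perm_natE permE /c_fun.
  by rewrite (unsplitK (inl _)).
rewrite -[(m + c)%N]/(nat_of_ord (rshift m (Ordinal cm))) perm_natE permE /c_fun.
by rewrite (unsplitK (inr _)).
Qed.

Lemma perm_nat_inv m (s : 'S_m) p q : (p < m)%N -> perm_nat s p = q ->
  perm_nat (s^-1)%g q = p.
Proof.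
by move=> pm; rewrite -[p]/(nat_of_ord (Ordinal pm)) perm_natE => <-; rewrite perm_natE permK.
Qed.

(** Read on sequences of points, the axioms without traces are identities between
    reindexed arguments, and the others compare insertions. *)
Theorem kernel_is_trap : is_trap (kernel_trap mu).
Proof.
split.
- move=> k l K; apply: kev_ext => a b; rewrite kev_lact; apply: kev_eq => // j jl /=.
  by rewrite -[j]/(nat_of_ord (Ordinal jl)) perm_natE perm1.
- move=> k l s s' K; apply: kev_ext => a b; rewrite !kev_lact; apply: kev_eq => // j jl /=.
  by rewrite -[j]/(nat_of_ord (Ordinal jl)) !perm_natE permM.
- move=> k l K; apply: kev_ext => a b; rewrite kev_ract; apply: kev_eq => // j jl /=.
  by rewrite -[j]/(nat_of_ord (Ordinal jl)) perm_natE invg1 perm1.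
- move=> k l s s' K; apply: kev_ext => a b; rewrite !kev_ract; apply: kev_eq => // j jl /=.
  by rewrite -[j]/(nat_of_ord (Ordinal jl)) !perm_natE invMg permM.
- by move=> k l s t K; apply: kev_ext => a b; rewrite kev_lact !kev_ract kev_lact.
- move=> k l k' l' k'' l'' p p' p''; apply: kev_ext => a b.
  rewrite kev_pcast !kev_hcat mulrA.
  by congr (_ * _ * _); apply: kev_eq => i _ /=; rewrite addnA.
- by move=> k l p; apply: kev_ext => a b; rewrite kev_hcat /= mul1r; apply: kev_eq.
- by move=> k l p; apply: kev_ext => a b; rewrite kev_pcast kev_hcat /= mulr1.
- move=> k l k' l' p p' s t s' t'; apply: kev_ext => a b.
  rewrite kev_hcat !kev_lact !kev_ract kev_hcat.
  have [s1 s2] := perm_tensE s s'; have [t1 t2] := perm_tensE (t^-1)%g (t'^-1)%g.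
  rewrite perm_tensV; congr (_ * _); apply: kev_eq => c cm /=.
  + by rewrite t1.
  + by rewrite s1.
  + by rewrite t2.
  + by rewrite s2.
- move=> k l k' l' p p'; apply: kev_ext => a b.
  rewrite kev_lact kev_ract kev_pcast !kev_hcat mulrC.
  have [s1 s2] := c_permE l l'; have [t1 t2] := c_permE k k'.
  congr (_ * _); apply: kev_eq => c cm /=.
  + by rewrite (perm_nat_inv _ (t2 c cm)) ?ltn_add2l.
  + by rewrite s2.
  + by rewrite (perm_nat_inv _ (t1 c cm)) // ltn_addr.
  + by rewrite s1.
- move=> k l i j i' j' p; split => Hi Hj; apply: kev_ext => a b;
    rewrite !kev_ptr; (under eq_cintegral => w do rewrite kev_ptr);
    (under [RHS]eq_cintegral => w do rewrite kev_ptr);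
    apply: kev_ptr_ptr; by [exact: ins_ord_ge|exact: ins_ord_lt].
- move=> k l i j s t p; apply: kev_ext => a b.
  rewrite kev_lact kev_ract !kev_ptr; apply: eq_cintegral => z.
  rewrite kev_lact kev_ract perm_delV; apply: kev_eq => m mm /=; rewrite ins_perm //.
  by rewrite invgK.
- move=> k l k' l' i j p p'; apply: kev_ext => a b.
  rewrite kev_ptr kev_hcat kev_ptr mulrC.
  pose f (v : unit -> M) := kev p (ins i (v tt) a) (ins j (v tt) b).
  have sf : smoothC f.
    have := kev_smooth_fill p (ins i (inl tt) (inr \o a)) (ins j (inl tt) (inr \o b)).
    by congr smoothC; apply/funext => v; apply: kev_eq => m _; rewrite /= (ins_comp (fill v)).
  rewrite -(cintegralZ mu _ sf); apply: eq_cintegral => z.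
  transitivity (kev p (ins i z a) (ins j z b) *
    kev p' (ins i z a \o addn k.+1) (ins j z b \o addn l.+1)).
    exact: (kev_hcat p p').
  have tailE r (o : 'I_r.+1) (x : nat -> M) c : ins o z x (r.+1 + c) = x (r + c)%N.
    have or : (o < r.+1 + c)%N by apply: ltn_addr.
    by rewrite /ins ltnNge (ltnW or) /= gtn_eqF.
  by rewrite mulrC; congr (_ * _); apply: kev_eq => c _ /=; rewrite tailE.
- move=> k l k' l' i j p p'; apply: kev_ext => a b.
  rewrite kev_ptr kev_hcat kev_ptr.
  pose a' := a \o addn k; pose b' := b \o addn l.
  pose f (v : unit -> M) := kev p' (ins i (v tt) a') (ins j (v tt) b').
  have sf : smoothC f.
    have := kev_smooth_fill p' (ins i (inl tt) (inr \o a')) (ins j (inl tt) (inr \o b')).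
    by congr smoothC; apply/funext => v; apply: kev_eq => m _; rewrite /= (ins_comp (fill v)).
  rewrite -(cintegralZ mu _ sf); apply: eq_cintegral => z.
  rewrite kev_pcast kev_hcat; congr (_ * _); apply: kev_eq => c cm /=.
  + by rewrite /ins ltn_addr.
  + by rewrite /ins ltn_addr.
  + rewrite /ins ltn_add2l eqn_add2l; case: ltnP => // ic; case: eqP => // ci.
    rewrite /a' /=; case: c ci {cm} ic => [|c] ci ic; last by rewrite addnS.
    by case: ci; case: (nat_of_ord i) ic.
  + rewrite /ins ltn_add2l eqn_add2l; case: ltnP => // ic; case: eqP => // ci.
    rewrite /b' /=; case: c ci {cm} ic => [|c] ci ic; last by rewrite addnS.
    by case: ci; case: (nat_of_ord j) ic.
Qed.

End KernelTrap.

Definition seqcat (T : Type) (k : nat) (a b : nat -> T) (m : nat) : T :=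
  if (m < k)%N then a m else b (m - k)%N.

Definition ext (T : Type) (d : T) (l : nat) (y : 'I_l -> T) (m : nat) : T :=
  oapp y d (insub m).

(** * Convolution and trace *)

Section KernelConvolution.
Context {R : realType} {n : nat} {M : closed_manifold R n}.
Variable mu : {finite_measure set (borel M) -> \bar R}.
Local Notation C := R[i].
Local Notation kernels := (smooth_kernels M).
Local Notation T := (kernel_trap mu).
Local Notation ext := (ext (point : M)).

Lemma ext_lt l (y : 'I_l -> M) (i : 'I_l) : ext y i = y i.
Proof. by rewrite /ext valK. Qed.

Lemma kernel_smooth_fill k l (K : kernels k l) I (s : 'I_k -> I + M) (t : 'I_l -> I + M) :
  smoothC (fun v : I -> M => K [tuple fill v (s i) | i < k] [tuple fill v (t j) | j < l]).
Proof.
have /smooth_kernelP sK := @kernel_smooth _ _ _ _ _ K.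
exact: (smoothC_subst (fun i => match i with inl i => s i | inr j => t j end) sK).
Qed.

(** Sequences whose terms are variables or constants, that is, the arguments which
    a kernel can take without losing smoothness. *)
Definition coord (I : Type) (s : (I -> M) -> nat -> M) :=
  exists s0 : nat -> I + M, forall v m, s v m = fill v (s0 m).

Lemma coord_cst I (a : nat -> M) : coord (fun _ : I -> M => a).
Proof. by exists (inr \o a). Qed.

Lemma coord_ext l : coord (@ext l).
Proof.
exists (fun m => oapp inl (inr point) (insub m)) => v m.
by rewrite /ext; case: insub.
Qed.

Lemma coord_seqcat I k (s t : (I -> M) -> nat -> M) :
  coord s -> coord t -> coord (fun v => seqcat k (s v) (t v)).
Proof.
move=> [s0 sE] [t0 tE]; exists (seqcat k s0 t0) => v m.
by rewrite /seqcat; case: ifP.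
Qed.

Lemma kev_smooth_coord k l (K : kernels k l) I (s t : (I -> M) -> nat -> M) :
  coord s -> coord t -> smoothC (fun v => kev K (s v) (t v)).
Proof.
move=> [s0 sE] [t0 tE]; have := kev_smooth_fill K s0 t0.
congr smoothC; apply/funext => v; apply: kev_eq => i _ /=; by rewrite ?sE ?tE.
Qed.

(** The innermost trace of [vtrace] integrates the variable of largest index. *)
Lemma Int_ord_max l (F : ('I_l.+1 -> M) -> C) : smoothC F ->
  Int mu F = Int mu (fun y => cintegral mu (fun z : borel M =>
    F (fun i => oapp y z (unlift ord_max i)))).
Proof.
move=> sF; pose h (i : 'I_l.+1) : option 'I_l := unlift ord_max i.
have bh : bijective h.
  exists (fun o : option 'I_l => if o is Some i then lift ord_max i else ord_max).
    by move=> i; rewrite /h; case: unliftP.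
  by case=> [i|]; rewrite /h ?liftK ?unlift_none.
rewrite -(Int_bij mu bh sF) Int_option_inner; last exact: smoothC_rename.
by apply: eq_Int => y; apply: eq_cintegral => z; congr F.
Qed.

Lemma ext_ord_max l (y : 'I_l -> M) z m : (m < l.+1)%N ->
  ext (fun i => oapp y z (unlift ord_max i)) m = if m == l then z else ext y m.
Proof.
move=> ml; rewrite -[m]/(nat_of_ord (Ordinal ml)) ext_lt.
case: unliftP => [i|] -> /=; last by rewrite eqxx.
by rewrite /bump leqNgt ltn_ord add0n ltn_eqF // ext_lt.
Qed.

(** The traces of [vtrace] identify the outputs of rank below l with the inputs of
    rank k and beyond, one at a time starting from the last. *)
Lemma kev_vtrace k l m (p : kernels (k + l)%N (l + m)%N) a b :
  kev (vtrace T p) a b =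
  Int mu (fun y : 'I_l -> M => kev p (seqcat k a (ext y)) (seqcat l (ext y) b)).
Proof.
elim: l p => [|l IH] p /=.
  rewrite kev_pcast (@Int_void _ _ _ _ _ _ (fun=> point)) ?card_ord //.
  apply: kev_eq => c cm; rewrite /seqcat; first by rewrite -[k]addn0 cm.
  by rewrite subn0.
rewrite IH (@Int_ord_max l); last first.
  apply: kev_smooth_coord; apply: coord_seqcat; by [exact: coord_cst|exact: coord_ext].
apply: eq_Int => y; rewrite kev_ptr; apply: eq_cintegral => z.
rewrite kev_pcast; apply: kev_eq => c cm; rewrite /ins /seqcat /=.
  rewrite addnS ltnS leq_eqVlt in cm.
  case: (ltnP c k) => ck; first by rewrite ltn_addr.
  move: cm; rewrite -(subnKC ck); move: (c - k)%N => d.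
  rewrite eqn_add2l ltn_add2l addKn => dl.
  have dl' : (d < l.+1)%N by rewrite ltnS leq_eqVlt.
  by rewrite ext_ord_max //; case: (ltngtP d l) dl.
case: (ltngtP c l) => cl.
- by rewrite ltnS ltnW // ext_ord_max ?ltnS 1?ltnW // ltn_eqF.
- case: c cl {cm} => // c; rewrite ltnS => cl.
  rewrite -[(c.+1 < l.+1)%N]/((c < l)%N) /= subSS.
  by rewrite (_ : (c < l)%N = false) //; apply/negbTE; rewrite -leqNgt.
- by rewrite cl ltnS leqnn ext_ord_max ?eqxx.
Qed.

Lemma kev_gtrace k (p : kernels k k) a b :
  kev (gtrace T p) a b = Int mu (fun y : 'I_k -> M => kev p (ext y) (ext y)).
Proof.
elim: k p => [|k IH] p /=.
  by rewrite (@Int_void _ _ _ _ _ _ (fun=> point)) ?card_ord //; apply: kev_eq.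
rewrite IH (@Int_ord_max k); last by apply: kev_smooth_coord; exact: coord_ext.
apply: eq_Int => y; rewrite kev_ptr; apply: eq_cintegral => z.
by apply: kev_eq => c cm; rewrite ext_ord_max // /ins /=;
  move: cm; rewrite ltnS leq_eqVlt; case: ltngtP.
Qed.

Lemma kernel_kev k l (K : kernels k l) x y : K x y = kev K (nth point x) (nth point y).
Proof.
by congr (kfun K _ _); apply: eq_from_tnth => i; rewrite tnth_mktuple (tnth_nth point).
Qed.

Lemma vcomp_Int k l m (K1 : kernels k l) (K2 : kernels l m) x z :
  vcomp T K2 K1 x z =
  Int mu (fun y : 'I_l -> M => K1 x [tuple y i | i < l] * K2 [tuple y i | i < l] z).
Proof.
rewrite kernel_kev kev_vtrace; apply: eq_Int => y; rewrite kev_hcat.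
congr (_ * _); rewrite /kev; congr (kfun _ _ _); apply: eq_from_tnth => i;
  rewrite !tnth_mktuple /= /seqcat ?ltn_ord ?ext_lt // -?(tnth_nth point) //.
  by rewrite ltnNge leq_addr addKn ext_lt.
by rewrite ltnNge leq_addr addKn -(tnth_nth point).
Qed.

Lemma vcomp_convolution k l m (K1 : kernels k l) (K2 : kernels l m) x z :
  vcomp T K2 K1 x z =
  cintegral (pow_measure mu l) (fun y : l.-tuple (borel M) => K1 x y * K2 y z).
Proof.
rewrite vcomp_Int -cintegral_pow.
  apply: eq_cintegral => t; congr (kfun K1 _ _ * kfun K2 _ _);
  by apply: eq_from_tnth => i; rewrite tnth_mktuple.
have := smoothCM (kernel_smooth_fill K1 (fun i => inr (tnth x i)) inl)
  (kernel_smooth_fill K2 inl (fun i => inr (tnth z i))).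
congr smoothC; apply/funext => y; congr (kfun K1 _ _ * kfun K2 _ _);
  by apply: eq_from_tnth => i; rewrite tnth_mktuple.
Qed.

(** Both sides integrate K1(x, y1) K2(y1, y2) K3(y2, z) over y1 and y2. *)
Lemma vcompA_fubini k l m p (K1 : kernels k l) (K2 : kernels l m) (K3 : kernels m p) :
  vcomp T K3 (vcomp T K2 K1) = vcomp T (vcomp T K3 K2) K1.
Proof.
apply: kernel_eq => x z; rewrite !vcomp_Int.
pose Y1 (v : 'I_l + 'I_m -> M) := [tuple v (inl i) | i < l].
pose Y2 (v : 'I_l + 'I_m -> M) := [tuple v (inr i) | i < m].
pose F v := K1 x (Y1 v) * K2 (Y1 v) (Y2 v) * K3 (Y2 v) z.
have s1 : smoothC (fun v => K1 x (Y1 v)).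
  have := kernel_smooth_fill K1 (fun i => inr (tnth x i)) (fun i => inl (inl i : 'I_l + 'I_m)).
  congr smoothC; apply/funext => y; congr (kfun K1 _ _);
  by apply: eq_from_tnth => i; rewrite tnth_mktuple.
have s2 : smoothC (fun v => K2 (Y1 v) (Y2 v)) by exact: kernel_smoothC.
have s3 : smoothC (fun v => K3 (Y2 v) z).
  have := kernel_smooth_fill K3 (fun i => inl (inr i : 'I_l + 'I_m)) (fun i => inr (tnth z i)).
  congr smoothC; apply/funext => y; congr (kfun K3 _ _);
  by apply: eq_from_tnth => i; rewrite tnth_mktuple.
have sF : smoothC F by exact: smoothCM (smoothCM s1 s2) s3.
transitivity (Int mu (fun y2 => Int mu (fun y1 => F (sumf y1 y2)))).
  apply: eq_Int => y2; rewrite vcomp_Int mulrC -IntZ.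
    by apply: eq_Int => y1; rewrite mulrC.
  have := smoothC_subst (fun i : 'I_l + 'I_m => match i with
    inl j => inl j | inr j => inr (y2 j) end) (smoothCM s1 s2).
  by [].
rewrite -Int_swap //; apply: eq_Int => y1; rewrite vcomp_Int -IntZ.
  by apply: eq_Int => y2; rewrite mulrA.
have := smoothC_subst (fun i : 'I_l + 'I_m => match i with
  inl j => inr (y1 j) | inr j => inl j end) (smoothCM s2 s3).
by [].
Qed.

Lemma gtrace_Int k (K : kernels k k) x y :
  gtrace T K x y = Int mu (fun v : 'I_k -> M => K [tuple v i | i < k] [tuple v i | i < k]).
Proof.
rewrite kernel_kev kev_gtrace; apply: eq_Int => v; congr (kfun K _ _);
  by apply: eq_from_tnth => i; rewrite !tnth_mktuple ext_lt.
Qed.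

Lemma gtrace_diagonal k (K : kernels k k) :
  gtrace T K [tuple] [tuple] =
  cintegral (pow_measure mu k) (fun x : k.-tuple (borel M) => K x x).
Proof.
rewrite gtrace_Int -cintegral_pow; last exact: kernel_smoothC.
apply: eq_cintegral => t; congr (kfun K _ _);
  by apply: eq_from_tnth => i; rewrite tnth_mktuple.
Qed.

(** Both sides integrate K1(x, y) K2(y, x) over x and y. *)
Lemma gtrace_cyclic k l (K1 : kernels k l) (K2 : kernels l k) :
  gtrace T (vcomp T K2 K1) = gtrace T (vcomp T K1 K2).
Proof.
apply: kernel_eq => x y; rewrite !gtrace_Int.
pose X (v : 'I_k + 'I_l -> M) := [tuple v (inl i) | i < k].
pose Y (v : 'I_k + 'I_l -> M) := [tuple v (inr i) | i < l].
pose F v := K1 (X v) (Y v) * K2 (Y v) (X v).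
have sF : smoothC F by apply: smoothCM; exact: kernel_smoothC.
transitivity (Int mu (fun u => Int mu (fun v => F (sumf u v)))).
  by apply: eq_Int => u; rewrite vcomp_Int.
rewrite Int_swap //; apply: eq_Int => v; rewrite vcomp_Int.
by apply: eq_Int => u; rewrite mulrC.
Qed.

End KernelConvolution.

(** * Graphs up to isomorphism and their vertical concatenation *)

Section Slots.

Lemma bijective_inverse A B (f : A -> B) : bijective f ->
  exists g, cancel f g /\ cancel g f.
Proof. by case=> g; exists g. Qed.

Definition binv A B (f : A -> B) (bf : bijective f) : B -> A :=
  sval (cid (bijective_inverse bf)).

Lemma binvK A B (f : A -> B) (bf : bijective f) : cancel f (binv bf).
Proof. by rewrite /binv; case: cid => g []. Qed.

Lemma f_binv A B (f : A -> B) (bf : bijective f) : cancel (binv bf) f.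
Proof. by rewrite /binv; case: cid => g []. Qed.

(** Slots belong to a type that depends on the graph; their vertex and rank can be
    compared through a map of vertices alone. *)
Definition slot_pos (V : Type) (a : V -> nat) (s : {v : V & 'I_(a v)}) : V * nat :=
  (projT1 s, nat_of_ord (projT2 s)).

Lemma slot_pos_inj (V : Type) (a : V -> nat) : injective (@slot_pos V a).
Proof.
by move=> [v i] [w j] [/= vw]; subst w => /ord_inj ->.
Qed.

(** Equality across arities that agree only up to a proof. *)
Definition same_dec (P : nat -> nat -> Type) k l k' l' (p : P k l) (p' : P k' l') :=
  exists (ek : k = k') (el : l = l'), p' = pcast ek el p.

Lemma same_dec_refl P k l (p : P k l) : same_dec p p.
Proof. by exists erefl, erefl. Qed.

Lemma same_dec_sym P k l k' l' (p : P k l) (p' : P k' l') :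
  same_dec p p' -> same_dec p' p.
Proof. by case=> ek [el ->]; subst k' l'; exists erefl, erefl. Qed.

Lemma same_dec_trans P k l k' l' k'' l'' (p : P k l) (p' : P k' l') (p'' : P k'' l'') :
  same_dec p p' -> same_dec p' p'' -> same_dec p p''.
Proof. by case=> ek [el ->] [ek' [el' ->]]; subst; exists erefl, erefl. Qed.

End Slots.

Section Gluing.
Variable P : nat -> nat -> Type.

Definition in_pos k l (G : sgraph P k l) (i : 'I_k) :=
  slot_pos (tgt (inr (inedge G i) : gE G + gI G)).
Definition out_pos k l (G : sgraph P k l) (j : 'I_l) :=
  slot_pos (src (inr (outedge G j) : gE G + gO G)).
Definition tgt_pos k l (G : sgraph P k l) (e : gE G) :=
  slot_pos (tgt (inl e : gE G + gI G)).
Definition src_pos k l (G : sgraph P k l) (e : gE G) :=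
  slot_pos (src (inl e : gE G + gO G)).

Definition map_pos (V W : Type) (f : V -> W) (s : V * nat) := (f s.1, s.2).

Lemma map_posK (V W : Type) (f : V -> W) g : cancel f g -> cancel (map_pos f) (map_pos g).
Proof. by move=> fK [v r]; rewrite /map_pos /= fK. Qed.

(** The isomorphisms of graphs, stated with equations only: the maps on external
    edges are determined by the labels, and dependent data are compared by position.
    In this form symmetry and transitivity are immediate. *)
Definition pos_iso k l (G H : sgraph P k l) :=
  exists (fV : gV G -> gV H) (fE : gE G -> gE H),
  [/\ bijective fV /\ bijective fE, forall v, same_dec (dec v) (dec (fV v)),
      forall e, tgt_pos (fE e) = map_pos fV (tgt_pos e) /\
                src_pos (fE e) = map_pos fV (src_pos e),
      forall i, in_pos H i = map_pos fV (in_pos G i)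
    & forall j, out_pos H j = map_pos fV (out_pos G j)].

Lemma pos_iso_of_iso k l (G H : sgraph P k l) : sgraph_iso G H -> pos_iso G H.
Proof.
move=> [fV [fE [fI [fO [ha [hb [[bV bE bI bO] [lI lO] ht hs hd]]]]]]].
exists fV, fE; split=> //.
- by move=> v; exists (ha v), (hb v).
- by move=> e; split; [rewrite /tgt_pos (ht (inl e))|rewrite /src_pos (hs (inl e))].
- by move=> i; rewrite /in_pos -lI (ht (inr (inedge G i))).
- by move=> j; rewrite /out_pos -lO (hs (inr (outedge G j))).
Qed.

Lemma bijective_comp_binv (A B D : Type) (f : A -> B) (g : A -> D)
  (bf : bijective f) (bg : bijective g) : bijective (g \o binv bf).
Proof.
exists (f \o binv bg) => x /=; first by rewrite binvK f_binv.
by rewrite binvK f_binv.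
Qed.

Lemma iso_of_pos_iso k l (G H : sgraph P k l) : pos_iso G H -> sgraph_iso G H.
Proof.
move=> [fV [fE [[bV bE] hd hts hi ho]]].
pose fI := inedge H \o binv (inedge_bij G).
pose fO := outedge H \o binv (outedge_bij G).
have ha v : ain v = ain (fV v) by case: (hd v).
have hb v : aout v = aout (fV v) by have [_ [el _]] := hd v.
exists fV, fE, fI, fO, ha, hb; split.
- split=> //; first exact: (bijective_comp_binv (inedge_bij G) (inedge_bij H)).
  exact: (bijective_comp_binv (outedge_bij G) (outedge_bij H)).
- by split=> i; rewrite /fI /fO /= binvK.
- move=> [e|i]; apply: slot_pos_inj => /=.
    by have [+ _] := hts e.
  by rewrite -{1}(f_binv (inedge_bij G) i) /fI /= binvK
    -[LHS]/(in_pos H _) hi /in_pos f_binv.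
- move=> [e|i]; apply: slot_pos_inj => /=.
    by have [_ +] := hts e.
  by rewrite -{1}(f_binv (outedge_bij G) i) /fO /= binvK
    -[LHS]/(out_pos H _) ho /out_pos f_binv.
- move=> v; have [ek [el ->]] := hd v.
  by rewrite (Prop_irrelevance ek (ha v)) (Prop_irrelevance el (hb v)).
Qed.

Lemma pos_iso_refl k l (G : sgraph P k l) : pos_iso G G.
Proof.
exists id, id; split=> //; try by [split; exists id|move=> v; exact: same_dec_refl].
Qed.

Lemma pos_iso_sym k l (G H : sgraph P k l) : pos_iso G H -> pos_iso H G.
Proof.
move=> [fV [fE [[[gV' fVK gVK] [gE' fEK gEK]] hd hts hi ho]]].
exists gV', gE'; split.
- by split; [exists fV|exists fE].
- by move=> v; have := hd (gV' v); rewrite gVK; exact: same_dec_sym.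
- move=> e; have [h1 h2] := hts (gE' e); rewrite gEK in h1 h2.
  by rewrite h1 h2 !(map_posK fVK).
- by move=> i; rewrite hi (map_posK fVK).
- by move=> j; rewrite ho (map_posK fVK).
Qed.

Lemma pos_iso_trans k l (G H K : sgraph P k l) : pos_iso G H -> pos_iso H K -> pos_iso G K.
Proof.
move=> [fV [fE [[bV bE] hd hts hi ho]]] [fV' [fE' [[bV' bE'] hd' hts' hi' ho']]].
exists (fV' \o fV), (fE' \o fE); split.
- by split; apply: bij_comp.
- by move=> v; apply: same_dec_trans (hd v) (hd' _).
- move=> e; have [h1 h2] := hts e; have [h1' h2'] := hts' (fE e).
  by rewrite /= h1' h2' h1 h2.
- by move=> i; rewrite hi' hi.
- by move=> i; rewrite ho' ho.
Qed.

Lemma gclass_eq k l (G H : sgraph P k l) : pos_iso G H -> gclass G = gclass H.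
Proof.
move=> GH; apply: eq_exist; apply/funext => K; apply/propext; split=> /pos_iso_of_iso i;
  apply: iso_of_pos_iso; last exact: pos_iso_trans GH i.
exact: pos_iso_trans (pos_iso_sym GH) i.
Qed.

Lemma grepr_pos_iso k l (G : sgraph P k l) : pos_iso (grepr (gclass G)) G.
Proof.
apply: pos_iso_sym; apply: pos_iso_of_iso; rewrite /grepr; case: cid => H /= E.
by rewrite E; apply: iso_of_pos_iso; exact: pos_iso_refl.
Qed.

(** G arises from H by joining the output a to the input k + a, for all a < l.
    The arities k' and l' of H are meant to be k + l and l + m, but only up to
    provable equality. *)
Definition glued l k' l' k m (H : sgraph P k' l') (G : sgraph P k m) :=
  exists (fV : gV H -> gV G) (fE : gE H + 'I_l -> gE G),
  [/\ bijective fV /\ bijective fE, forall v, same_dec (dec v) (dec (fV v)),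
      forall e, tgt_pos (fE (inl e)) = map_pos fV (tgt_pos e) /\
                src_pos (fE (inl e)) = map_pos fV (src_pos e),
      (forall (a : 'I_l) (i : 'I_k'), i = (k + a)%N :> nat ->
         tgt_pos (fE (inr a)) = map_pos fV (in_pos H i)) /\
      (forall (a : 'I_l) (j : 'I_l'), j = a :> nat ->
         src_pos (fE (inr a)) = map_pos fV (out_pos H j))
    & (forall (i : 'I_k) (i' : 'I_k'), i' = i :> nat ->
         in_pos G i = map_pos fV (in_pos H i')) /\
      (forall (j : 'I_m) (j' : 'I_l'), j' = (l + j)%N :> nat ->
         out_pos G j = map_pos fV (out_pos H j'))].

Lemma glued_pcast l k1 l1 k2 l2 k m (ek : k1 = k2) (el : l1 = l2)
    (H : sgraph P k1 l1) (G : sgraph P k m) :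
  glued l (pcast ek el H) G -> glued l H G.
Proof. by subst k2 l2. Qed.

Lemma glued0 k' l' k m (ek : k' = k) (el : l' = m) (H : sgraph P k' l') :
  glued 0 H (pcast ek el H).
Proof.
subst k' l'; have no (A : Type) : 'I_0 -> A by case.
exists id, (fun x => match x with inl e => e | inr a => no _ a end).
have mid (V : Type) (s : V * nat) : map_pos id s = s by case: s.
split=> /=; try by [split=> -[]|move=> v; exact: same_dec_refl].
- split; first by exists id.
  by exists inl => [[e|[]]|].
- by move=> e; rewrite !mid.
- by split=> i i' /ord_inj ->; rewrite mid.
Qed.

Lemma glued_iso l k' l' k m (H H' : sgraph P k' l') (G : sgraph P k m) :
  pos_iso H' H -> glued l H G -> glued l H' G.
Proof.
move=> [gV' [gE' [[bV bE] hd hts hi ho]]] [fV [fE [[bV' bE'] hd' hts' [ht hs] [hin hout]]]].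
exists (fV \o gV'), (fE \o sum_map gE' id); split.
- split; first exact: bij_comp.
  apply: bij_comp => //; case: bE => g gK Kg.
  by exists (sum_map g id) => -[e|a] /=; rewrite ?gK ?Kg.
- by move=> v; apply: same_dec_trans (hd v) (hd' _).
- move=> e; have [h1 h2] := hts e; have [h1' h2'] := hts' (gE' e).
  by rewrite /= h1' h2' h1 h2.
- by split=> a i ai /=; [rewrite (ht a i) // hi|rewrite (hs a i) // ho].
- by split=> i i' ii'; [rewrite (hin i i') // hi|rewrite (hout i i') // ho].
Qed.

(** Tracing the last of the l + 1 pairs first and gluing the l others afterwards
    glues all of them. *)
Lemma glued_ptr l k m (H : sgraph P (k + l).+1 (l + m).+1) (G : sgraph P k m) :
  glued l (sgraph_ptr ord_max (lshift m (@ord_max l)) H) G -> glued l.+1 H G.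
Proof.
set j0 := lshift m ord_max; set H1 := sgraph_ptr _ _ _.
move=> [fV [fE [[bV bE] hd hts [ht hs] [hin hout]]]].
(* the edge [None] created by the trace is the glued edge of largest label *)
pose h (x : gE H + 'I_l.+1) : option (gE H) + 'I_l := match x with
  | inl e => inl (Some e)
  | inr a => if unlift ord_max a is Some b then inr b else inl None end.
have bh : bijective h.
  exists (fun x => match x with inl (Some e) => inl e | inl None => inr ord_max
    | inr b => inr (lift ord_max b) end) => [[e|a]|[[e|]|b]] //=.
  - by case: unliftP => [b|] ->.
  - by rewrite unlift_none.
  - by rewrite liftK.
have inE i : in_pos H1 i = in_pos H (lift ord_max i) by [].
have outE j : out_pos H1 j = out_pos H (lift j0 j) by [].
have hlift (i : 'I_(k + l)) : lift ord_max i = i :> nat.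
  by rewrite lift_max.
have hlift' (b : 'I_l) : lift ord_max b = b :> nat by rewrite lift_max.
have hj0 : j0 = l :> nat by [].
exists fV, (fE \o h); split=> //.
- by split=> //; exact: bij_comp.
- by move=> e; have [h1 h2] := hts (Some e); rewrite /= h1 h2.
- split=> a i ai /=.
    case: (unliftP ord_max a) ai => [b|] -> ai.
      rewrite lift_max /= in ai *.
      case: (unliftP ord_max i) ai => [c|] -> ai.
        by rewrite -inE; apply: ht; rewrite -ai hlift.
      by move/eqP: ai; rewrite /= eqn_add2l gtn_eqF.
    have -> : i = ord_max by apply: ord_inj.
    by have [h1 _] := hts None; rewrite h1.
  case: (unliftP ord_max a) ai => [b|] -> ai.
    rewrite lift_max /= in ai *.
    case: (unliftP j0 i) ai => [c|] -> ai.
      rewrite -outE; apply: hs; move: ai; rewrite /= /bump.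
      case: leqP => //= lc ai; move: (ltn_ord b); rewrite -ai add1n => bl.
      by move: (leq_trans bl lc); rewrite ltnNge leqnSn.
    by move/eqP: ai; rewrite hj0 gtn_eqF.
  have -> : i = j0 by apply: ord_inj.
  by have [_ h2] := hts None; rewrite h2.
- split=> i i' ii'.
    case: (unliftP ord_max i') ii' => [c|] -> ii'.
      by rewrite -inE; apply: hin; rewrite -ii' hlift.
    have := ltn_ord i; rewrite -ii' /= => kl.
    by move: (leq_trans kl (leq_addr l k)); rewrite ltnn.
  case: (unliftP j0 i') ii' => [c|] -> ii'.
    rewrite -outE; apply: hout; move: ii'; rewrite /= /bump.
    case: leqP => //= lc; first by rewrite add1n addSn => -[].
    by rewrite add0n => ii'; move: lc; rewrite ii' addSn ltnNge leqW // leq_addr.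
  by move/eqP: ii'; rewrite hj0 addSn ltn_eqF // ltnS leq_addr.
Qed.

(** The relation prescribes the ends of every edge of G. *)
Lemma glued_unique l k m (H : sgraph P (k + l) (l + m)) (G G' : sgraph P k m) :
  glued l H G -> glued l H G' -> pos_iso G G'.
Proof.
move=> [fV [fE [[bV bE] hd hts [ht hs] [hin hout]]]].
move=> [fV' [fE' [[bV' bE'] hd' hts' [ht' hs'] [hin' hout']]]].
have mapE s : map_pos (fV' \o binv bV) (map_pos fV s) = map_pos fV' s.
  by rewrite /map_pos /= binvK.
exists (fV' \o binv bV), (fE' \o binv bE); split.
- by split; [exact: (bijective_comp_binv bV bV')|exact: (bijective_comp_binv bE bE')].
- move=> v; have h := hd (binv bV v); rewrite f_binv in h.
  exact: same_dec_trans (same_dec_sym h) (hd' _).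
- move=> e /=; have := f_binv bE e; move: (binv bE e) => [e0|a] <-.
    have [-> ->] := hts e0; have [-> ->] := hts' e0; by rewrite !mapE.
  rewrite (ht a (rshift k a)) // (ht' a (rshift k a)) //.
  by rewrite (hs a (lshift m a)) // (hs' a (lshift m a)) // !mapE.
- by move=> i; rewrite (hin i (lshift l i)) // (hin' i (lshift l i)) // mapE.
- by move=> j; rewrite (hout j (rshift l j)) // (hout' j (rshift l j)) // mapE.
Qed.

Lemma glued_comp k l m (G1 : sgraph P l m) (G2 : sgraph P k l) :
  glued l (sgraph_hcat G2 G1) (sgraph_comp G1 G2).
Proof.
set H := sgraph_hcat G2 G1.
have mid (V : Type) (s : V * nat) : map_pos id s = s by case: s.
have inl_in i : inedge H (lshift l i) = inl (inedge G2 i).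
  by rewrite /= /cat_labels (unsplitK (inl _)).
have inr_in i : inedge H (rshift k i) = inr (inedge G1 i).
  by rewrite /= /cat_labels (unsplitK (inr _)).
have inl_out i : outedge H (lshift m i) = inl (outedge G2 i).
  by rewrite /= /cat_labels (unsplitK (inl _)).
have inr_out i : outedge H (rshift l i) = inr (outedge G1 i).
  by rewrite /= /cat_labels (unsplitK (inr _)).
exists id, id; split.
- by split; exists id.
- by move=> v; exact: same_dec_refl.
- by move=> [e|e]; rewrite !mid.
- split=> a i ai; rewrite mid.
    have -> : i = rshift k a by apply: ord_inj.
    by rewrite /in_pos inr_in.
  have -> : i = lshift m a by apply: ord_inj.
  by rewrite /out_pos inl_out.
- split=> i i' ii'; rewrite mid.
    have -> : i' = lshift l i by apply: ord_inj.
    by rewrite /in_pos inl_in.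
  have -> : i' = rshift l i by apply: ord_inj.
  by rewrite /out_pos inr_out.
Qed.

Lemma pcast_gclass k k' l l' (ek : k = k') (el : l = l') (G : sgraph P k l) :
  pcast ek el (gclass G) = gclass (pcast ek el G).
Proof. by subst k' l'. Qed.

Lemma vtrace_glued k l m (H : sgraph P (k + l) (l + m)) :
  exists2 G, vtrace (solCGr_ops P) (gclass H) = gclass G & glued l H G.
Proof.
elim: l H => [|l IH] H /=.
  by exists (pcast (addn0 k) (add0n m) H); [exact: pcast_gclass|exact: glued0].
rewrite pcast_gclass.
have [G -> GH] := IH (sgraph_ptr ord_max (lshift m ord_max)
  (grepr (gclass (pcast (addnS k l) (addSn l m) H)))).
exists G => //; apply: (glued_pcast (ek := addnS k l) (el := addSn l m)).
exact: glued_iso (pos_iso_sym (grepr_pos_iso _)) (glued_ptr GH).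
Qed.

(** Both sides are gluings of the disjoint union of B and A. *)
Lemma solCGr_compE k l m (A : solCGr P l m) (B : solCGr P k l) :
  solCGr_comp A B = vcomp (solCGr_ops P) A B.
Proof.
have [G e GH] := vtrace_glued (sgraph_hcat (grepr B) (grepr A)).
rewrite /vcomp /= e; apply: gclass_eq.
exact: glued_unique (glued_comp _ _) GH.
Qed.

End Gluing.

(** * The amplitude of a graph *)

Section EdgeLocation.
Variables (P : nat -> nat -> Type) (k l : nat).
Implicit Type G : sgraph P k l.

(** The variable carried by the edge at a given slot of a vertex: an external edge
    is replaced by its label, an internal edge is a variable of integration. *)
Definition tloc G (s : {v : gV G & 'I_(ain v)}) : ('I_k + 'I_l) + gE G :=
  match binv (tgt_bij G) s with
  | inl e => inr e
  | inr i => inl (inl (binv (inedge_bij G) i))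
  end.

Definition sloc G (s : {v : gV G & 'I_(aout v)}) : ('I_k + 'I_l) + gE G :=
  match binv (src_bij G) s with
  | inl e => inr e
  | inr i => inl (inr (binv (outedge_bij G) i))
  end.

Lemma tloc_inner G e : tloc (tgt (inl e : gE G + gI G)) = inr e.
Proof. by rewrite /tloc binvK. Qed.

Lemma tloc_outer G i : tloc (tgt (inr (inedge G i) : gE G + gI G)) = inl (inl i).
Proof. by rewrite /tloc !binvK. Qed.

Lemma sloc_inner G e : sloc (src (inl e : gE G + gO G)) = inr e.
Proof. by rewrite /sloc binvK. Qed.

Lemma sloc_outer G i : sloc (src (inr (outedge G i) : gE G + gO G)) = inl (inr i).
Proof. by rewrite /sloc !binvK. Qed.

(** Every slot is the end of exactly one edge. *)
Lemma tgt_ind G (Q : {v : gV G & 'I_(ain v)} -> Prop) :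
  (forall e, Q (tgt (inl e : gE G + gI G))) ->
  (forall i, Q (tgt (inr (inedge G i) : gE G + gI G))) -> forall s, Q s.
Proof.
move=> Qe Qi s; rewrite -(f_binv (tgt_bij G) s).
case: (binv _ s) => [e|i]; first exact: Qe.
by rewrite -(f_binv (inedge_bij G) i); exact: Qi.
Qed.

Lemma src_ind G (Q : {v : gV G & 'I_(aout v)} -> Prop) :
  (forall e, Q (src (inl e : gE G + gO G))) ->
  (forall i, Q (src (inr (outedge G i) : gE G + gO G))) -> forall s, Q s.
Proof.
move=> Qe Qi s; rewrite -(f_binv (src_bij G) s).
case: (binv _ s) => [e|i]; first exact: Qe.
by rewrite -(f_binv (outedge_bij G) i); exact: Qi.
Qed.
End EdgeLocation.

Section Amplitude.
Context {R : realType} {n : nat} {M : closed_manifold R n}.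
Variable mu : {finite_measure set (borel M) -> \bar R}.
Local Notation C := R[i].
Local Notation kernels := (smooth_kernels M).
Local Notation T := (kernel_trap mu).

Definition factor k l (G : sgraph kernels k l)
    (u : ('I_k + 'I_l) + gE G -> M) (v : gV G) : C :=
  dec v [tuple u (tloc (existT (fun v => 'I_(ain v)) v r)) | r < ain v]
        [tuple u (sloc (existT (fun v => 'I_(aout v)) v r)) | r < aout v].

Definition integrand k l (G : sgraph kernels k l) (u : ('I_k + 'I_l) + gE G -> M) : C :=
  \prod_(v : gV G) factor u v.

Lemma smooth_integrand k l (G : sgraph kernels k l) : smoothC (@integrand k l G).
Proof. by apply: smoothC_prod => v; exact: kernel_smoothC. Qed.

Lemma smooth_integrand_inner k l (G : sgraph kernels k l) (w : 'I_k + 'I_l -> M) :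
  smoothC (fun e : gE G -> M => integrand (sumf w e)).
Proof.
have := smoothC_subst (fun i : ('I_k + 'I_l) + gE G => match i with
   inl i => inr (w i) | inr e => inl e end) (@smooth_integrand k l G).
by congr smoothC; apply/funext => e; congr integrand; apply/funext => -[].
Qed.

Lemma same_dec_eval k l k' l' (K : kernels k l) (K' : kernels k' l')
    (f : 'I_k -> M) (g : 'I_l -> M) (f' : 'I_k' -> M) (g' : 'I_l' -> M) :
  same_dec K K' ->
  (forall (r : 'I_k) (r' : 'I_k'), r = r' :> nat -> f r = f' r') ->
  (forall (r : 'I_l) (r' : 'I_l'), r = r' :> nat -> g r = g' r') ->
  K [tuple f i | i < k] [tuple g j | j < l] = K' [tuple f' i | i < k'] [tuple g' j | j < l'].
Proof.
move=> [ek [el ->]] ff' gg'; subst k' l' => /=.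
by congr (kfun K _ _); apply: eq_from_tnth => i; rewrite !tnth_mktuple ?(ff' i i) ?(gg' i i).
Qed.

(** Comparison of one vertex in two graphs.  Their edges may be indexed by different
    types; only the points carried by corresponding slots matter. *)
Lemma factor_eq k l k' l' (G : sgraph kernels k l) (H : sgraph kernels k' l')
    (u : ('I_k + 'I_l) + gE G -> M) (u' : ('I_k' + 'I_l') + gE H -> M) v v' :
  same_dec (dec v) (dec v') ->
  (forall (s : {v : gV G & 'I_(ain v)}) (s' : {v : gV H & 'I_(ain v)}),
    projT1 s = v -> slot_pos s' = (v', (slot_pos s).2) -> u (tloc s) = u' (tloc s')) ->
  (forall (s : {v : gV G & 'I_(aout v)}) (s' : {v : gV H & 'I_(aout v)}),
    projT1 s = v -> slot_pos s' = (v', (slot_pos s).2) -> u (sloc s) = u' (sloc s')) ->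
  factor u v = factor u' v'.
Proof.
move=> vv' ut us; apply: same_dec_eval => // r r' rr'.
  by apply: ut => //; rewrite /slot_pos /= rr'.
by apply: us => //; rewrite /slot_pos /= rr'.
Qed.

Definition amp_val k l (G : sgraph kernels k l) (x : 'I_k -> M) (y : 'I_l -> M) : C :=
  Int mu (fun e : gE G -> M => integrand (sumf (sumf x y) e)).

Lemma gamp_smooth k l (G : sgraph kernels k l) :
  is_smooth_kernel (fun x y => amp_val G (tnth x) (tnth y)).
Proof.
apply/smooth_kernelP; have := smoothC_Int mu (@smooth_integrand k l G).
congr smoothC; apply/funext => v; apply: eq_Int => e; congr (integrand (sumf _ _)).
by apply/funext => -[i|i] /=; rewrite tnth_mktuple.
Qed.

Definition gamp k l (G : sgraph kernels k l) : kernels k l := Defs.Kernel (@gamp_smooth k l G).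

Lemma tnth_eq_mktuple m (f : 'I_m -> M) : tnth [tuple f i | i < m] = f.
Proof. by apply/funext => i; rewrite tnth_mktuple. Qed.

(** The bijection between internal edges renames the variables of integration, the
    one between vertices reorders the product. *)
Lemma gamp_iso k l (G H : sgraph kernels k l) : sgraph_iso G H -> gamp G = gamp H.
Proof.
move=> [fV [fE [fI [fO [ha [hb [[bV bE bI bO] [lI lO] ht hs hd]]]]]]].
apply: kernel_eq => x y /=; rewrite /amp_val.
rewrite -(Int_bij mu bE (@smooth_integrand_inner _ _ G _)); apply: eq_Int => e.
have [gV' fVK gVK] := bV.
rewrite /integrand [RHS](reindex fV); last by exists gV' => ? _.
apply: eq_bigr => v _; apply: factor_eq; first by exists (ha v), (hb v).
- move=> s s' sv; have -> : v = projT1 s by [].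
  elim/tgt_ind: s {sv} => [e0|i] E.
    have -> : s' = tgt (sum_map fE fI (inl e0)) by apply: slot_pos_inj; rewrite E ht.
    by rewrite tloc_inner /= tloc_inner.
  have -> : s' = tgt (sum_map fE fI (inr (inedge G i))) by apply: slot_pos_inj; rewrite E ht.
  by rewrite tloc_outer /= lI tloc_outer.
- move=> s s' sv; have -> : v = projT1 s by [].
  elim/src_ind: s {sv} => [e0|i] E.
    have -> : s' = src (sum_map fE fO (inl e0)) by apply: slot_pos_inj; rewrite E hs.
    by rewrite sloc_inner /= sloc_inner.
  have -> : s' = src (sum_map fE fO (inr (outedge G i))) by apply: slot_pos_inj; rewrite E hs.
  by rewrite sloc_outer /= lO sloc_outer.
Qed.

Lemma gamp_lact k l (s : 'S_l) (G : sgraph kernels k l) :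
  gamp (sgraph_lact s G) = k_lact s (gamp G).
Proof.
apply: kernel_eq => x y /=; rewrite tnth_eq_mktuple; apply: eq_Int => e.
apply: eq_bigr => v _; apply: factor_eq; first exact: same_dec_refl.
- move=> t t' tv tt'.
  have {tv tt'} -> : t' = t by apply: slot_pos_inj; rewrite tt' -tv.
  elim/tgt_ind: t => [e0|i].
    by rewrite (@tloc_inner _ _ _ G) (@tloc_inner _ _ _ (sgraph_lact s G)).
  by rewrite (@tloc_outer _ _ _ G) (@tloc_outer _ _ _ (sgraph_lact s G)).
- move=> t t' tv tt'.
  have {tv tt'} -> : t' = t by apply: slot_pos_inj; rewrite tt' -tv.
  elim/(@src_ind _ _ _ (sgraph_lact s G)): t => [e0|i].
    by rewrite (@sloc_inner _ _ _ G) (@sloc_inner _ _ _ (sgraph_lact s G)).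
  by rewrite (@sloc_outer _ _ _ (sgraph_lact s G)) /= (@sloc_outer _ _ _ G) /= permKV.
Qed.

Lemma gamp_ract k l (s : 'S_k) (G : sgraph kernels k l) :
  gamp (sgraph_ract G s) = k_ract (gamp G) s.
Proof.
apply: kernel_eq => x y /=; rewrite tnth_eq_mktuple; apply: eq_Int => e.
apply: eq_bigr => v _; apply: factor_eq; first exact: same_dec_refl.
- move=> t t' tv tt'.
  have {tv tt'} -> : t' = t by apply: slot_pos_inj; rewrite tt' -tv.
  elim/(@tgt_ind _ _ _ (sgraph_ract G s)): t => [e0|i].
    by rewrite (@tloc_inner _ _ _ G) (@tloc_inner _ _ _ (sgraph_ract G s)).
  by rewrite (@tloc_outer _ _ _ (sgraph_ract G s)) /= (@tloc_outer _ _ _ G) /= permK.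
- move=> t t' tv tt'.
  have {tv tt'} -> : t' = t by apply: slot_pos_inj; rewrite tt' -tv.
  elim/src_ind: t => [e0|i].
    by rewrite (@sloc_inner _ _ _ G) (@sloc_inner _ _ _ (sgraph_ract G s)).
  by rewrite (@sloc_outer _ _ _ G) (@sloc_outer _ _ _ (sgraph_ract G s)).
Qed.

End Amplitude.

Section AmplitudeMorphism.
Context {R : realType} {n : nat} {M : closed_manifold R n}.
Variable mu : {finite_measure set (borel M) -> \bar R}.
Local Notation C := R[i].
Local Notation kernels := (smooth_kernels M).
Local Notation T := (kernel_trap mu).

Lemma tnth_tinsert k (i : 'I_k.+1) (z : M) (x : k.-tuple M) :
  (forall a, tnth (tinsert i z x) (lift i a) = tnth x a) /\ tnth (tinsert i z x) i = z.
Proof. by split=> [a|]; rewrite tnth_mktuple ?liftK ?unlift_none. Qed.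

(** The trace turns two external edges into an internal one, that is, the variables
    labelled i and j into one more variable of integration. *)
Lemma gamp_ptr k l (i : 'I_k.+1) (j : 'I_l.+1) (G : sgraph kernels k.+1 l.+1) :
  gamp mu (sgraph_ptr i j G) = k_ptr mu i j (gamp mu G).
Proof.
apply: kernel_eq => x y /=; rewrite /amp_val /=.
rewrite (@Int_option _ _ _ _ (gE G) (fun e => integrand (G := sgraph_ptr i j G)
  (sumf (sumf (tnth x) (tnth y)) e))); last first.
  exact: (@smooth_integrand_inner _ _ _ _ _ (sgraph_ptr i j G)).
apply: eq_cintegral => z; apply: eq_Int => e; apply/esym.
have [xl xi] := tnth_tinsert i z x; have [yl yj] := tnth_tinsert j z y.
pose G' := sgraph_ptr i j G.
apply: eq_bigr => v _; apply: factor_eq; first exact: same_dec_refl.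
- move=> s s' sv ss'; have {sv ss'} -> : s' = s by apply: slot_pos_inj; rewrite ss' -sv.
  elim/tgt_ind: s => [e0|a].
    by rewrite tloc_inner -[tgt _]/(@tgt _ _ _ G' (inl (Some e0))) tloc_inner.
  rewrite tloc_outer; case: (unliftP i a) => [b|] ->.
    by rewrite -[tgt _]/(@tgt _ _ _ G' (inr (inedge G' b))) tloc_outer /= xl.
  by rewrite -[tgt _]/(@tgt _ _ _ G' (inl None)) tloc_inner /= xi.
- move=> s s' sv ss'; have {sv ss'} -> : s' = s by apply: slot_pos_inj; rewrite ss' -sv.
  elim/src_ind: s => [e0|a].
    by rewrite sloc_inner -[src _]/(@src _ _ _ G' (inl (Some e0))) sloc_inner.
  rewrite sloc_outer; case: (unliftP j a) => [b|] ->.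
    by rewrite -[src _]/(@src _ _ _ G' (inr (outedge G' b))) sloc_outer /= yl.
  by rewrite -[src _]/(@src _ _ _ G' (inl None)) sloc_inner /= yj.
Qed.

Lemma integrand_hcat k l k' l' (G : sgraph kernels k l) (H : sgraph kernels k' l')
    (x : (k + k').-tuple M) (y : (l + l').-tuple M) e e' :
  integrand (G := sgraph_hcat G H) (sumf (sumf (tnth x) (tnth y)) (sumf e e')) =
  integrand (sumf (sumf (tnth (tleft x)) (tnth (tleft y))) e) *
  integrand (sumf (sumf (tnth (tright x)) (tnth (tright y))) e').
Proof.
pose GH := sgraph_hcat G H.
have inl_in a : inl (inedge G a) = inedge GH (lshift k' a).
  by rewrite /= /cat_labels (unsplitK (inl _)).
have inr_in a : inr (inedge H a) = inedge GH (rshift k a).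
  by rewrite /= /cat_labels (unsplitK (inr _)).
have inl_out a : inl (outedge G a) = outedge GH (lshift l' a).
  by rewrite /= /cat_labels (unsplitK (inl _)).
have inr_out a : inr (outedge H a) = outedge GH (rshift l a).
  by rewrite /= /cat_labels (unsplitK (inr _)).
rewrite [LHS]big_sumType /=; congr (_ * _); apply: eq_bigr => v _; apply/esym;
  apply: factor_eq; try exact: same_dec_refl.
- move=> s s' sv; have -> : v = projT1 s by []. elim/tgt_ind: s {sv} => [e0|a] E.
    have -> : s' = @tgt _ _ _ GH (inl (inl e0)) by apply: slot_pos_inj; rewrite E.
    by rewrite !tloc_inner.
  have -> : s' = @tgt _ _ _ GH (inr (inedge GH (lshift k' a))).
    by apply: slot_pos_inj; rewrite E -inl_in.
  by rewrite !tloc_outer /= tnth_mktuple.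
- move=> s s' sv; have -> : v = projT1 s by []. elim/src_ind: s {sv} => [e0|a] E.
    have -> : s' = @src _ _ _ GH (inl (inl e0)) by apply: slot_pos_inj; rewrite E.
    by rewrite !sloc_inner.
  have -> : s' = @src _ _ _ GH (inr (outedge GH (lshift l' a))).
    by apply: slot_pos_inj; rewrite E -inl_out.
  by rewrite !sloc_outer /= tnth_mktuple.
- move=> s s' sv; have -> : v = projT1 s by []. elim/tgt_ind: s {sv} => [e0|a] E.
    have -> : s' = @tgt _ _ _ GH (inl (inr e0)) by apply: slot_pos_inj; rewrite E.
    by rewrite !tloc_inner.
  have -> : s' = @tgt _ _ _ GH (inr (inedge GH (rshift k a))).
    by apply: slot_pos_inj; rewrite E -inr_in.
  by rewrite !tloc_outer /= tnth_mktuple.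
- move=> s s' sv; have -> : v = projT1 s by []. elim/src_ind: s {sv} => [e0|a] E.
    have -> : s' = @src _ _ _ GH (inl (inr e0)) by apply: slot_pos_inj; rewrite E.
    by rewrite !sloc_inner.
  have -> : s' = @src _ _ _ GH (inr (outedge GH (rshift l a))).
    by apply: slot_pos_inj; rewrite E -inr_out.
  by rewrite !sloc_outer /= tnth_mktuple.
Qed.

(** The integrand of a disjoint union is a product of two functions of disjoint
    sets of variables. *)
Lemma gamp_hcat k l k' l' (G : sgraph kernels k l) (H : sgraph kernels k' l') :
  gamp mu (sgraph_hcat G H) = k_hcat (gamp mu G) (gamp mu H).
Proof.
apply: kernel_eq => x y /=; rewrite /amp_val.
rewrite (@Int_sum _ _ _ _ (gE G) (gE H) (fun e => integrand (G := sgraph_hcat G H)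
  (sumf (sumf (tnth x) (tnth y)) e))); last first.
  exact: (@smooth_integrand_inner _ _ _ _ _ (sgraph_hcat G H)).
rewrite -Int_prod; try exact: smooth_integrand_inner.
by apply: eq_Int => e; apply: eq_Int => e'; exact: integrand_hcat.
Qed.

Lemma gamp_one : gamp mu (sgraph_one kernels) = k_hone.
Proof.
apply: kernel_eq => x y /=; rewrite /amp_val.
rewrite (@Int_void _ _ _ _ _ _ (fun=> point)) ?card_void //.
by rewrite /integrand big1 // => -[].
Qed.

Lemma gamp_corolla k l (p : kernels k l) : gamp mu (corolla p) = p.
Proof.
apply: kernel_eq => x y /=; rewrite /amp_val.
rewrite (@Int_void _ _ _ _ _ _ (fun=> point)) ?card_void //.
rewrite /integrand (big_pred1 tt); last by case.
rewrite /factor /=; congr (kfun p _ _); apply: eq_from_tnth => i; rewrite tnth_mktuple.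
  by rewrite -[existT _ _ _]/(@tgt _ _ _ (corolla p) (inr (inedge (corolla p) i))) tloc_outer.
by rewrite -[existT _ _ _]/(@src _ _ _ (corolla p) (inr (outedge (corolla p) i))) sloc_outer.
Qed.

Definition amplitude k l (A : solCGr kernels k l) : kernels k l := gamp mu (grepr A).

Lemma amplitude_gclass k l (G : sgraph kernels k l) : amplitude (gclass G) = gamp mu G.
Proof. by apply: gamp_iso; apply: iso_of_pos_iso; exact: grepr_pos_iso. Qed.

Theorem amplitude_is_amplitude : is_amplitude T amplitude.
Proof.
split=> [|k l p]; last by rewrite amplitude_gclass gamp_corolla.
split=> *; rewrite [LHS]amplitude_gclass.
- exact: gamp_lact.
- exact: gamp_ract.
- exact: gamp_hcat.
- exact: gamp_one.
- exact: gamp_ptr.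
Qed.

End AmplitudeMorphism.

(** * TRAP morphisms and vertical concatenation *)

Section MorphismComposition.
Variables (P Q : nat -> nat -> Type) (T : trap_ops P) (U : trap_ops Q).
Variable f : forall k l, P k l -> Q k l.
Hypothesis fT : is_trap_morphism T U f.

Lemma morph_pcast k k' l l' (ek : k = k') (el : l = l') (p : P k l) :
  f (pcast ek el p) = pcast ek el (f p).
Proof. by subst k' l'. Qed.

Lemma morph_vtrace k l m (p : P (k + l)%N (l + m)%N) :
  f (vtrace T p) = vtrace U (f p).
Proof.
elim: l p => [|l IH] p /=; first exact: morph_pcast.
by rewrite IH (morph_ptr fT) morph_pcast.
Qed.

Lemma morph_vcomp k l m (q : P l m) (p : P k l) :
  f (vcomp T q p) = vcomp U (f q) (f p).
Proof. by rewrite /vcomp morph_vtrace (morph_hcat fT). Qed.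

End MorphismComposition.

Theorem theorem4p3p4 (R : realType) (n : nat) (M : closed_manifold R n)
    (orientM : orientable M) (om : volume_form M)
    (mu : {measure set (borel M) -> \bar R})
    (mu_om : is_volume_measure om mu) :
  exists T : trap_ops (smooth_kernels M),
    [/\ is_kernel_ops mu T,
        is_trap T,
        forall k l m (K1 : smooth_kernels M k l) (K2 : smooth_kernels M l m) x z,
          vcomp T K2 K1 x z = vtrace T (hcat T K1 K2) x z /\
          vtrace T (hcat T K1 K2) x z =
            cintegral (pow_measure mu l) (fun y => K1 x y * K2 y z),
        forall k l m p (K1 : smooth_kernels M k l) (K2 : smooth_kernels M l m) (K3 : smooth_kernels M m p),
          let lhs x z :=
            cintegral (pow_measure mu m) (fun y2 =>
              cintegral (pow_measure mu l) (fun y1 =>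
                K1 x y1 * K2 y1 y2) * K3 y2 z) in
          let rhs x z :=
            cintegral (pow_measure mu l) (fun y1 =>
              K1 x y1 * cintegral (pow_measure mu m) (fun y2 =>
                K2 y1 y2 * K3 y2 z)) in
          [/\ forall x z, vcomp T K3 (vcomp T K2 K1) x z = lhs x z,
              forall x z, vcomp T (vcomp T K3 K2) K1 x z = rhs x z,
              vcomp T K3 (vcomp T K2 K1) = vcomp T (vcomp T K3 K2) K1 <->
                (forall x z, lhs x z = rhs x z),
              vcomp T K3 (vcomp T K2 K1) = vcomp T (vcomp T K3 K2) K1
            & forall x z, lhs x z = rhs x z]
      & [/\ forall k (K : smooth_kernels M k k),
              gtrace T K [tuple] [tuple] =
                cintegral (pow_measure mu k) (fun x => K x x),
            forall k l (K1 : smooth_kernels M k l) (K2 : smooth_kernels M l k),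
              gtrace T (vcomp T K2 K1) = gtrace T (vcomp T K1 K2),
            exists Phi : forall k l, solCGr (smooth_kernels M) k l -> smooth_kernels M k l,
              is_amplitude T Phi
          & forall Phi : forall k l, solCGr (smooth_kernels M) k l -> smooth_kernels M k l,
              is_amplitude T Phi ->
              (forall k l k' l' (G1 : solCGr (smooth_kernels M) k l)
                  (G2 : solCGr (smooth_kernels M) k' l'),
                Phi _ _ (hcat (solCGr_ops (smooth_kernels M)) G1 G2) =
                hcat T (Phi _ _ G1) (Phi _ _ G2)) /\
              (forall k l m (G1 : solCGr (smooth_kernels M) l m)
                  (G2 : solCGr (smooth_kernels M) k l),
                Phi _ _ (solCGr_comp G1 G2) =
                vcomp T (Phi _ _ G1) (Phi _ _ G2))]].
Proof.
have [m mE] := finite_bundle (volume_finite mu_om).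
rewrite -mE; have ampP := amplitude_is_amplitude m.
exists (kernel_trap m); split.
- exact: kernel_trap_ops.
- exact: kernel_is_trap.
- move=> k l p K1 K2 x z; split=> //.
  exact: (vcomp_convolution m K1 K2 x z).
- move=> k l p q K1 K2 K3 lhs rhs.
  have lhsE x z : vcomp (kernel_trap m) K3 (vcomp (kernel_trap m) K2 K1) x z = lhs x z.
    rewrite vcomp_convolution; apply: eq_cintegral => y2.
    by rewrite vcomp_convolution.
  have rhsE x z : vcomp (kernel_trap m) (vcomp (kernel_trap m) K3 K2) K1 x z = rhs x z.
    rewrite vcomp_convolution; apply: eq_cintegral => y1.
    by rewrite vcomp_convolution.
  have fub x z : lhs x z = rhs x z by rewrite -lhsE -rhsE vcompA_fubini.
  split=> //; last exact: vcompA_fubini.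
  by split=> // _; exact: vcompA_fubini.
- split.
  + exact: gtrace_diagonal.
  + exact: gtrace_cyclic.
  + by exists (@amplitude _ _ _ m).
  + move=> Phi [PhiM _]; split=> *; first exact: (morph_hcat PhiM).
    by rewrite solCGr_compE (morph_vcomp PhiM).
Qed.
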